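(* Let $S$ be a formula with structure constants $F_n^k(u,v)\in S$ (see context), and assume that $\langle\mathrm{Jacobi}\rangle\subset D\,\mathbb{C}[D]\otimes S$ and that $F_n^0(u,v)=-\varepsilon_{u,v}(-1)^nF_n^0(v,u)$ for all homogeneous $u,v\in S$ and $n\ge0$. Then there exist a vertex superalgebra $V$ and an injective homomorphism $\varphi:S\to V$ such that $V$ is generated (as a vertex superalgebra) by $\varphi(S)$, and, writing $Y(u,z)$ for $Y_V(\varphi(u),z)$ and $Y(F_n^k(u,v),z)$ for $Y_V(\varphi(F_n^k(u,v)),z)$, the commutator formula $$[Y(u,z_1),Y(v,z_2)]=\sum_{n,k\ge0}\frac{(-1)^n}{n!}\Big(\frac{d}{dz_1}\Big)^nz_2^{-1}\delta(z_1/z_2)\Big(\frac{d}{dz_2}\Big)^kY(F_n^k(u,v),z_2)$$ holds for all $u,v\in S$. Moreover, among all such pairs $(V,\varphi)$ there is one, $(\mathcal{V}(\langle S\rangle),\iota)$, such that for every other such pair $(V,\varphi)$ there is a surjective homomorphism of vertex superalgebras $\mathcal{V}(\langle S\rangle)\to V$ whose composite with $\iota$ is $\varphi$. Finally, for every such pair and all $u,v\in S$, $n\ge0$, one has $\varphi(u)_n\varphi(v)=\sum_{k\ge0}D^k\varphi(F_n^k(u,v))$.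
   Context: All spaces over $\mathbb{C}$; $\varepsilon_{u,v}=(-1)^{|u||v|}$ for homogeneous $u,v$; $\delta(z)=\sum_{n\in\mathbb{Z}}z^n$. A formula is a $\mathbb{Z}_2$-graded space $S$ with parity-preserving linear maps $F_n:S\otimes S\to\mathbb{C}[D]\otimes S$ ($n\in\mathbb{N}$; $\mathbb{C}[D]$, formal polynomials in $D$, is even) such that $F_n(u,v)=0$ for $n$ large. Write $u_nv=F_n(u,v)=\sum_{k\ge0}D^k\otimes F_n^k(u,v)$ with $F_n^k(u,v)\in S$; identify $S$ with $1\otimes S$ and let $D(D^k\otimes u)=D^{k+1}\otimes u$. The products extend uniquely to bilinear products $A_nB$ ($n\in\mathbb{N}$) on $\mathbb{C}[D]\otimes S$ with $(DA)_nB=-nA_{n-1}B$ and $D(A_nB)=(DA)_nB+A_n(DB)$; explicitly $\sum_{n\ge0}(P(D)u)_n(Q(D)v)z^{-n-1}=P(\frac{d}{dz})Q(D-\frac{d}{dz})\sum_{n\ge0}(u_nv)z^{-n-1}$. A two-sided ideal of $\mathbb{C}[D]\otimes S$ is a subspace $I$ with $A_nI\subset I$ and $I_nA\subset I$ for all $A$ and $n\ge0$. $\langle\mathrm{Jacobi}\rangle$ is the two-sided ideal of $\mathbb{C}[D]\otimes S$ generated by all elements $u_m(v_nw)-\varepsilon_{u,v}v_n(u_mw)-\sum_{i\ge0}\binom{m}{i}(u_iv)_{n+m-i}w$ with $u,v,w\in\mathbb{C}[D]\otimes S$ homogeneous and $m,n\in\mathbb{N}$. Vertex superalgebra: $\mathbb{Z}_2$-graded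 $V$, even vacuum $\mathbf{1}$, even $D$, products $u_nv$ ($n\in\mathbb{Z}$), $Y(u,z)=\sum u_nz^{-n-1}$, with truncation ($u_nv=0$ for $n\gg0$), $|u_nv|=|u|+|v|$, $[D,Y(u,z)]=Y(Du,z)=\frac{d}{dz}Y(u,z)$, $Y(\mathbf{1},z)=\mathrm{id}$, $u_n\mathbf{1}=0$ ($n\ge0$), $u_{-1}\mathbf{1}=u$, and the Jacobi identity $z_0^{-1}\delta(\frac{z_1-z_2}{z_0})Y(u,z_1)Y(v,z_2)-\varepsilon_{u,v}z_0^{-1}\delta(\frac{z_2-z_1}{-z_0})Y(v,z_2)Y(u,z_1)=z_2^{-1}\delta(\frac{z_1-z_0}{z_2})Y(Y(u,z_0)v,z_2)$. A homomorphism of vertex superalgebras is a parity-preserving linear map preserving all products $u_nv$, $n\in\mathbb{Z}$. A homomorphism from the formula $S$ to a vertex superalgebra $V$ is a parity-preserving linear map $\varphi:S\to V$ such that $\tilde\varphi:\mathbb{C}[D]\otimes S\to V$, $D^k\otimes u\mapsto D^k\varphi(u)$, satisfies $\tilde\varphi(u_nv)=\varphi(u)_n\varphi(v)$ for all $u,v\in S$, $n\ge0$. *)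

(* Defs.v *)
(* Scalars: the complex numbers, realised as R[i] for an
   arbitrary R : realType (every realType is a model of the real numbers). *)
From HB Require Import structures.
From mathcomp Require Import all_boot all_order all_algebra.
From mathcomp Require Import reals complex.
Set Implicit Arguments. Unset Strict Implicit. Unset Printing Implicit Defensive.
Import Order.TTheory GRing.Theory Num.Theory.
Local Open Scope ring_scope.

Section Defs.
Variable K : fieldType.

Definition is_linear (U W : lmodType K) (f : U -> W) : Prop :=
  forall (a : K) (x y : U), f (a *: x + y) = a *: f x + f y.

Definition is_subspace (U : lmodType K) (P : U -> Prop) : Prop :=
  [/\ P 0, (forall x y, P x -> P y -> P (x + y)) & (forall (a : K) x, P x -> P (a *: x))].

Definition is_Z2grading (U : lmodType K) (U0 U1 : U -> Prop) : Prop :=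
  [/\ is_subspace U0, is_subspace U1,
      (forall x, exists x0 x1, [/\ U0 x0, U1 x1 & x = x0 + x1]) &
      (forall x, U0 x -> U1 x -> x = 0)].

Definition homog (U : lmodType K) (U0 U1 : U -> Prop) (b : bool) (x : U) : Prop :=
  if b then U1 x else U0 x.

Definition eps (a b : bool) : K := if a && b then -1 else 1.

Definition binz (r : int) (i : nat) : int :=
  match r with
  | Posz m => ('C(m, i))%:Z
  | Negz m => ((-1) ^+ i * ('C(m + i, i))%:Z)%R
  end.

(* (d/dz)^n z^e = dcoef e n * z^(e-n),  dcoef e n = e(e-1)...(e-n+1) *)
Definition dcoef (e : int) (n : nat) : int := \prod_(i < n) (e - i%:Z).

(* A formula: Z2-graded space S = S0 (+) S1 together with the structure
   constants F n k u v = F_n^k(u,v), i.e. u_n v = sum_k D^k (x) F n k u v. *)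
Definition is_formula (S : lmodType K) (S0 S1 : S -> Prop)
    (F : nat -> nat -> S -> S -> S) : Prop :=
  [/\ is_Z2grading S0 S1,
      (forall n k v, is_linear (fun u => F n k u v)) /\
      (forall n k u, is_linear (fun v => F n k u v)),
      (* parity preserving (D is even) *)
      (forall n k a b u v, homog S0 S1 a u -> homog S0 S1 b v ->
                           homog S0 S1 (a (+) b) (F n k u v)),
      (* F_n(u,v) lies in C[D] (x) S : finitely many k *)
      (forall n u v, exists N, forall k, (N <= k)%N -> F n k u v = 0) &
      (forall u v, exists N, forall n k, (N <= n)%N -> F n k u v = 0)].

(* Elements of C[D] (x) S are represented by their coefficient functions
   x : nat -> S (x = sum_k D^k (x) x k) with finite support. *)
Definition fin_supp (S : lmodType K) (x : nat -> S) : Prop :=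
  exists N, forall k, (N <= k)%N -> x k = 0.

Definition homogD (S : lmodType K) (S0 S1 : S -> Prop) (b : bool) (x : nat -> S) : Prop :=
  forall k, homog S0 S1 b (x k).

(* The extension of the products to C[D] (x) S, obtained from
   sum_n (P(D)u)_n (Q(D)v) z^{-n-1} = P(d/dz) Q(D - d/dz) sum_n (u_n v) z^{-n-1}:
   (D^a u)_n (D^b v) = sum_j (-1)^a C(b,j) n!/(n-j-a)! D^(b-j) (u_(n-j-a) v).
   The coefficient of D^k of A_n B is the following finite sum. *)
Definition cprod (S : lmodType K) (F : nat -> nat -> S -> S -> S) (n : nat)
    (A B : nat -> S) : nat -> S :=
  fun k => \sum_(a < n.+1) \sum_(j < (n - a).+1) \sum_(l < k.+1)
     (((-1) ^+ a * ('C(k - l + j, j))%:R * (n ^_ (j + a))%:R : K)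
        *: F (n - j - a)%N l (A a) (B (k - l + j)%N)).

Definition fadd (S : lmodType K) (x y : nat -> S) : nat -> S := fun k => x k + y k.
Definition fscale (S : lmodType K) (c : K) (x : nat -> S) : nat -> S := fun k => c *: x k.

Definition two_sided_ideal (S : lmodType K) (F : nat -> nat -> S -> S -> S)
    (I : (nat -> S) -> Prop) : Prop :=
  [/\ (forall x, I x -> fin_supp x),
      I (fun _ => 0),
      (forall x y, I x -> I y -> I (fadd x y)),
      (forall c x, I x -> I (fscale c x)) &
      (forall A x n, fin_supp A -> I x -> I (cprod F n A x) /\ I (cprod F n x A))].

Definition jacobi_elem (S : lmodType K) (F : nat -> nat -> S -> S -> S)
    (a b : bool) (u v w : nat -> S) (m n : nat) : nat -> S :=
  fun k => cprod F m u (cprod F n v w) k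
           - eps a b *: cprod F n v (cprod F m u w) k
           - \sum_(i < m.+1) ('C(m, i))%:R *: cprod F (n + m - i)%N (cprod F i u v) w k.

Definition is_jacobi_generator (S : lmodType K) (S0 S1 : S -> Prop)
    (F : nat -> nat -> S -> S -> S) (g : nat -> S) : Prop :=
  exists a b c u v w m n,
    [/\ fin_supp u /\ fin_supp v /\ fin_supp w,
        homogD S0 S1 a u, homogD S0 S1 b v, homogD S0 S1 c w &
        g = jacobi_elem F a b u v w m n].

Definition jacobi_ideal (S : lmodType K) (S0 S1 : S -> Prop)
    (F : nat -> nat -> S -> S -> S) (x : nat -> S) : Prop :=
  forall I, two_sided_ideal F I -> (forall g, is_jacobi_generator S0 S1 F g -> I g) -> I x.

Definition is_vsa (V : lmodType K) (V0 V1 : V -> Prop) (vac : V) (D : V -> V)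
    (prod : int -> V -> V -> V) : Prop :=
  [/\ is_Z2grading V0 V1 /\
      (forall n v, is_linear (fun u => prod n u v)) /\
      (forall n u, is_linear (fun v => prod n u v)),
      (forall u v, exists N : int, forall n, N <= n -> prod n u v = 0) /\
      [/\ (forall a b u v n, homog V0 V1 a u -> homog V0 V1 b v ->
            homog V0 V1 (a (+) b) (prod n u v)),
          homog V0 V1 false vac,
          is_linear D &
          (forall b u, homog V0 V1 b u -> homog V0 V1 b (D u))],
      (* [D, Y(u,z)] = Y(Du,z) = d/dz Y(u,z) *)
      (forall u v n, D (prod n u v) - prod n u (D v) = prod n (D u) v) /\
      (forall u v n, prod n (D u) v = - (n%:~R : K) *: prod (n - 1) u v),
      [/\ (forall n v, prod n vac v = (if n == -1 then v else 0)),
          (forall u n, 0 <= n -> prod n u vac = 0) &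
          (forall u, prod (-1) u vac = u)] &
      (* Jacobi identity, written as the identity of coefficients of
         z0^{-r-1} z1^{-p-1} z2^{-q-1}; all sums are finite by truncation,
         M is any bound beyond which every summand vanishes *)
      (forall a b u v w (p q r : int) (M : nat),
         homog V0 V1 a u -> homog V0 V1 b v ->
         (forall i : nat, (M <= i)%N ->
            [/\ prod (r + i%:Z) u v = 0, prod (q + i%:Z) v w = 0 & prod (p + i%:Z) u w = 0]) ->
         \sum_(i < M) ((binz p i)%:~R : K) *: prod (p + q - i%:Z) (prod (r + i%:Z) u v) w
         = \sum_(i < M) (((-1) ^+ i * binz r i)%:~R : K) *:
              (prod (p + r - i%:Z) u (prod (q + i%:Z) v w)
               - (eps a b * (-1) ^ r) *: prod (q + r - i%:Z) v (prod (p + i%:Z) u w)))].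

End Defs.
Arguments eps {K} a b.

Record vsa (K : fieldType) := VSA {
  vs_car : lmodType K;
  vs_even : vs_car -> Prop;
  vs_odd : vs_car -> Prop;
  vs_vac : vs_car;
  vs_D : vs_car -> vs_car;
  vs_prod : int -> vs_car -> vs_car -> vs_car;
  vs_ax : is_vsa vs_even vs_odd vs_vac vs_D vs_prod }.
Arguments vs_car {K} v.
Arguments vs_even {K} v _.
Arguments vs_odd {K} v _.
Arguments vs_vac {K} v.
Arguments vs_D {K} v _.
Arguments vs_prod {K} v _ _ _.

Section Morphisms.
Variable K : fieldType.
Local Open Scope ring_scope.

Definition vhomog (V : vsa K) (b : bool) (x : vs_car V) : Prop :=
  homog (vs_even V) (vs_odd V) b x.

Definition vsa_hom (V W : vsa K) (f : vs_car V -> vs_car W) : Prop :=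
  [/\ is_linear f,
      (forall b x, vhomog b x -> vhomog b (f x)) &
      (forall n x y, f (vs_prod V n x y) = vs_prod W n (f x) (f y))].

Definition vsa_generated_by (V : vsa K) (G : vs_car V -> Prop) : Prop :=
  forall W : vs_car V -> Prop,
    is_subspace W -> W (vs_vac V) ->
    (forall n x y, W x -> W y -> W (vs_prod V n x y)) ->
    (forall x, G x -> W x) -> forall x, W x.

Definition formula_hom (S : lmodType K) (S0 S1 : S -> Prop)
    (F : nat -> nat -> S -> S -> S) (V : vsa K) (phi : S -> vs_car V) : Prop :=
  [/\ is_linear phi,
      (forall b u, homog S0 S1 b u -> vhomog b (phi u)) &
      (forall (u v : S) (n N : nat), (forall k, (N <= k)%N -> F n k u v = 0) ->
         vs_prod V (n%:Z) (phi u) (phi v)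
         = \sum_(k < N) iter k (vs_D V) (phi (F n k u v)))].

(* the commutator formula, coefficient of z1^{-m-1} z2^{-p-1}:
   [u_m, v_p] = sum_{n,k} (-1)^n/n! * (coefficient from (d/dz1)^n z2^{-1} delta(z1/z2))
                 * (coefficient from (d/dz2)^k Y(F_n^k(u,v), z2)).
   Here with e := n - m - 1 the exponent of z1 in z1^e z2^{-e-1} before
   differentiating, and q := m + p - n - k the mode of F_n^k(u,v). *)
Definition commutator_formula (S : lmodType K) (S0 S1 : S -> Prop)
    (F : nat -> nat -> S -> S -> S) (V : vsa K) (phi : S -> vs_car V) : Prop :=
  forall (a b : bool) (u v : S) (m p : int) (N : nat),
    homog S0 S1 a u -> homog S0 S1 b v ->
    (forall n k, (N <= n)%N \/ (N <= k)%N -> F n k u v = 0) ->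
    forall w : vs_car V,
    vs_prod V m (phi u) (vs_prod V p (phi v) w)
      - eps a b *: vs_prod V p (phi v) (vs_prod V m (phi u) w)
    = \sum_(n < N) \sum_(k < N)
        (((-1) ^+ n / (n`!)%:R) * (dcoef (n%:Z - m - 1) n)%:~R
           * (dcoef (- (m + p - n%:Z - k%:Z) - 1) k)%:~R : K)
        *: vs_prod V (m + p - n%:Z - k%:Z) (phi (F n k u v)) w.

Definition good_pair (S : lmodType K) (S0 S1 : S -> Prop)
    (F : nat -> nat -> S -> S -> S) (V : vsa K) (phi : S -> vs_car V) : Prop :=
  [/\ formula_hom S0 S1 F phi, injective phi,
      vsa_generated_by (fun x => exists s, x = phi s) &
      commutator_formula S0 S1 F phi].

End Morphisms.

(* Main.v *)
(* The algebra generated by [S].  Let M be the module spanned by the words in symbols u_n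
   ([u] in [S], [n] an integer) applied to a vacuum vector, modulo the commutator formula
   dictated by the [F_n^k] and u_n 1 = 0 for n >= 0.  The series u(z) are pairwise local
   fields on M, so by Dong's lemma all fields obtained from them by the n-th products are
   local, and a translation covariant local field is determined by the vector it creates from
   the vacuum.  These fields therefore form a vertex superalgebra, and its vectors are the
   states they create.  For any pair (V, phi), the words act on the vacuum of V, which gives
   the homomorphism onto V.

   Injectivity.  It remains to see that u_(-1) 1 = 0 in M only if u = 0.  The loop space
   S[t, t^-1], with the bracket given by the commutator formula, becomes a Lie superalgebra L
   after dividing by the modes A_m with A in <Jacobi> and by the skew-symmetry defects; it is
   the sum of the subalgebras L- and L+ spanned by the negative and the nonnegative modes.
   The map u_(-1) -> u, zero on the other modes, kills the modes of <Jacobi> because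
   <Jacobi> lies in D C[D] (x) S, and the defects because of the skew-symmetry of the F_n^0;
   a defect is first expanded into defects of single products, of which only the terms F_n^0
   are seen.  It is thus defined on L-, and extends to a form on the enveloping algebra of L-,
   which is the module induced from the trivial L+-module.  This extension replaces the PBW
   theorem and uses characteristic zero: the value on a word is the average, over its letters,
   of the commutators produced by moving that letter to the front, the remaining letters being
   handled recursively. *)

Require Import Defs.
From HB Require Import structures.
From mathcomp Require Import all_boot all_order all_algebra.
From mathcomp Require Import generic_quotient ring zify.
From mathcomp Require Import boolp functions.
From mathcomp Require Import reals complex.
Set Implicit Arguments. Unset Strict Implicit. Unset Printing Implicit Defensive.
Import Order.TTheory GRing.Theory Num.Theory.
Local Open Scope ring_scope.

(** [vmod] imposes on words only what every target satisfies, the commutator formula and the vacuum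
    condition; neither skew-symmetry nor <Jacobi> is among its relators. The map onto any [V] is
    then easy to build, and the danger is that [S] collapses. The enveloping algebra serves that
    question alone: its form takes values in [S] itself and is a retraction.

    Reading off the coefficient of t^-1 is blind to D C[D] (x) S because (D A)_m = - m A_(m - 1):
    the mode A_(-1) could only come from D A at m = 0, where the factor vanishes.

    A bracket of a nonnegative with a negative mode has terms in both halves of L, so the
    skew-symmetry relations cannot be projected one by one. The remedy is a recurrence: a family
    with Z_(r+1)(p, q) = Z_r(p + 1, q) - Z_r(p, q + 1) that vanishes for large r is determined by
    its row p = 0 ([cascade]). The same fact gives the Jacobi identity for local fields.

    No homogeneous basis of [S] is chosen. Every letter carries a parity bit that selects a
    component of its vector, and a field is a pair of components. *)

Section Linear.
Variable K : fieldType.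
Implicit Types U W Z : lmodType K.

Section OneMap.
Variables (U W : lmodType K) (f : U -> W).
Hypothesis fL : is_linear f.

Lemma lin0 : f 0 = 0.
Proof.
have := fL 1 0 0; rewrite !scale1r addr0 => h.
by apply: (addrI (f 0)); rewrite -h addr0.
Qed.

Lemma linD x y : f (x + y) = f x + f y.
Proof. by have := fL 1 x y; rewrite !scale1r. Qed.

Lemma linZ c x : f (c *: x) = c *: f x.
Proof. by have := fL c x 0; rewrite !addr0 lin0 addr0. Qed.

Lemma linN x : f (- x) = - f x.
Proof. by rewrite -scaleN1r linZ scaleN1r. Qed.

Lemma linB x y : f (x - y) = f x - f y.
Proof. by rewrite linD linN. Qed.

Lemma lin_sum I (r : seq I) (P : pred I) F :
  f (\sum_(i <- r | P i) F i) = \sum_(i <- r | P i) f (F i).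
Proof. by elim/big_rec2: _ => [|i y x _ <-]; rewrite ?lin0 ?linD. Qed.
End OneMap.

Lemma lin_comp U W Z (f : U -> W) (g : W -> Z) :
  is_linear f -> is_linear g -> is_linear (g \o f).
Proof. by move=> fL gL a x y; rewrite /= fL gL. Qed.

Lemma lin_scale U W c (f : U -> W) : is_linear f -> is_linear (fun x => c *: f x).
Proof. by move=> fL a x y; rewrite fL scalerDr !scalerA mulrC. Qed.

Lemma lin_add U W (f g : U -> W) :
  is_linear f -> is_linear g -> is_linear (fun x => f x + g x).
Proof. by move=> fL gL a x y; rewrite fL gL scalerDr addrACA. Qed.

Lemma lin_opp U W (f : U -> W) : is_linear f -> is_linear (fun x => - f x).
Proof. by move=> fL a x y; rewrite fL opprD scalerN. Qed.

Lemma lin_zero U W : is_linear (fun _ : U => 0 : W).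
Proof. by move=> a x y; rewrite scaler0 addr0. Qed.

Lemma lin_bigsum U W I (r : seq I) (P : pred I) (f : I -> U -> W) :
  (forall i, is_linear (f i)) -> is_linear (fun x => \sum_(i <- r | P i) f i x).
Proof.
move=> fL a x y; rewrite scaler_sumr -big_split; apply: eq_bigr => i _.
exact: fL.
Qed.

Lemma lin_if U W (b : bool) (f : U -> W) :
  is_linear f -> is_linear (fun x => if b then f x else 0).
Proof. by case: b => // _; apply: lin_zero. Qed.

Lemma lin_id U : is_linear (fun x : U => x).
Proof. by []. Qed.

End Linear.

(** * Modules given by generators and relations *)

Section Presentation.
Variable K : fieldType.
Local Open Scope quotient_scope.

Inductive term (X : Type) :=
  TZ | TA of term X & term X | TS of K & term X | TG of X.
Arguments TZ {X}.

Fixpoint ext X (W : lmodType K) (phi : X -> W) (t : term X) : W :=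
  match t with
  | TZ => 0
  | TA x y => ext phi x + ext phi y
  | TS c x => c *: ext phi x
  | TG x => phi x
  end.

Lemma eq_ext X (W : lmodType K) (f g : X -> W) : f =1 g -> ext f =1 ext g.
Proof. by move=> e; elim=> //= [x -> y ->|c x ->]. Qed.

Lemma ext_comp X (U W : lmodType K) (f : U -> W) (phi : X -> U) t :
  is_linear f -> f (ext phi t) = ext (f \o phi) t.
Proof.
move=> fL; elim: t => //= [|x IHx y IHy|c x IHx].
- exact: lin0.
- by rewrite linD // IHx IHy.
- by rewrite linZ // IHx.
Qed.

Section Pres.
Variables (X : Type) (Rl : term X -> Prop).

HB.instance Definition _ := gen_eqMixin (term X).
HB.instance Definition _ := gen_choiceMixin (term X).

Definition kills (W : lmodType K) (phi : X -> W) := forall r, Rl r -> ext phi r = 0.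

(* This impredicative definition replaces the congruence generated by the relators, and
   gives the universal property at once. *)
Definition teq (x y : term X) : bool :=
  `[< forall (W : lmodType K) (phi : X -> W), kills phi -> ext phi x = ext phi y >].

Lemma teq_refl : reflexive teq. Proof. by move=> x; apply/asboolP. Qed.
Lemma teq_sym : symmetric teq.
Proof. by move=> x y; apply/asboolP/asboolP => h W phi k; rewrite h. Qed.
Lemma teq_trans : transitive teq.
Proof.
by move=> y x z /asboolP h1 /asboolP h2; apply/asboolP => W phi k; rewrite h1 // h2.
Qed.
Canonical teq_equiv := EquivRel teq teq_refl teq_sym teq_trans.

Definition pres := {eq_quot teq}.
HB.instance Definition _ := Choice.on pres.
HB.instance Definition _ := EqQuotient.on pres.

Local Notation p := (\pi_pres).

Lemma pE (x y : term X) : p x = p y <->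
  forall (W : lmodType K) (phi : X -> W), kills phi -> ext phi x = ext phi y.
Proof.
split; first by move/eqmodP/asboolP.
by move=> h; apply/eqmodP/asboolP.
Qed.

Lemma repr_ext (x : term X) (W : lmodType K) (phi : X -> W) :
  kills phi -> ext phi (repr (p x)) = ext phi x.
Proof. by move=> k; move: k; apply: (iffLR (pE _ _)); rewrite reprK. Qed.

Definition padd (x y : pres) := p (TA (repr x) (repr y)).
Definition popp (x : pres) := p (TS (-1) (repr x)).
Definition pscale c (x : pres) := p (TS c (repr x)).

Fact paddA : associative padd.
Proof.
move=> x y z; apply/pE => W phi k /=.
by rewrite !repr_ext //= addrA.
Qed.
Fact paddC : commutative padd.
Proof. by move=> x y; apply/pE => W phi k /=; rewrite addrC. Qed.
Fact padd0 : left_id (p TZ) padd.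
Proof.
move=> x; rewrite -[RHS]reprK; apply/pE => W phi k /=.
by rewrite repr_ext //= add0r.
Qed.
Fact paddN : left_inverse (p TZ) popp padd.
Proof. by move=> x; apply/pE => W phi k /=; rewrite repr_ext //= scaleN1r addNr. Qed.

HB.instance Definition _ := GRing.isZmodule.Build pres paddA paddC padd0 paddN.

Fact pscaleA a b (x : pres) : pscale a (pscale b x) = pscale (a * b) x.
Proof. by apply/pE => W phi k /=; rewrite repr_ext //= scalerA. Qed.
Fact pscale1 : left_id 1 pscale.
Proof.
by move=> x; rewrite -[RHS]reprK; apply/pE => W phi k /=; rewrite scale1r.
Qed.
Fact pscaleDr : right_distributive pscale +%R.
Proof.
by move=> a x y; apply/pE => W phi k /=; rewrite !repr_ext //= scalerDr.
Qed.
Fact pscaleDl (x : pres) : {morph pscale^~ x : a b / a + b}.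
Proof.
by move=> a b /=; apply/pE => W phi k /=; rewrite !repr_ext //= scalerDl.
Qed.

HB.instance Definition _ := GRing.Zmodule_isLmodule.Build K pres
  pscaleA pscale1 pscaleDr pscaleDl.

Definition pgen (x : X) : pres := p (TG x).

Definition plift (W : lmodType K) (phi : X -> W) (x : pres) : W := ext phi (repr x).

Lemma plift_linear (W : lmodType K) (phi : X -> W) : kills phi -> is_linear (plift phi).
Proof.
move=> k a x y.
rewrite /plift -[_ + _]/(padd (pscale a x) y) !repr_ext //=.
by rewrite repr_ext.
Qed.

Lemma plift_gen (W : lmodType K) (phi : X -> W) x : kills phi -> plift phi (pgen x) = phi x.
Proof. by move=> k; rewrite /plift repr_ext. Qed.

Lemma ext_pgen t : ext pgen t = p t.
Proof.
elim: t => //= [x -> y ->|c x ->]; apply/pE => W phi k /=; by rewrite !repr_ext.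
Qed.

Lemma pres_ext0 r : Rl r -> ext pgen r = 0.
Proof.
by move=> Rr; rewrite ext_pgen; apply/pE => W phi k /=; apply: k.
Qed.

Lemma pres_ind (P : pres -> Prop) :
  P 0 -> (forall x y, P x -> P y -> P (x + y)) -> (forall c x, P x -> P (c *: x)) ->
  (forall x, P (pgen x)) -> forall x, P x.
Proof.
move=> P0 PD PS PG x; rewrite -[x]reprK -ext_pgen.
by elim: (repr x) => //= [t1 h1 t2 h2|c t h]; [exact: PD|exact: PS].
Qed.

Lemma pres_linext (W : lmodType K) (f g : pres -> W) : is_linear f -> is_linear g ->
  (forall x, f (pgen x) = g (pgen x)) -> f =1 g.
Proof.
move=> fL gL e; apply: pres_ind => //.
- by rewrite !lin0.
- by move=> x y ex ey; rewrite !linD // ex ey.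
- by move=> c x ex; rewrite !linZ // ex.
Qed.

End Pres.

Section Quot.
Variables (U : lmodType K) (Q : U -> Prop).

(** All vectors of [U] are generators and their linear relations are relators, so [Q] may be any set
    of vectors: the subspace that it spans is divided out. *)
Inductive quot_rel : term U -> Prop :=
 | QrL c x y : quot_rel (TA (TG (c *: x + y)) (TS (-1) (TA (TS c (TG x)) (TG y))))
 | QrK x : Q x -> quot_rel (TG x).

Definition quot := pres quot_rel.
Definition qproj : U -> quot := @pgen _ quot_rel.

Lemma qproj_linear : is_linear qproj.
Proof.
move=> c x y; have /= := pres_ext0 (QrL c x y).
by rewrite scaleN1r => /eqP; rewrite subr_eq0 => /eqP.
Qed.

Lemma qproj0 x : Q x -> qproj x = 0.
Proof. by move=> Qx; have /= := pres_ext0 (QrK Qx). Qed.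

Lemma quot_kills (W : lmodType K) (f : U -> W) :
  is_linear f -> (forall x, Q x -> f x = 0) -> kills quot_rel f.
Proof.
move=> fL fQ r; case=> [c x y|x] /=; last exact: fQ.
by rewrite fL scaleN1r subrr.
Qed.

Lemma quot_ind (P : quot -> Prop) : (forall x, P (qproj x)) -> forall x, P x.
Proof.
move=> h x.
suff [u ->] : exists u, x = qproj u by apply: h.
elim/pres_ind: x => [|x y [u ->] [v ->]|c x [u ->]|u].
- by exists 0; rewrite lin0 //; apply: qproj_linear.
- by exists (u + v); rewrite linD //; apply: qproj_linear.
- by exists (c *: u); rewrite linZ //; apply: qproj_linear.
- by exists u.
Qed.

End Quot.
End Presentation.
Arguments TZ {K X}.
Arguments TG {K X}.

(** * Deciding linear identities in a module by reflection *)

Section LmodTactic.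
Variable K : fieldType.

Inductive mexp := M0 | MD of mexp & mexp | MN of mexp | MZ of K & mexp | MA of nat.

Fixpoint mden (W : lmodType K) (env : seq W) (e : mexp) : W :=
  match e with
  | M0 => 0
  | MD x y => mden env x + mden env y
  | MN x => - mden env x
  | MZ c x => c *: mden env x
  | MA n => env`_n
  end.

Fixpoint mcoef (i : nat) (e : mexp) : K :=
  match e with
  | M0 => 0
  | MD x y => mcoef i x + mcoef i y
  | MN x => - mcoef i x
  | MZ c x => c * mcoef i x
  | MA n => if eqn n i then 1 else 0
  end.

Lemma mdenE (W : lmodType K) (env : seq W) e :
  mden env e = \sum_(i < size env) mcoef i e *: env`_i.
Proof.
elim: e => /= [|x -> y ->|x ->|c x ->|n].
- by rewrite big1 // => i _; rewrite scale0r.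
- by rewrite -big_split; apply: eq_bigr => i _; rewrite scalerDl.
- by rewrite -sumrN; apply: eq_bigr => i _; rewrite scaleNr.
- by rewrite scaler_sumr; apply: eq_bigr => i _; rewrite scalerA.
- have [lt|ge] := ltnP n (size env).
    rewrite (bigD1 (Ordinal lt)) //= eqnE eqxx scale1r big1 ?addr0 // => i ne.
    case: eqP => [e|]; last by rewrite scale0r.
    by case/eqP: ne; apply: val_inj.
  rewrite nth_default // eqnE big1 // => i _.
  case: eqP => [e|]; last by rewrite scale0r.
  by move: (ltn_ord i); rewrite -e ltnNge ge.
Qed.

Fixpoint mcoef_all (n : nat) (x y : mexp) : Prop :=
  match n with
  | 0 => True
  | m.+1 => mcoef m x = mcoef m y /\ mcoef_all m x y
  end.

Lemma lmod_eq (W : lmodType K) (env : seq W) x y :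
  mcoef_all (size env) x y -> mden env x = mden env y.
Proof.
move=> h; rewrite !mdenE.
elim: (size env) h => [|n IH] /=; first by rewrite !big_ord0.
by case=> e /IH {}IH; rewrite !big_ord_recr /= e IH.
Qed.

End LmodTactic.
Arguments M0 {K}.
Arguments MA {K}.

(** Atoms are compared up to unification after a syntactic test, so that convertible presentations
    of one vector count as a single atom. *)
Ltac lm_same x y :=
  match constr:(Set) with
  | _ => let _ := match constr:(Set) with _ => constr_eq x y end in constr:(true)
  | _ => let _ := match constr:(Set) with _ => unify x y end in constr:(true)
  | _ => constr:(false)
  end.

Ltac lm_index x env :=
  lazymatch env with
  | ?y :: ?env' =>
      let b := lm_same x y in
      lazymatch b with
      | true => constr:(0%N)
      | false => let n := lm_index x env' in constr:(S n)
      end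
  end.

Ltac lm_mem x env :=
  lazymatch env with
  | nil => constr:(false)
  | ?y :: ?env' =>
      let b := lm_same x y in
      lazymatch b with
      | true => constr:(true)
      | false => lm_mem x env'
      end
  end.

Ltac lm_atoms e env :=
  lazymatch e with
  | (?x + ?y)%R => let env1 := lm_atoms x env in lm_atoms y env1
  | (- ?x)%R => lm_atoms x env
  | (?c *: ?x)%R => lm_atoms x env
  | (0)%R => env
  | ?x => let b := lm_mem x env in
      lazymatch b with true => env | false => constr:(x :: env) end
  end.

Ltac lm_reify K e env :=
  lazymatch e with
  | (?x + ?y)%R => let a := lm_reify K x env in let b := lm_reify K y env in constr:(MD a b)
  | (- ?x)%R => let a := lm_reify K x env in constr:(MN a)
  | (?c *: ?x)%R => let a := lm_reify K x env in constr:(@MZ K c a)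
  | (0)%R => constr:(@M0 K)
  | ?x => let n := lm_index x env in constr:(@MA K n)
  end.

(* Reduces an equality in a [K]-module to the equalities of the coefficients of its atoms. *)
Ltac lmod_coefs K :=
  lazymatch goal with
  | |- @eq ?W ?a ?b =>
    let env0 := lm_atoms a (@nil W) in
    let env := lm_atoms b env0 in
    let x := lm_reify K a env in
    let y := lm_reify K b env in
    refine (@lmod_eq K _ env x y _);
    cbn [size mcoef mcoef_all eqn]; repeat split
  end.
Ltac lmod K := lmod_coefs K; try ring.

(** * Linear forms on induced modules of Lie superalgebras *)

Section WordFunctions.
Variables (K : numFieldType) (L W : lmodType K).

Lemma eps_sq a b : eps a b * eps a b = 1 :> K.
Proof. by rewrite /eps; case: ifP; rewrite ?mulrNN mulr1. Qed.

Local Notation letter := (bool * L)%type.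
Definition esign (x y : letter) : K := eps x.1 y.1.

Definition multilinear (h : seq letter -> W) :=
  forall p a c x y r,
    h (p ++ (a, c *: x + y) :: r) = c *: h (p ++ (a, x) :: r) + h (p ++ (a, y) :: r).

Lemma multilinear_cons h z : multilinear h -> multilinear (h \o cons z).
Proof. by move=> hM p a c x y r; rewrite /= -!cat_cons hM. Qed.

Variable br : bool -> bool -> L -> L -> L.
Hypothesis br_linl : forall a b y, is_linear (fun x => br a b x y).
Hypothesis br_linr : forall a b x, is_linear (br a b x).

Definition brl (x y : letter) : letter := (x.1 (+) y.1, br x.1 y.1 x.2 y.2).

(* [h] turns a transposition of two neighbours into [h'] of their bracket. *)
Definition commutes (h h' : seq letter -> W) := forall p x y r,
  h (p ++ x :: y :: r) = esign x y *: h (p ++ y :: x :: r) + h' (p ++ brl x y :: r).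

Lemma commutes_cons h h' z : commutes h h' -> commutes (h \o cons z) (h' \o cons z).
Proof. by move=> hR p x y r; rewrite /= -!cat_cons hR. Qed.

Hypothesis br_skew : forall a b x y, br a b x y = - eps a b *: br b a y x.
Hypothesis br_jacobi : forall a b c x y z,
  br (a (+) b) c (br a b x y) z =
  br a (b (+) c) x (br b c y z) - eps a b *: br b (a (+) c) y (br a c x z).

Section Extension.

Lemma ml0 h p a r : multilinear h -> h (p ++ (a, 0) :: r) = 0.
Proof.
move=> hM; have := hM p a 1 0 0 r; rewrite !scale1r addr0 => e.
by apply: (addrI (h (p ++ (a, 0) :: r))); rewrite -e addr0.
Qed.

Lemma mlZ h p a c x r : multilinear h ->
  h (p ++ (a, c *: x) :: r) = c *: h (p ++ (a, x) :: r).
Proof. by move=> hM; have := hM p a c x 0 r; rewrite ml0 // !addr0. Qed.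

Lemma ml_skew h p x y r : multilinear h ->
  h (p ++ brl x y :: r) = - esign x y *: h (p ++ brl y x :: r).
Proof.
by move=> hM; rewrite /brl br_skew mlZ //= (addbC x.1).
Qed.

Lemma ml_jacobi h p x y z r : multilinear h ->
  h (p ++ brl (brl x y) z :: r) =
  h (p ++ brl x (brl y z) :: r) - esign x y *: h (p ++ brl y (brl x z) :: r).
Proof.
move=> hM; rewrite {1}/brl /= br_jacobi [_ - _]addrC -scaleNr hM addrC scaleNr.
by rewrite /brl /= (addbCA y.1) (addbA x.1).
Qed.

Variable mu : letter -> seq letter -> W.

(* Value assigned to a word [rev pr ++ x :: r] after moving [x] to the front. *)
Fixpoint to_front (h : seq letter -> W) (pr : seq letter) (x : letter) (r : seq letter) : W :=
  if pr is y :: pr' then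
    esign y x *: to_front h pr' x (y :: r) + h (catrev pr' (brl y x :: r))
  else mu x r.

Fixpoint front_sum h (pr w : seq letter) : W :=
  if w is x :: r then to_front h pr x r + front_sum h (x :: pr) r else 0.

Variables (h h' : seq letter -> W).
Hypotheses (hM : multilinear h) (hM' : multilinear h') (hR : commutes h h').

Lemma hRrev p x y r : h (catrev p (x :: y :: r)) =
  esign x y *: h (catrev p (y :: x :: r)) + h' (catrev p (brl x y :: r)).
Proof. by rewrite !catrevE hR. Qed.

Lemma hRrev2 q p x y r : h (catrev (q ++ y :: x :: p) r) =
  esign x y *: h (catrev (q ++ x :: y :: p) r) + h' (catrev (q ++ brl x y :: p) r).
Proof. by rewrite !catrev_catl /= hRrev. Qed.

Variable n : nat.
Hypothesis muR : forall z p x y r, (size p + size r).+2 = n ->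
  mu z (p ++ x :: y :: r) =
  esign x y *: mu z (p ++ y :: x :: r) + h (z :: p ++ brl x y :: r).

(** The transposition takes place to the right of the moved letter [z]. Each letter crossed by [z]
    adds a bracket term, to which [hR] applies; the resulting [h'] terms are those produced by
    moving [z] back across that letter in the correction term. *)
Lemma to_front_right pr z p x y r : (size pr + size p + size r).+2 = n ->
  to_front h pr z (p ++ x :: y :: r) =
  esign x y *: to_front h pr z (p ++ y :: x :: r) + h (catrev pr (z :: p ++ brl x y :: r)).
Proof.
elim: pr p => [|t pr IH] p sz /=; first exact: muR.
rewrite -!cat_cons IH; last by rewrite -sz /=; lia.
rewrite (catrevE pr (_ ++ x :: _)) -cat_cons catA hR -!catA !cat_cons -!catrevE.
rewrite [X in _ = _ + X]hRrev.
by lmod K.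
Qed.

Lemma esign_brr x y z : esign x (brl y z) = esign x y * esign x z.
Proof. by case: x y z => [[] ?] [[] ?] [[] ?]; rewrite /esign /eps /=; ring. Qed.

Lemma esign_brl x y z : esign (brl x y) z = esign x z * esign y z.
Proof. by case: x y z => [[] ?] [[] ?] [[] ?]; rewrite /esign /eps /=; ring. Qed.

(** The moved letter [z] now crosses both [x] and [y]. The two orders of crossing differ by iterated
    brackets of the three letters, and this is where the Jacobi identity enters, through
    [ml_jacobi]. *)
Lemma to_front_left q pr x y z r : (size q + size pr + size r).+2 = n ->
  to_front h (q ++ y :: x :: pr) z r =
  esign x y *: to_front h (q ++ x :: y :: pr) z r + h (catrev (q ++ brl x y :: pr) (z :: r)).
Proof.
elim: q r => [|t q IH] r sz /=.
- rewrite (@to_front_right pr z [::] x y r) /=; last by rewrite -sz /=; lia.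
  rewrite (hRrev _ (brl x y)) (hRrev _ x (brl y z)) (hRrev _ y (brl x z)).
  rewrite (catrevE _ (brl (brl x y) z :: r)) ml_jacobi // -!catrevE.
  rewrite !esign_brr esign_brl.
  lmod_coefs K; case: (x) (y) (z) => [[] ?] [[] ?] [[] ?]; rewrite /esign /eps /=; ring.
- rewrite IH; last by rewrite -sz /=; lia.
  rewrite (hRrev2 q) (hRrev _ t z).
  by lmod K.
Qed.

Lemma front_sum_left q pr x y r : (size q + size pr + size r).+1 = n ->
  front_sum h (q ++ y :: x :: pr) r =
  esign x y *: front_sum h (q ++ x :: y :: pr) r +
  (size r)%:R *: h (catrev (q ++ brl x y :: pr) r).
Proof.
elim: r q => [|z r IH] q sz /=; first by rewrite scale0r scaler0 addr0.
rewrite to_front_left; last by rewrite -sz /=; lia.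
rewrite -!cat_cons IH; last by rewrite -sz /=; lia.
rewrite -[(size r).+1]addn1 natrD /=.
by lmod K.
Qed.

(** Every letter of [p] and [r] contributes one copy of the bracket term. Moving [x] and [y] to the
    front adds [x, y] and minus the signed [y, x], which are equal by skew-symmetry. The
    multiplicity is thus the number of letters summed over. *)
Lemma front_sum_commutes pr p x y r : (size pr + size p + size r).+1 = n ->
  front_sum h pr (p ++ x :: y :: r) =
  esign x y *: front_sum h pr (p ++ y :: x :: r) +
  (size p + size r).+2%:R *: h (catrev pr (p ++ brl x y :: r)).
Proof.
elim: p pr => [|z p IH] pr sz /=.
- rewrite (@front_sum_left [::]) /=; last by rewrite -sz /=; lia.
  rewrite (catrevE pr (brl y x :: r)) ml_skew // -catrevE.
  rewrite add0n -(addn2 (size r)) natrD.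
  lmod_coefs K; case: (x) (y) => [[] ?] [[] ?]; rewrite /esign /eps /=; ring.
- rewrite to_front_right; last by rewrite -sz /=; lia.
  rewrite IH; last by rewrite -sz /=; lia.
  rewrite addSn -[(size p + size r).+3]addn1 natrD /=.
  by lmod K.
Qed.

End Extension.

Section Linearity.
Variables (mu : letter -> seq letter -> W) (h : seq letter -> W).
Hypotheses (hM : multilinear h) (muM : forall z, multilinear (mu z)).
Hypothesis muL : forall a c x y r, mu (a, c *: x + y) r = c *: mu (a, x) r + mu (a, y) r.

Lemma to_front_linr pr z p a c x y r :
  to_front mu h pr z (p ++ (a, c *: x + y) :: r) =
  c *: to_front mu h pr z (p ++ (a, x) :: r) + to_front mu h pr z (p ++ (a, y) :: r).
Proof.
elim: pr p => [|t pr IH] p /=; first exact: muM.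
rewrite -!cat_cons IH !catrevE !catA hM /=.
by lmod K.
Qed.

Lemma to_front_linm pr a c x y r :
  to_front mu h pr (a, c *: x + y) r =
  c *: to_front mu h pr (a, x) r + to_front mu h pr (a, y) r.
Proof.
elim: pr r => [|t pr IH] r /=; first exact: muL.
rewrite IH !catrevE /brl /= br_linr hM /esign /=.
by lmod K.
Qed.

Lemma to_front_linl q pr z a c x y r :
  to_front mu h (q ++ (a, c *: x + y) :: pr) z r =
  c *: to_front mu h (q ++ (a, x) :: pr) z r + to_front mu h (q ++ (a, y) :: pr) z r.
Proof.
elim: q r => [|t q IH] r /=.
  rewrite (to_front_linr _ _ [::]) /= !catrevE /brl /= br_linl hM /esign /=.
  by lmod K.
by rewrite IH !catrev_catl /= !(catrevE pr) hM; lmod K.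
Qed.

Lemma front_sum_linl q pr a c x y r :
  front_sum mu h (q ++ (a, c *: x + y) :: pr) r =
  c *: front_sum mu h (q ++ (a, x) :: pr) r + front_sum mu h (q ++ (a, y) :: pr) r.
Proof.
elim: r q => [|t r IH] q /=; first by rewrite scaler0 addr0.
by rewrite to_front_linl -cat_cons IH !cat_cons; lmod K.
Qed.

Lemma front_sum_multilinear pr : multilinear (front_sum mu h pr).
Proof.
move=> p a c x y r; elim: p pr => [|t p IH] pr /=.
  by rewrite to_front_linm (front_sum_linl [::]) /=; lmod K.
by rewrite to_front_linr IH; lmod K.
Qed.

End Linearity.

Lemma front_sum_add mu1 mu2 mu h1 h2 h c :
  (forall z w, mu z w = c *: mu1 z w + mu2 z w) ->
  (forall w, h w = c *: h1 w + h2 w) ->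
  forall pr w, front_sum mu h pr w = c *: front_sum mu1 h1 pr w + front_sum mu2 h2 pr w.
Proof.
move=> emu eh pr w.
have tf q x r : to_front mu h q x r = c *: to_front mu1 h1 q x r + to_front mu2 h2 q x r.
  by elim: q r => [|y q IH] r //=; rewrite IH eh; lmod K.
elim: w pr => [|x w IH] pr /=; first by rewrite scaler0 addr0.
by rewrite tf IH; lmod K.
Qed.

(* On words of length [n], the average over the letters of a word of the values
   obtained by moving one letter to the front, the rest being handled by induction.
   This makes [H^1] of the symmetric group vanish explicitly. *)
Fixpoint extend (n : nat) (h : seq letter -> W) (w : seq letter) : W :=
  if n is m.+1 then
    n%:R^-1 *: front_sum (fun z => extend m (h \o cons z)) h [::] w
  else 0.

Lemma extend_add n h1 h2 h c : (forall w, h w = c *: h1 w + h2 w) ->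
  forall w, extend n h w = c *: extend n h1 w + extend n h2 w.
Proof.
elim: n h h1 h2 => [|n IH] h h1 h2 e w /=; first by rewrite scaler0 addr0.
rewrite (@front_sum_add (fun z => extend n (h1 \o cons z)) (fun z => extend n (h2 \o cons z))
  _ h1 h2 _ c) //; first by lmod K.
by move=> z w'; apply: IH => w''; rewrite /= e.
Qed.

Lemma extend_multilinear n h : multilinear h -> multilinear (extend n h).
Proof.
elim: n h => [|n IH] h hM p a c x y r /=; first by rewrite scaler0 addr0.
rewrite front_sum_multilinear //; first by lmod K.
  by move=> z; apply: IH; apply: multilinear_cons.
move=> b d u v w; apply: extend_add => w'.
exact: (hM [::]).
Qed.

(** Once a first letter [z] is fixed, the value on the remaining word is the same construction for
    [h \o cons z], so the induction hypothesis supplies [muR]. The bracket term then appears as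
    often as the word has letters, and the average divides by that number. *)
Lemma extend_commutes n h h' : multilinear h -> multilinear h' -> commutes h h' ->
  forall p x y r, (size p + size r).+2 = n ->
  extend n h (p ++ x :: y :: r) = esign x y *: extend n h (p ++ y :: x :: r) +
    h (p ++ brl x y :: r).
Proof.
elim: n h h' => [|n IH] h h' hM hM' hR p x y r // sz /=.
rewrite (@front_sum_commutes _ h h' hM hM' hR n) //; last by case: sz.
  rewrite /= sz scalerDr [n.+1%:R^-1 *: (n.+1%:R *: _)]scalerA mulVf ?scale1r ?pnatr_eq0 //.
  by lmod K.
move=> z p' x' y' r' sz'.
by rewrite (IH _ (h' \o cons z)) //; [apply: multilinear_cons|apply: multilinear_cons|
  apply: commutes_cons].
Qed.

Variable rho : L -> W.
Hypothesis rhoL : is_linear rho.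

(** Layer [n] is meant for words of length [n], with bracket corrections in the layer below. The
    extension is nevertheless taken at [size w], so that the exchange rule holds on words of every
    length, as [commutes] demands. *)
Fixpoint tower (n : nat) (w : seq letter) : W :=
  match n with
  | 0 => 0
  | 1 => if w is [:: x] then rho x.2 else 0
  | m.+1 => extend (size w) (tower m) w
  end.

Lemma tower_multilinear n : multilinear (tower n).
Proof.
case: n => [|n]; first by move=> *; rewrite /= scaler0 addr0.
elim: n => [|n IH] p a c x y r.
  case: p => [|t [|? ?]] /=; rewrite ?scaler0 ?addr0 //.
  by case: r => [|? ?]; rewrite ?scaler0 ?addr0 //= rhoL.
by rewrite /= !size_cat extend_multilinear.
Qed.

Lemma tower_commutes n : commutes (tower n.+1) (tower n).
Proof.
elim: n => [|n IH] p x y r; first by case: p => [|? [|? ?]] /=; rewrite scaler0 addr0.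
have E w : tower n.+2 w = extend (size w) (tower n.+1) w by [].
rewrite !E !size_cat (@extend_commutes _ _ (tower n)) //; try exact: tower_multilinear.
by rewrite !addnS.
Qed.

(* A linear form on the enveloping algebra, written as a function on words. *)
Definition env_form (w : seq letter) : W := tower (size w) w.

Lemma env_form_multilinear : multilinear env_form.
Proof. by move=> p a c x y r; rewrite /env_form !size_cat tower_multilinear. Qed.

Lemma env_form_commutes : commutes env_form env_form.
Proof.
move=> p x y r; rewrite /env_form !size_cat /= !addnS; exact: tower_commutes.
Qed.

End WordFunctions.

(** * Forms on the module induced from the trivial module of a subalgebra *)

Section VacuumForm.
Variables (K : numFieldType) (L W : lmodType K).
Local Notation letter := (bool * L)%type.
Implicit Types f : seq letter -> W.

Variable br : bool -> bool -> L -> L -> L.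
Hypothesis br_linl : forall a b y, is_linear (fun x => br a b x y).
Hypothesis br_linr : forall a b x, is_linear (br a b x).
Hypothesis br_skew : forall a b x y, br a b x y = - eps a b *: br b a y x.
Hypothesis br_jacobi : forall a b c x y z,
  br (a (+) b) c (br a b x y) z =
  br a (b (+) c) x (br b c y z) - eps a b *: br b (a (+) c) y (br a c x z).

(* [pm] and [pp] are the projections of a decomposition of [L] into subalgebras. *)
Variables pm pp : L -> L.
Hypotheses (pmL : is_linear pm) (ppL : is_linear pp).
Hypothesis pmpp : forall x, pm x + pp x = x.
Hypotheses (pm_pp : forall x, pm (pp x) = 0) (pp_pm : forall x, pp (pm x) = 0).
Hypothesis pm_br : forall a b x y, pm (br a b (pp x) (pp y)) = 0.
Hypothesis pp_br : forall a b x y, pp (br a b (pm x) (pm y)) = 0.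

Lemma pm_idem x : pm (pm x) = pm x.
Proof. by rewrite -{2}(pmpp x) linD // pm_pp addr0. Qed.
Lemma pm_br_id a b x y : pm (br a b (pm x) (pm y)) = br a b (pm x) (pm y).
Proof. by rewrite -[RHS]pmpp pp_br addr0. Qed.
Lemma pp_br_id a b x y : pp (br a b (pp x) (pp y)) = br a b (pp x) (pp y).
Proof. by rewrite -[RHS]pmpp pm_br add0r. Qed.

(** The subalgebra [pm L] is not made into a type. Its bracket is pulled back to all of [L] along
    [pm], which preserves the Jacobi identity because brackets of [pm L] stay in [pm L]. *)
Definition brm a b x y := br a b (pm x) (pm y).

Lemma brm_linl a b y : is_linear (fun x => brm a b x y).
Proof. by move=> c x x'; rewrite /brm pmL br_linl. Qed.
Lemma brm_linr a b x : is_linear (brm a b x).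
Proof. by move=> c y y'; rewrite /brm pmL br_linr. Qed.
Lemma brm_skew a b x y : brm a b x y = - eps a b *: brm b a y x.
Proof. exact: br_skew. Qed.
Lemma brm_jacobi a b c x y z :
  brm (a (+) b) c (brm a b x y) z =
  brm a (b (+) c) x (brm b c y z) - eps a b *: brm b (a (+) c) y (brm a c x z).
Proof. by rewrite /brm !pm_br_id br_jacobi. Qed.

(* Transpose of the action of [pp x] on the words in [pm L], seen as products
   applied to a vector that [pp L] annihilates. *)
Fixpoint lact f (a : bool) (x : L) (m : seq letter) : W :=
  if m is y :: m' then
    let z := br a y.1 (pp x) (pm y.2) in
    eps a y.1 *: lact (f \o cons y) a x m' + f ((a (+) y.1, pm z) :: m') +
    lact f (a (+) y.1) z m'
  else 0.

Definition act f a x m := f ((a, pm x) :: m) + lact f a x m.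

Lemma lact_add f f1 f2 c a x m : (forall w, f w = c *: f1 w + f2 w) ->
  lact f a x m = c *: lact f1 a x m + lact f2 a x m.
Proof.
elim: m f f1 f2 a x => [|y m IH] f f1 f2 a x e /=; first by rewrite scaler0 addr0.
rewrite (IH f f1 f2) // e.
rewrite (IH (f \o cons y) (f1 \o cons y) (f2 \o cons y)); last by move=> w; exact: e.
by lmod K.
Qed.

Lemma lact_lin f a m : multilinear f -> is_linear (fun x => lact f a x m).
Proof.
elim: m f a => [|y m IH] f a fM c x x' /=; first by rewrite scaler0 addr0.
rewrite ppL br_linl pmL (fM [::]) IH; last exact: multilinear_cons.
by rewrite (IH f) //=; lmod K.
Qed.

Lemma lactE f a x y : f =1 f -> multilinear f -> pp x = pp y -> lact f a x =1 lact f a y.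
Proof.
by move=> _ fM e m; elim: m f fM => [|t m IH] f fM //=; rewrite e IH //; apply: multilinear_cons.
Qed.

Lemma lact_minus f a x m : multilinear f -> pp x = 0 -> lact f a x m = 0.
Proof.
move=> fM x0; rewrite (@lactE f a x 0) ?(lin0 ppL) //.
by rewrite (lin0 (lact_lin a m fM)).
Qed.

Lemma lact_multilinear f a x : multilinear f -> multilinear (lact f a x).
Proof.
move=> fM p b c y y' r; elim: p f a x fM => [|t p IH] f a x fM /=.
  rewrite pmL br_linr pmL (fM [::]) /= (lact_lin _ _ fM).
  rewrite (@lact_add _ (f \o cons (b, y)) (f \o cons (b, y')) c) => [|w].
    by lmod K.
  exact: (fM [::]).
rewrite IH; last exact: multilinear_cons.
by rewrite -cat_cons fM /= IH //; lmod K.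
Qed.

Lemma act_multilinear f a x : multilinear f -> multilinear (act f a x).
Proof.
move=> fM p b c y y' r; rewrite /act -!cat_cons fM lact_multilinear //=; lmod K.
Qed.

(** This makes the action of [pp L] descend from words to the enveloping algebra of [pm L]. Only a
    transposition at the head of the word is substantial. *)
Lemma lact_commutes f a x : multilinear f -> commutes brm f f ->
  commutes brm (lact f a x) (lact f a x).
Proof.
move=> fM fR p; elim: p f a x fM fR => [|t p IH] f a x fM fR /= [b y] [c z] r; last first.
  rewrite (IH (f \o cons t)); [|exact: multilinear_cons|exact: commutes_cons].
  by rewrite -!cat_cons fR /= (IH f) //=; lmod K.
rewrite /esign /brl /=.
rewrite (@lact_add ((f \o cons (b, y)) \o cons (c, z)) ((f \o cons (c, z)) \o cons (b, y))
  (f \o cons (brl brm (b, y) (c, z))) (eps b c)); last by move=> w; apply: (fR [::]).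
have fy := fR [::]; rewrite /= in fy.
set u := br a b (pp x) (pm y); set v := br a c (pp x) (pm z).
rewrite (fy (a (+) b, pm u)) (fy (a (+) c, pm v)) /esign /brl /=.
rewrite -/(brm b c y z).
(* The Jacobi identity for [pp x], [pm y], [pm z], with [u] and [v] split into their two components:
   the negative ones are bracketed by [brm], the others act further on the word. *)
have -> : br a (b (+) c) (pp x) (pm (brm b c y z)) =
   br (a (+) b) c (pp u) (pm z) - (eps a b * eps b (a (+) c)) *: br (a (+) c) b (pp v) (pm y)
   + (brm (a (+) b) c (pm u) z - (eps a b * eps b (a (+) c)) *: brm (a (+) c) b (pm v) y).
  have := br_jacobi a b c (pp x) (pm y) (pm z).
  rewrite /brm pm_br_id -/u -/v !pm_idem => /eqP; rewrite eq_sym subr_eq => /eqP ->.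
  rewrite -{1}(pmpp u) (linD (br_linl _ _ _)) (br_skew b) -{1}(pmpp v) (linD (br_linl _ _ _)).
  by lmod K.
have fD c' m : is_linear (fun t => f ((c', t) :: m)) by move=> k t t'; apply: (fM [::]).
have lL c' m := lact_lin c' m fM.
rewrite !addbA (addbAC a c b).
rewrite !(linD pmL) !(linN pmL) !(linZ pmL) !(linD (fD _ _)) !(linN (fD _ _)) !(linZ (fD _ _)).
rewrite !(linD (lL _ _)) !(linN (lL _ _)) !(linZ (lL _ _)) !pm_br_id.
rewrite !(@lact_minus f _ (brm _ _ _ _)) ?pp_br //.
by lmod_coefs K; case: a b c {u v} => [] [] []; rewrite /eps /=; ring.
Qed.

(** The action respects brackets inside [pp L]. By induction on the word: at the head letter this is
    the Jacobi identity for [pp x], [pp y] and that letter, the intermediate brackets being split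
    into components. *)
Lemma lact_lact f a b x y m : multilinear f ->
  lact (lact f a x) b y m = eps a b *: lact (lact f b y) a x m +
    lact f (a (+) b) (br a b (pp x) (pp y)) m.
Proof.
elim: m f a b x y => [|[c z] m IH] f a b x y fM /=; first by rewrite scaler0 addr0.
have lc g d t (gM : multilinear g) e s k :
    lact (lact g d t \o cons (c, z)) e s k =
    eps d c *: lact (lact (g \o cons (c, z)) d t) e s k +
    (lact (g \o cons (d (+) c, pm (br d c (pp t) (pm z)))) e s k +
     lact (lact g (d (+) c) (br d c (pp t) (pm z))) e s k).
  set g1 := g \o cons (d (+) c, _); set g2 := lact g (d (+) c) _.
  rewrite (@lact_add _ (lact (g \o cons (c, z)) d t) (fun w => g1 w + g2 w) (eps d c)).
    by rewrite (@lact_add (fun w => g1 w + g2 w) g1 g2 1) ?scale1r // => w; rewrite scale1r.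
  by move=> w /=; rewrite addrA.
rewrite !lc // {lc}.
set v := br a c (pp x) (pm z); set w := br b c (pp y) (pm z).
rewrite (IH (f \o cons (c, z))); last exact: multilinear_cons.
rewrite (IH f a (b (+) c) x w) // (IH f b (a (+) c) y v) //.
rewrite pp_br_id br_jacobi -/v -/w !pm_idem.
have fD c' k : is_linear (fun t => f ((c', t) :: k)) by move=> d t t'; apply: (fM [::]).
have lL c' k := lact_lin c' k fM.
have dec d e t k : br d e t k = br d e t (pm k) + br d e t (pp k).
  by rewrite -(linD (br_linr _ _ _)) pmpp.
rewrite (dec _ _ _ w) (dec _ _ _ v) {dec}.
rewrite !addbA (addbC b a).
rewrite !(linD pmL) !(linN pmL) !(linZ pmL) !(linD pmL) !(linD (fD _ _)).
rewrite !(linN (fD _ _)) !(linZ (fD _ _)) !(linD (fD _ _)).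
rewrite !(linD (lL _ _)) !(linN (lL _ _)) !(linZ (lL _ _)) !(linD (lL _ _)) !pm_br.
rewrite !(lin0 (fD _ _)).
by lmod_coefs K; case: a b c {v w} => [] [] []; rewrite /eps /=; ring.
Qed.

Lemma act_commutes f a x : multilinear f -> commutes brm f f ->
  commutes brm (act f a x) (act f a x).
Proof.
move=> fM fR p y z r; rewrite /act -!cat_cons fR lact_commutes //=.
by lmod K.
Qed.

(** Three kinds of pairs occur. Two elements of [pm L] are handled by the exchange rule of [f], two
    of [pp L] by [lact_lact], and a mixed pair by the recursive clause of [lact]. *)
Lemma act_act f a b x y m : multilinear f -> commutes brm f f ->
  act (act f a x) b y m = eps a b *: act (act f b y) a x m +
    act f (a (+) b) (br a b x y) m.
Proof.
move=> fM fR.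
have exp c d s t : act (act f c s) d t m = f [:: (c, pm s), (d, pm t) & m] +
    lact f c s ((d, pm t) :: m) +
    (lact (f \o cons (c, pm s)) d t m + lact (lact f c s) d t m).
  rewrite {1}/act; congr (_ + _).
  by rewrite (@lact_add (act f c s) (f \o cons (c, pm s)) (lact f c s) 1) ?scale1r // => w;
    rewrite scale1r.
rewrite !exp {exp} (lact_lact a b) // [lact f a x (_ :: _)]/= [lact f b y (_ :: _)]/=.
have := fR [::] (a, pm x) (b, pm y) m; rewrite /= /esign /brl /= => ->.
have -> : br a b x y = brm a b x y + br a b (pp x) (pm y) +
    (br a b (pp x) (pp y) - eps a b *: br b a (pp y) (pm x)).
  rewrite /brm -{1}(pmpp x) -{1}(pmpp y) (linD (br_linl _ _ _)) !(linD (br_linr _ _ _)).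
  by rewrite (br_skew a b (pm x) (pp y)); lmod K.
rewrite /act /brm !pm_idem.
have fD c' k : is_linear (fun t => f ((c', t) :: k)) by move=> d t t'; apply: (fM [::]).
have lL c' k := lact_lin c' k fM.
rewrite !(linD pmL) !(linN pmL) !(linZ pmL) !(linD (fD _ _)) !(linN (fD _ _)) !(linZ (fD _ _)).
rewrite !(linD (lL _ _)) !(linN (lL _ _)) !(linZ (lL _ _)) pm_br (lin0 (fD _ _)).
rewrite (lact_minus _ _ fM (pp_br _ _ _ _)) pm_br_id (addbC b a).
by lmod_coefs K; case: a b {fD lL} => [] []; rewrite /eps /=; ring.
Qed.

(** The value of [f] on the product of the letters applied to the vacuum, computed by transposing
    the letters onto [f] one at a time from the left. *)
Fixpoint word_form f (w : seq letter) : W :=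
  if w is x :: w' then word_form (act f x.1 x.2) w' else f [::].

Lemma word_form_add f f1 f2 c w : (forall w, f w = c *: f1 w + f2 w) ->
  word_form f w = c *: word_form f1 w + word_form f2 w.
Proof.
elim: w f f1 f2 => [|x w IH] f f1 f2 e /=; first exact: e.
apply: IH => w'; rewrite /act e (@lact_add f f1 f2 c) //.
by lmod K.
Qed.

Lemma word_form_multilinear f : multilinear f -> multilinear (word_form f).
Proof.
move=> fM p; elim: p f fM => [|t p IH] f fM a c x y r /=; last first.
  by apply: IH; apply: act_multilinear.
apply: word_form_add => w; rewrite /act pmL (fM [::]) (lact_lin _ _ fM).
by lmod K.
Qed.

Lemma word_form_commutes f : multilinear f -> commutes brm f f ->
  commutes br (word_form f) (word_form f).
Proof.
move=> fM fR p; elim: p f fM fR => [|t p IH] f fM fR x y r /=; last first.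
  by apply: IH; [apply: act_multilinear|apply: act_commutes].
by apply: word_form_add => w; rewrite act_act.
Qed.

Lemma word_form_last f p a x : multilinear f -> pm x = 0 ->
  word_form f (p ++ [:: (a, x)]) = 0.
Proof.
move=> fM x0; elim: p f fM => [|t p IH] f fM /=; last by apply: IH; apply: act_multilinear.
by rewrite /act x0 (ml0 (h := f) [::]) //= addr0.
Qed.

Variable rho : L -> W.
Hypothesis rhoL : is_linear rho.

Definition vacuum_form := word_form (env_form brm rho).

Lemma vacuum_form_multilinear : multilinear vacuum_form.
Proof.
apply: word_form_multilinear; apply: env_form_multilinear => //;
[exact: brm_linl|exact: brm_linr].
Qed.

Lemma vacuum_form_commutes : commutes br vacuum_form vacuum_form.
Proof.
apply: word_form_commutes.
  by apply: env_form_multilinear => //; [exact: brm_linl|exact: brm_linr].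
apply: env_form_commutes => //; [exact: brm_linl|exact: brm_linr|exact: brm_skew|exact: brm_jacobi].
Qed.

Lemma vacuum_form_last p a x : pm x = 0 -> vacuum_form (p ++ [:: (a, x)]) = 0.
Proof.
by apply: word_form_last; apply: env_form_multilinear => //; [exact: brm_linl|exact: brm_linr].
Qed.

Lemma vacuum_form1 a x : vacuum_form [:: (a, x)] = rho (pm x).
Proof. by rewrite /vacuum_form /= /act /= addr0. Qed.

End VacuumForm.

(** * Local fields *)

Section Binz.

Lemma binz0 r : binz r 0 = 1.
Proof. by case: r => m /=; rewrite ?bin0 ?expr0 ?mul1r. Qed.

Lemma binzS r i : binz (r + 1) i.+1 = binz r i.+1 + binz r i.
Proof.
case: r => m; first by rewrite -PoszD addn1 /= binS PoszD.
case: m => [|m].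
  rewrite /= !add0n !binn exprS (_ : (1 - 1)%N = 0%N) // bin0n /=; ring.
have -> : Negz m.+1 + 1 = Negz m by rewrite !NegzE; lia.
rewrite /binz !addSn !addnS (binS (m + i).+1) PoszD exprS.
move: (Posz _) (Posz _) => u v; ring.
Qed.

Lemma binz_nat_eq0 (m i : nat) : (m < i)%N -> binz m i = 0.
Proof. by move=> h; rewrite /= bin_small. Qed.

Lemma binz_mulS r i : binz r i.+1 * i.+1%:Z = binz r i * (r - i%:Z).
Proof.
case: r => m.
  rewrite /=; have [le|lt] := leqP i m; last first.
    by rewrite !bin_small ?mul0r // ltnW.
  by rewrite subzn // -!PoszM [in LHS]mulnC mul_bin_left mulnC.
have := mul_bin_diag (m + i).+1 i; rewrite /= NegzE addnS => h.
have -> : - m.+1%:Z - i%:Z = - (m + i).+1%:Z by lia.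
rewrite exprS -!mulrA -PoszM [('C(_, i.+1) * _)%N]mulnC -h PoszM; ring.
Qed.

End Binz.

(** * Finitely supported sums and binomial expansions of arrays *)

Section FiniteSums.
Variables (K : numFieldType) (M : lmodType K).
Implicit Types f g : nat -> M.

Definition ez f := exists N, forall i, (N <= i)%N -> f i = 0.

(* Sum of a finitely supported family; junk value [0] otherwise. *)
Definition tsum f : M :=
  match pselect (ez f) with
  | left h => \sum_(i < projT1 (cid h)) f i
  | right _ => 0
  end.

Lemma sum_trunc f N N' : (forall i, (N <= i)%N -> f i = 0) -> (N <= N')%N ->
  \sum_(i < N') f i = \sum_(i < N) f i.
Proof.
move=> h le; rewrite -(subnKC le) big_split_ord /= [X in _ + X]big1 ?addr0 // => i _.
by apply: h; rewrite leq_addr.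
Qed.

Lemma tsumE N f : (forall i, (N <= i)%N -> f i = 0) -> tsum f = \sum_(i < N) f i.
Proof.
move=> h; rewrite /tsum; case: pselect => [e|ne]; last by case: ne; exists N.
case: cid => N' h' /=; have [le|/ltnW le] := leqP N N'.
  by rewrite (sum_trunc h le).
by rewrite (sum_trunc h' le).
Qed.

Lemma eq_tsum f g : f =1 g -> tsum f = tsum g.
Proof. by move=> /funext ->. Qed.

Lemma ezZ c f : ez f -> ez (fun i => c i *: f i).
Proof. by move=> [N h]; exists N => i i1; rewrite h // scaler0. Qed.

Lemma ez_sub f g : (forall i, f i = 0 -> g i = 0) -> ez f -> ez g.
Proof. by move=> h [N e]; exists N => i /e /h. Qed.

Lemma tsum0 : tsum (fun _ => 0) = 0.
Proof. by rewrite (@tsumE 0) ?big_ord0. Qed.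

Lemma tsumD f g : ez f -> ez g -> tsum (fun i => f i + g i) = tsum f + tsum g.
Proof.
move=> [N h] [N' h']; pose m := maxn N N'.
have [le1 le2] : (N <= m)%N /\ (N' <= m)%N by rewrite leq_maxl leq_maxr.
rewrite !(@tsumE m) ?big_split // => i le; rewrite ?h ?h' ?addr0 //.
all: exact: leq_trans le.
Qed.

Lemma tsumZ c f : ez f -> tsum (fun i => c *: f i) = c *: tsum f.
Proof.
move=> [N h]; rewrite !(@tsumE N) ?scaler_sumr // => i le; rewrite h ?scaler0 //.
Qed.

Lemma tsumN f : ez f -> tsum (fun i => - f i) = - tsum f.
Proof.
move=> e; rewrite -scaleN1r -tsumZ //; apply: eq_tsum => i; by rewrite scaleN1r.
Qed.

Lemma ez_shift f : ez f -> ez (fun i => f i.+1).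
Proof. by move=> [N h]; exists N => i le; apply: h; apply: leqW. Qed.

Lemma tsumS f : ez f -> tsum f = f 0%N + tsum (fun i => f i.+1).
Proof.
move=> [N h]; rewrite (@tsumE N.+1) => [|i le]; last by apply: h; apply: ltnW.
rewrite (@tsumE N) => [|i le]; last by apply: h; apply: leqW.
by rewrite big_ord_recl.
Qed.

Lemma tsum1 f j : (forall i, i != j -> f i = 0) -> tsum f = f j.
Proof.
move=> h; rewrite (@tsumE j.+1) => [|i lt]; last by apply: h; rewrite gtn_eqF.
rewrite big_ord_recr /= big1 ?add0r // => i _; apply: h.
by rewrite neq_ltn ltn_ord.
Qed.

End FiniteSums.

Lemma lin_tsum (K : numFieldType) (U W : lmodType K) (h : U -> W) (f : nat -> U) :
  is_linear h -> ez f -> h (tsum f) = tsum (h \o f).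
Proof.
move=> hL [N e]; rewrite !(@tsumE _ _ N) ?lin_sum // => i le /=.
by rewrite e // lin0.
Qed.

Section Arrays.
Variables (K : numFieldType) (M : lmodType K).
Implicit Types X Y : int -> int -> M.

Definition bz r i : K := (binz r i)%:~R.

Lemma bz0 r : bz r 0 = 1. Proof. by rewrite /bz binz0. Qed.
Lemma bzS r i : bz (r + 1) i.+1 = bz r i.+1 + bz r i.
Proof. by rewrite /bz binzS intrD. Qed.
Lemma bz_mulS r i : bz r i.+1 * i.+1%:R = bz r i * (r - i%:Z)%:~R.
Proof. by rewrite /bz -[i.+1%:R]/(i.+1%:~R) -!intrM binz_mulS. Qed.
Lemma bz0S i : bz 0 i.+1 = 0. Proof. by []. Qed.

(* Coefficients of [(z1 - z2) ^ r X(z1, z2)], expanded in nonnegative powers of [z2];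
   the array [X] holds the coefficients of [z1 ^ (- p - 1) z2 ^ (- q - 1)]. *)
Definition zpow X (r p q : int) : M :=
  tsum (fun i => ((-1) ^+ i * bz r i) *: X (p + r - i%:Z) (q + i%:Z)).

Definition rtrunc X := exists Q : int, forall q, Q <= q -> forall p, X p q = 0.

Lemma rtrunc_ez X (c : nat -> K) (s : nat -> int) q : rtrunc X ->
  ez (fun i => c i *: X (s i) (q + i%:Z)).
Proof.
case=> Q h; exists `|Q - q|%N => i le; rewrite h ?scaler0 //; lia.
Qed.

Lemma zpowS X r p q : rtrunc X ->
  zpow X (r + 1) p q = zpow X r (p + 1) q - zpow X r p (q + 1).
Proof.
move=> tX; rewrite /zpow.
rewrite tsumS; last exact: rtrunc_ez.
rewrite [X in _ = X - _]tsumS; last exact: rtrunc_ez.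
rewrite -[RHS]addrA; congr (_ + _).
  by rewrite !bz0 (_ : p + (r + 1) = p + 1 + r) //; ring.
rewrite -tsumN; last exact: rtrunc_ez.
rewrite -tsumD.
- apply: eq_tsum => i; rewrite bzS exprS.
  rewrite (_ : p + (r + 1) - i.+1%:Z = p + r - i%:Z); last by lia.
  rewrite (_ : p + 1 + r - i.+1%:Z = p + r - i%:Z); last by lia.
  rewrite (_ : q + 1 + i%:Z = q + i.+1%:Z); last by lia.
  by lmod K.
- by case: tX => Q h; exists `|Q - q|%N => i le; rewrite h ?scaler0 //; lia.
- by case: tX => Q h; exists `|Q - q|%N => i le; rewrite h ?scaler0 ?oppr0 //; lia.
Qed.

Lemma zpow0 X p q : zpow X 0 p q = X p q.
Proof.
rewrite /zpow (@tsum1 _ _ _ 0) => [|[|i] //]; last by rewrite bz0S mulr0 scale0r.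
by rewrite bz0 expr0 mulr1 scale1r !addr0.
Qed.

Lemma eq_zpow X Y r p q : X =2 Y -> zpow X r p q = zpow Y r p q.
Proof. by move=> e; apply: eq_tsum => i; rewrite e. Qed.

Lemma zpow_zero r p q : zpow (fun _ _ => 0) r p q = 0.
Proof. by rewrite /zpow -[RHS](@tsum0 _ M); apply: eq_tsum => i; rewrite scaler0. Qed.

Lemma zpow_add X Y c d r p q : rtrunc X -> rtrunc Y ->
  zpow (fun l m => c *: X l m + d *: Y l m) r p q = c *: zpow X r p q + d *: zpow Y r p q.
Proof.
move=> tX tY; rewrite /zpow -!tsumZ; try exact: rtrunc_ez.
rewrite -tsumD; try by apply: ezZ; apply: rtrunc_ez.
by apply: eq_tsum => i; lmod K.
Qed.

Definition cdiff X : int -> int -> M := fun p q => X (p + 1) q - X p (q + 1).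

(** From the row p = 0 the recurrence reaches p + 1 directly. For negative p it expresses layer r at
    p - 1 through layer r at p and layer r + 1 at p - 1, so one descends in r from the vanishing
    layer [N]. *)
Lemma cascade_eq0 (Z : nat -> int -> int -> M) N :
  (forall r p q, Z r.+1 p q = Z r (p + 1) q - Z r p (q + 1)) ->
  (forall r p q, (N <= r)%N -> Z r p q = 0) -> (forall r q, Z r 0 q = 0) ->
  forall r p q, Z r p q = 0.
Proof.
move=> rec ZN Z0 r p; elim/int_rect: p r => [|p IH|p IH] r q; first exact: Z0.
  have := rec r p q; rewrite !IH.
  by rewrite (_ : p%:Z + 1 = p.+1%:Z) ?subr0; last lia.
have [le|/ltnW le] := leqP N r; first exact: ZN.
rewrite -(subKn le); elim: (N - r)%N q => [|k IHk] q; first by rewrite ZN ?subn0.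
have [lt|ge] := ltnP k N; last first.
  have e : (N - k.+1 = N - k)%N by lia.
  by rewrite e.
have := rec (N - k.+1)%N (- p.+1%:Z) (q - 1); rewrite subnSK //.
rewrite (_ : - p.+1%:Z + 1 = - p%:Z); last by lia.
by rewrite IH IHk subrK sub0r => /esym/eqP; rewrite oppr_eq0 => /eqP.
Qed.

(** The right-hand side, shifted by r, satisfies the recurrence by Pascal's rule, vanishes for large
    r, and agrees with [Z] at p = 0, where only the term i = 0 is left. The difference is zero by
    [cascade_eq0]. *)
Lemma cascade (Z : nat -> int -> int -> M) N :
  (forall r p q, Z r.+1 p q = Z r (p + 1) q - Z r p (q + 1)) ->
  (forall r p q, (N <= r)%N -> Z r p q = 0) ->
  forall p q, Z 0%N p q = tsum (fun i => bz p i *: Z i 0 (p + q - i%:Z)).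
Proof.
move=> rec ZN p q.
have E r (c : nat -> K) (s : nat -> int) : ez (fun i => c i *: Z (i + r)%N 0 (s i)).
  by exists N => i le; rewrite ZN ?scaler0 // (leq_trans le) ?leq_addr.
pose T r p q := tsum (fun i => bz p i *: Z (i + r)%N 0 (p + q - i%:Z)).
suff : Z 0%N p q - T 0%N p q = 0.
  move/eqP; rewrite subr_eq0 => /eqP ->; apply: eq_tsum => i; by rewrite addn0.
move: 0%N p q; apply: (@cascade_eq0 (fun r p q => Z r p q - T r p q) N).
- move=> r p q; rewrite rec.
  suff -> : T r (p + 1) q = T r.+1 p q + T r p (q + 1) by lmod K.
  rewrite /T tsumS; last exact: E.
  rewrite [X in _ = _ + X]tsumS; last exact: E.
  rewrite addrCA; congr (_ + _).
    by rewrite !bz0 (_ : p + 1 + q = p + (q + 1)) //; lia.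
  rewrite -tsumD; [|exact: E|].
    apply: eq_tsum => i; rewrite bzS -addSnnS.
    rewrite (_ : p + 1 + q - i.+1%:Z = p + q - i%:Z); last by lia.
    rewrite (_ : p + (q + 1) - i.+1%:Z = p + q - i%:Z); last by lia.
    by lmod K.
  by exists N => i le; rewrite ZN ?scaler0 //; lia.
- move=> r p q le; rewrite ZN // sub0r /T -[RHS]oppr0 -[in RHS](@tsum0 _ M); congr (- _).
  by apply: eq_tsum => i; rewrite ZN ?scaler0 // (leq_trans le) ?leq_addl.
- move=> r q; rewrite /T (@tsum1 _ _ _ 0) => [|[|i] //].
    by rewrite bz0 scale1r add0r !add0n ?addr0 ?subr0 subrr.
  by rewrite bz0S scale0r.
Qed.

(* An array with a finite expansion in the [bz p i] is annihilated by a power of [cdiff]. *)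
Lemma iter_cdiff_expansion (Z : nat -> int -> M) N n :
  (forall i j, (N <= i)%N -> Z i j = 0) ->
  iter n cdiff (fun p q => tsum (fun i => bz p i *: Z i (p + q - i%:Z))) =
  fun p q => tsum (fun i => bz p i *: Z (i + n)%N (p + q - i%:Z)).
Proof.
move=> Z0; elim: n => [|n IH] /=.
  by apply: funext => p; apply: funext => q; apply: eq_tsum => i; rewrite addn0.
rewrite IH; apply: funext => p; apply: funext => q; rewrite /cdiff.
have eY p' (s : nat -> int) : ez (fun i => bz p' i *: Z (i + n)%N (s i)).
  by exists N => i le; rewrite Z0 ?scaler0 // (leq_trans le) ?leq_addr.
rewrite (tsumS (eY _ _)) [X in _ - X](tsumS (eY _ _)) !bz0.
rewrite (_ : p + (q + 1) = p + 1 + q); last by lia.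
rewrite opprD addrACA subrr add0r -tsumN; last first.
  by exists N => i le; rewrite Z0 ?scaler0 //; lia.
rewrite -tsumD.
- apply: eq_tsum => i; rewrite bzS addSnnS.
  rewrite (_ : p + 1 + q - i.+1%:Z = p + q - i%:Z); last by lia.
  by lmod K.
- by exists N => i le; rewrite Z0 ?scaler0 //; lia.
- by exists N => i le; rewrite Z0 ?scaler0 ?oppr0 //; lia.
Qed.

End Arrays.

Lemma lin_zpow (K : numFieldType) (U W : lmodType K) (h : U -> W) X r p q :
  is_linear h -> rtrunc X -> h (zpow X r p q) = zpow (fun l m => h (X l m)) r p q.
Proof.
move=> hL tX; rewrite /zpow lin_tsum //; last exact: rtrunc_ez.
by apply: eq_tsum => i; rewrite /= linZ.
Qed.

Section Fields.
Variables (K : numFieldType) (M : lmodType K).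
Implicit Types a b c : int -> M -> M.

Definition is_field a :=
  (forall n, is_linear (a n)) /\ (forall w, exists N : int, forall n, N <= n -> a n w = 0).

(* Coefficients of [(z1 - z2) ^ r a(z1) b(z2) w - e (- z2 + z1) ^ r b(z2) a(z1) w], each
   power being expanded in the domain where the product of fields makes sense. *)
Definition ocomm (e : K) a b (r p q : int) (w : M) : M :=
  zpow (fun l m => a l (b m w)) r p q -
  (e * (-1) ^ r) *: zpow (fun m l => b m (a l w)) r q p.

(** The index p = 0 selects the residue in z1, which gives the usual r-th product of two fields. *)
Definition nprod e a b (r : int) : int -> M -> M := fun q w => ocomm e a b r 0 q w.

(** For r >= 0 the two expansions of the r-th power of z1 - z2 coincide, so this says that a power
    of z1 - z2 annihilates the supercommutator. *)
Definition local e a b :=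
  exists N : int, forall r p q w, N <= r -> ocomm e a b r p q w = 0.

Lemma field_rtrunc a b w : is_field a -> is_field b ->
  rtrunc (fun l m => a l (b m w)).
Proof.
move=> [aL _] [_ /(_ w)[N h]]; exists N => q le p; rewrite h // lin0 //.
Qed.

Lemma signz_succ (r : int) : (-1) ^ (r + 1) = - (-1) ^ r :> K.
Proof. by rewrite expfzDr ?oppr_eq0 ?oner_eq0 // expr1z mulrN1. Qed.

Lemma ocommS e a b r p q w : is_field a -> is_field b ->
  ocomm e a b (r + 1) p q w = ocomm e a b r (p + 1) q w - ocomm e a b r p (q + 1) w.
Proof.
move=> fa fb; rewrite /ocomm !zpowS;
  try first [exact: (field_rtrunc _ fa fb)|exact: (field_rtrunc _ fb fa)].
by rewrite signz_succ; lmod K.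
Qed.

Lemma ocomm0 e a b p q w : ocomm e a b 0 p q w = a p (b q w) - e *: b q (a p w).
Proof. by rewrite /ocomm !zpow0 expr0z mulr1. Qed.

(** This is the Jacobi (Borcherds) identity for fields. Multiplication by z1 - z2 raises r by one,
    locality kills large r, and [cascade] expands everything in the residues p = 0. *)
Lemma ocomm_expand e a b r p q w : is_field a -> is_field b -> local e a b ->
  ocomm e a b r p q w =
  tsum (fun i => bz K p i *: nprod e a b (r + i%:Z) (p + q - i%:Z) w).
Proof.
move=> fa fb [N h].
pose Z (k : nat) p' q' := ocomm e a b (r + k%:Z) p' q' w.
have recZ k p' q' : Z k.+1 p' q' = Z k (p' + 1) q' - Z k p' (q' + 1).
  by rewrite /Z -ocommS // -addrA -[k%:Z + 1]/((k + 1)%N%:Z) addn1.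
have Z0 k p' q' : (`|N - r|%N <= k)%N -> Z k p' q' = 0 by move=> le; apply: h; lia.
by rewrite -(cascade recZ Z0) /Z addr0.
Qed.

Lemma ocomm_linear e a b r p q : is_field a -> is_field b ->
  is_linear (ocomm e a b r p q).
Proof.
move=> fa fb c x y; rewrite /ocomm.
have [aL _] := fa; have [bL _] := fb.
rewrite (@eq_zpow _ _ _ (fun l m => c *: a l (b m x) + 1 *: a l (b m y))); last first.
  by move=> l m; rewrite bL aL scale1r.
rewrite (@eq_zpow _ _ (fun m l => b m (a l (c *: x + y)))
  (fun m l => c *: b m (a l x) + 1 *: b m (a l y))); last first.
  by move=> l m; rewrite aL bL scale1r.
by rewrite !zpow_add ?scale1r; try first [exact: (field_rtrunc _ fa fb)|exact: (field_rtrunc _ fb fa)]; lmod K.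
Qed.

Lemma field_nprod e a b r : is_field a -> is_field b -> is_field (nprod e a b r).
Proof.
move=> fa fb; split=> [n|w]; first exact: ocomm_linear.
have [aL /(_ w)[A hA]] := fa; have [bL hb] := fb; have [B hB] := hb w.
(* In the second expansion [b] acts on the vectors [a i w] with i >= 0. Only finitely many of them
   are nonzero, so one bound serves them all. *)
have [C hC] : exists C : int, forall i : nat, (i < `|A|)%N -> forall n, C <= n -> b n (a i%:Z w) = 0.
  elim: `|A|%N => [|k [C hC]]; first by exists 0.
  have [C' hC'] := hb (a k%:Z w); exists (Num.max C C') => i; rewrite ltnS leq_eqVlt.
  case/orP=> [/eqP ->|lt] n; rewrite ge_max => /andP[h1 h2]; first exact: hC'.
  exact: (hC i).
exists (Num.max B (C - r + `|A|%N%:Z)) => n; rewrite ge_max => /andP[le1 le2].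
rewrite /nprod /ocomm /zpow (@eq_tsum _ _ _ (fun _ => 0)) ?tsum0; last first.
  by move=> i; rewrite hB ?(lin0 (aL _)) ?scaler0 //; lia.
rewrite (@eq_tsum _ _ _ (fun _ => 0)) ?tsum0 ?scaler0 ?subr0 // => i.
have [lt|le] := ltnP i `|A|%N; last by rewrite hA ?(lin0 (bL _)) ?scaler0 //; lia.
by rewrite add0r (hC i) ?scaler0 //; lia.
Qed.

End Fields.

Section Nilpotent.
Variables (V : zmodType) (A B : V -> V).
Hypothesis AB : forall x, A (B x) = B (A x).
Hypotheses (subA : {morph A : x y / x - y}) (subB : {morph B : x y / x - y}).

Lemma iter_morph0 (C : V -> V) n : {morph C : x y / x - y} -> iter n C 0 = 0.
Proof. by move=> h; elim: n => //= n ->; rewrite -{1}(subrr 0) h subrr. Qed.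

Lemma iter_comm (C E : V -> V) n x : (forall y, C (E y) = E (C y)) ->
  iter n C (E x) = E (iter n C x).
Proof. by move=> h; elim: n => //= n ->. Qed.

(* The difference of two commuting nilpotent operators is nilpotent. *)
Lemma nilpotent_sub a b x : iter a A x = 0 -> iter b B x = 0 ->
  iter (a + b) (fun y => B y - A y) x = 0.
Proof.
pose C y := B y - A y; rewrite -/C.
have subC : {morph C : x y / x - y}.
  by move=> u v; rewrite /C subA subB !opprB addrACA [RHS]addrACA (addrC (- B v)).
move: {2}(a + b)%N (leqnn (a + b)) => n; elim: n a b x => [|n IH] [|a] [|b] x //= le;
  try by move=> x0 _; rewrite x0 -?iterS ?iter_morph0.
  by move=> _ x0; rewrite x0 -iterS iter_morph0.
move=> xa xb; rewrite -iterS iterSr.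
have subCn k u v : iter k C (u - v) = iter k C u - iter k C v.
  by elim: k => //= k ->; rewrite subC.
rewrite [C x]/C subCn.
have addS : (a + b.+1 = a.+1 + b)%N by rewrite addnS.
rewrite {1}addS !IH ?subrr //; try by [rewrite -ltnS -?addS | rewrite -iterSr].
- rewrite iter_comm // -?iterS /=; first by rewrite xb -{1}(subrr 0) subA subrr.
- rewrite (iter_comm (C := A)) //; change (B (iter a.+1 A x) = 0).
  by rewrite /= xa -{1}(subrr 0) subB subrr.
Qed.

End Nilpotent.

(** * Locality of products of fields: Dong's lemma *)

Section Dong.
Variables (K : numFieldType) (M : lmodType K).
Implicit Types (X : int -> int -> int -> M) (a b c : int -> M -> M).

(** On coefficient arrays in z1, z2, z3 these three operators are multiplication by z1 - z2, z1 - z3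
    and z2 - z3. *)
Definition d12 X l m n := X (l + 1) m n - X l (m + 1) n.
Definition d13 X l m n := X (l + 1) m n - X l m (n + 1).
Definition d23 X l m n := X l (m + 1) n - X l m (n + 1).

Lemma ext3 (X Y : int -> int -> int -> M) : (forall l m n, X l m n = Y l m n) -> X = Y.
Proof. by move=> e; apply: funext => l; apply: funext => m; apply: funext => n. Qed.

Lemma d13_d23 X : d13 (d23 X) = d23 (d13 X).
Proof. by apply: ext3 => l m n; rewrite /d13 /d23; lmod K. Qed.
Lemma d12_d23 X : d12 (d23 X) = d23 (d12 X).
Proof. by apply: ext3 => l m n; rewrite /d12 /d23; lmod K. Qed.
Lemma d12_d13 X : d12 (d13 X) = d13 (d12 X).
Proof. by apply: ext3 => l m n; rewrite /d12 /d13; lmod K. Qed.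

Lemma subd12 : {morph d12 : X Y / X - Y}.
Proof. by move=> X Y; apply: ext3 => l m n; rewrite /d12 !fctE; lmod K. Qed.
Lemma subd13 : {morph d13 : X Y / X - Y}.
Proof. by move=> X Y; apply: ext3 => l m n; rewrite /d13 !fctE; lmod K. Qed.
Lemma subd23 : {morph d23 : X Y / X - Y}.
Proof. by move=> X Y; apply: ext3 => l m n; rewrite /d23 !fctE; lmod K. Qed.

Definition tr12 X := forall n, rtrunc (fun l m => X l m n).
Definition zpow12 r X l m n := zpow (fun l' m' => X l' m' n) r l m.

Lemma zpow_shiftl (Y : int -> int -> M) r p q :
  zpow (fun l m => Y (l + 1) m) r p q = zpow Y r (p + 1) q.
Proof. by apply: eq_tsum => i; rewrite (_ : p + 1 + r - i%:Z = p + r - i%:Z + 1) //; ring. Qed.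

Lemma zpow_shiftr (Y : int -> int -> M) r p q :
  zpow (fun l m => Y l (m + 1)) r p q = zpow Y r p (q + 1).
Proof. by apply: eq_tsum => i; rewrite (_ : q + 1 + i%:Z = q + i%:Z + 1) //; ring. Qed.

Lemma zpow_sub (Y Z : int -> int -> M) r p q : rtrunc Y -> rtrunc Z ->
  zpow (fun l m => Y l m - Z l m) r p q = zpow Y r p q - zpow Z r p q.
Proof.
move=> tY tZ; have := zpow_add 1 (-1) r p q tY tZ.
by rewrite scale1r scaleN1r => <-; apply: eq_zpow => l m; rewrite scale1r scaleN1r.
Qed.

Lemma rtrunc_shiftl (Y : int -> int -> M) : rtrunc Y -> rtrunc (fun l m => Y (l + 1) m).
Proof. by case=> Q h; exists Q => q le p; apply: h. Qed.
Lemma rtrunc_shiftr (Y : int -> int -> M) : rtrunc Y -> rtrunc (fun l m => Y l (m + 1)).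
Proof. by case=> Q h; exists Q => q le p; apply: h; lia. Qed.
Lemma rtrunc_sub (Y Z : int -> int -> M) : rtrunc Y -> rtrunc Z ->
  rtrunc (fun l m => Y l m - Z l m).
Proof.
case=> Q h [Q' h']; exists (Num.max Q Q') => q; rewrite ge_max => /andP[le1 le2] p.
by rewrite h // h' // subrr.
Qed.

Lemma tr12_d13 X : tr12 X -> tr12 (d13 X).
Proof. by move=> t n; apply: (rtrunc_sub (rtrunc_shiftl (t n)) (t (n + 1))). Qed.
Lemma tr12_d23 X : tr12 X -> tr12 (d23 X).
Proof. by move=> t n; apply: (rtrunc_sub (rtrunc_shiftr (t n)) (t (n + 1))). Qed.

Lemma d13_zpow12 r X : tr12 X -> d13 (zpow12 r X) = zpow12 r (d13 X).
Proof.
move=> t; apply: ext3 => l m n; rewrite /d13 /zpow12.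
by rewrite (zpow_sub _ _ _ (rtrunc_shiftl (t n)) (t (n + 1))) (zpow_shiftl (fun l m => X l m n)).
Qed.
Lemma d23_zpow12 r X : tr12 X -> d23 (zpow12 r X) = zpow12 r (d23 X).
Proof.
move=> t; apply: ext3 => l m n; rewrite /d23 /zpow12.
by rewrite (zpow_sub _ _ _ (rtrunc_shiftr (t n)) (t (n + 1))) (zpow_shiftr (fun l m => X l m n)).
Qed.

Lemma iter_zpow12 r X i j : tr12 X ->
  iter i d13 (iter j d23 (zpow12 r X)) = zpow12 r (iter i d13 (iter j d23 X)).
Proof.
move=> t.
have [-> t'] : iter j d23 (zpow12 r X) = zpow12 r (iter j d23 X) /\ tr12 (iter j d23 X).
  by elim: j => //= j [-> t']; split; [exact: d23_zpow12|exact: tr12_d23].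
suff [] : iter i d13 (zpow12 r (iter j d23 X)) = zpow12 r (iter i d13 (iter j d23 X)) /\
  tr12 (iter i d13 (iter j d23 X)) by [].
by elim: i => //= i [-> t'']; split; [exact: d13_zpow12|exact: tr12_d13].
Qed.

Lemma iter_cdiff (Z : int -> int -> int -> M) k r :
  (forall r p q, Z (r + 1) p q = Z r (p + 1) q - Z r p (q + 1)) ->
  iter k (@cdiff K M) (Z r) = Z (r + k%:Z).
Proof.
move=> rec; elim: k => [|k IH] /=; first by rewrite addr0.
rewrite IH; apply: funext => p; apply: funext => q; rewrite /cdiff -rec.
by rewrite (_ : r + k%:Z + 1 = r + k.+1%:Z) //; lia.
Qed.

Lemma iter_ocomm e a b k r w : is_field a -> is_field b ->
  iter k (@cdiff K M) (fun p q => ocomm e a b r p q w) = fun p q => ocomm e a b (r + k%:Z) p q w.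
Proof.
move=> fa fb.
apply: (iter_cdiff (Z := fun r p q => ocomm e a b r p q w)) => *; exact: ocommS.
Qed.

(** [cdiff] is multiplication by z1 - z2 and turns the array for r into the one for r + 1, so
    locality can be tested on the iterated differences of the plain supercommutator r = 0. *)
Lemma localP e a b : is_field a -> is_field b ->
  local e a b <-> exists N : nat, forall w,
    iter N (@cdiff K M) (fun p q => ocomm e a b 0 p q w) = fun _ _ => 0.
Proof.
move=> fa fb; split=> [[N h]|[N h]].
  exists `|N|%N => w; rewrite iter_ocomm //.
  by apply: funext => p; apply: funext => q; apply: h; lia.
exists N%:Z => r p q w le.
have -> : r = N%:Z + `|r - N%:Z|%N%:Z by lia.
have := iter_ocomm e `|r - N%:Z|%N N%:Z w fa fb.
have := iter_ocomm e N 0 w fa fb; rewrite h add0r => <- e0.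
have := congr1 (fun f => f p q) e0 => <- {e0}.
by elim: (`|_|%N) p q => [|k IH] p q //=; rewrite /cdiff !IH subrr.
Qed.

Lemma local_sym e a b : e * e = 1 -> local e a b -> local e b a.
Proof.
move=> ee [N h]; exists N => r p q w le.
have sq : (-1) ^ r * (-1) ^ r = 1 :> K.
  by rewrite -expfzMl mulrNN mulr1 exp1rz.
suff -> : ocomm e b a r p q w = - (e * (-1) ^ r) *: ocomm e a b r q p w by rewrite h ?scaler0.
rewrite /ocomm scalerBr scalerA mulNr mulrACA ee sq mulr1.
by lmod K.
Qed.

Lemma local_lin e a b b' s t : is_field a -> is_field b -> is_field b' ->
  local e a b -> local e a b' -> local e a (fun n w => s *: b n w + t *: b' n w).
Proof.
move=> fa fb fb' [N h] [N' h']; exists (Num.max N N') => r p q w.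
rewrite ge_max => /andP[le le'].
suff -> : ocomm e a (fun n w => s *: b n w + t *: b' n w) r p q w =
  s *: ocomm e a b r p q w + t *: ocomm e a b' r p q w by rewrite h ?h' // !scaler0 addr0.
have [aL _] := fa.
rewrite /ocomm !zpow_add; try first [exact: (field_rtrunc _ fb fa)|exact: (field_rtrunc _ fb' fa)].
rewrite (@eq_zpow _ _ _ (fun l m => s *: a l (b m w) + t *: a l (b' m w))); last first.
  by move=> l m; rewrite aL (linZ (aL _)).
rewrite zpow_add; try first [exact: (field_rtrunc _ fa fb)|exact: (field_rtrunc _ fa fb')].
by lmod K.
Qed.

Section Triple.
Variables (e1 e2 : K) (a b c : int -> M -> M) (w : M) (N1 N2 : nat).
Hypotheses (fa : is_field a) (fb : is_field b) (fc : is_field c).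

Definition triple l m n := a l (b m (c n w)) - (e1 * e2) *: c n (a l (b m w)).

Lemma triple_tr12 : tr12 triple.
Proof.
move=> n; have [aL _] := fa; have [_ hb] := fb; have [cL _] := fc.
have [Q h] := hb (c n w); have [Q' h'] := hb w.
exists (Num.max Q Q') => q; rewrite ge_max => /andP[le le'] p.
by rewrite /triple h // h' // (lin0 (aL _)) (lin0 (cL _)) scaler0 subrr.
Qed.

(** The supercommutator of a(z1) b(z2) with c(z3) is a [b, c] + e2 [a, c] b. A power of z2 - z3
    kills the first term and a power of z1 - z3 the second, and both commute with the expansion of
    the power of z1 - z2. *)
Lemma triple_killed r :
  (forall w, iter N1 (@cdiff K M) (fun p q => ocomm e1 a c 0 p q w) = fun _ _ => 0) ->
  (forall w, iter N2 (@cdiff K M) (fun p q => ocomm e2 b c 0 p q w) = fun _ _ => 0) ->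
  iter N1 d13 (iter N2 d23 (zpow12 r triple)) = 0.
Proof.
move=> h1 h2; rewrite iter_zpow12; last exact: triple_tr12.
have [aL _] := fa.
pose u l m n := a l (ocomm e2 b c 0 m n w).
pose v l m n := ocomm e1 a c 0 l n (b m w).
have -> : triple = u + (e2 *: v).
  apply: ext3 => l m n; rewrite /triple /u /v !fctE !ocomm0 (linB (aL _)) (linZ (aL _)).
  by lmod K.
have D13 X Y : d13 (X + e2 *: Y) = d13 X + e2 *: d13 Y.
  by apply: ext3 => l m n; rewrite /d13 !fctE; lmod K.
have D23 X Y : d23 (X + e2 *: Y) = d23 X + e2 *: d23 Y.
  by apply: ext3 => l m n; rewrite /d23 !fctE; lmod K.
have I13 k X Y : iter k d13 (X + e2 *: Y) = iter k d13 X + e2 *: iter k d13 Y.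
  by elim: k => //= k ->.
have I23 k X Y : iter k d23 (X + e2 *: Y) = iter k d23 X + e2 *: iter k d23 Y.
  by elim: k => //= k ->.
rewrite I23 I13.
have -> : iter N2 d23 u = 0.
  have E k l m n : iter k d23 u l m n =
      a l (iter k (@cdiff K M) (fun p q => ocomm e2 b c 0 p q w) m n).
    by elim: k m n => //= k IH m n; rewrite /d23 !IH /cdiff (linB (aL _)).
  by apply: ext3 => l m n; rewrite E h2 (lin0 (aL _)).
have -> : iter N1 d13 (iter N2 d23 v) = 0.
  have -> : iter N1 d13 (iter N2 d23 v) = iter N2 d23 (iter N1 d13 v).
    elim: N2 => //= k <-; apply: iter_comm; exact: d13_d23.
  have -> : iter N1 d13 v = 0.
    have E k l m n : iter k d13 v l m n =
        iter k (@cdiff K M) (fun p q => ocomm e1 a c 0 p q (b m w)) l n.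
      by elim: k l n => //= k IH l n; rewrite /d13 !IH.
    by apply: ext3 => l m n; rewrite E h1.
  by rewrite iter_morph0 //; exact: subd23.
rewrite iter_morph0; last exact: subd13.
by rewrite scaler0 addr0; apply: ext3 => l m n; rewrite /zpow12 (@zpow_zero K).
Qed.

End Triple.

(** [H r] is the supercommutator with c(z3) before the residue in z1 is taken. It is killed by a
    power of z1 - z2, since a and b are local, and by a product of powers of z1 - z3 and z2 - z3.
    Eliminating z1 - z3 leaves a power of z2 - z3, which survives the residue at l = 0. *)
Lemma dong e e1 e2 a b c r : is_field a -> is_field b -> is_field c ->
  local e a b -> local e1 a c -> local e2 b c -> local (e1 * e2) (nprod e a b r) c.
Proof.
move=> fa fb fc [N lab] /(localP _ fa fc)[N1 h1] /(localP _ fb fc)[N2 h2].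
have [cL _] := fc.
apply/localP => //; first exact: field_nprod.
pose s := `|N - r|%N; exists (s + N1 + N2)%N => w.
pose H r l m n := ocomm e a b r l m (c n w) - (e1 * e2) *: c n (ocomm e a b r l m w).
have H12 r' : d12 (H r') = H (r' + 1).
  by apply: ext3 => l m n; rewrite /d12 /H !ocommS // (linB (cL n) (ocomm _ _ _ _ _ _ _) (ocomm _ _ _ _ _ _ _)); lmod K.
have Hs : iter s d12 (H r) = 0.
  have -> : iter s d12 (H r) = H (r + s%:Z).
    elim: s => [|k IH] /=; first by rewrite addr0.
    by rewrite IH H12; congr H; lia.
  by apply: ext3 => l m n; rewrite /H !lab ?(lin0 (cL _)) ?scaler0 ?subrr //; lia.
have H13 : iter N1 d13 (iter N2 d23 (H r)) = 0.
  have k1 := triple_killed w fa fb fc r h1 h2.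
  have k2 := triple_killed w fb fa fc r h2 h1.
  pose sw X l m n : M := X m l n.
  (* The second half of [ocomm] is the triple with [a] and [b] exchanged, read with z1 and z2
     exchanged by [sw]; the roles of [d13] and [d23] are exchanged with them. *)
  have -> : H r = zpow12 r (triple e1 e2 a b c w) -
      (e * (-1) ^ r) *: sw (zpow12 r (triple e2 e1 b a c w)).
    apply: ext3 => l m n.
    rewrite /H /ocomm /sw /zpow12 /triple !fctE (linB (cL _)) (linZ (cL _)).
    rewrite !(lin_zpow _ _ _ (cL n)); try first [exact: (field_rtrunc _ fa fb)|exact: (field_rtrunc _ fb fa)].
    have t1 := field_rtrunc (c n w) fa fb; have t2 := field_rtrunc (c n w) fb fa.
    have t3 : rtrunc (fun l m => c n (a l (b m w))).
      by have [Q h] := field_rtrunc w fa fb; exists Q => q le p; rewrite h // (lin0 (cL _)).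
    have t4 : rtrunc (fun l m => c n (b l (a m w))).
      by have [Q h] := field_rtrunc w fb fa; exists Q => q le p; rewrite h // (lin0 (cL _)).
    have := zpow_add 1 (- (e1 * e2)) r l m t1 t3.
    rewrite (@eq_zpow _ _ _ (fun l m => a l (b m (c n w)) - (e1 * e2) *: c n (a l (b m w)))).
      move=> ->; have := zpow_add 1 (- (e2 * e1)) r m l t2 t4.
      rewrite (@eq_zpow _ _ _ (fun l m => b l (a m (c n w)) - (e2 * e1) *: c n (b l (a m w)))).
        by move=> ->; lmod K.
      by move=> l' m'; lmod K.
    by move=> l' m'; lmod K.
  have subI13 k : {morph iter k d13 : X Y / X - Y}.
    by move=> X Y; elim: k => //= k ->; rewrite subd13.
  have subI23 k : {morph iter k d23 : X Y / X - Y}.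
    by move=> X Y; elim: k => //= k ->; rewrite subd23.
  rewrite subI23 subI13 k1 sub0r.
  have E k X (d : K) : iter k d13 (d *: X) = d *: iter k d13 X.
    by elim: k => //= k ->; apply: ext3 => l m n; rewrite /d13 !fctE; lmod K.
  have E' k X (d : K) : iter k d23 (d *: X) = d *: iter k d23 X.
    by elim: k => //= k ->; apply: ext3 => l m n; rewrite /d23 !fctE; lmod K.
  have W13 k X : iter k d13 (sw X) = sw (iter k d23 X) by elim: k => //= k ->.
  have W23 k X : iter k d23 (sw X) = sw (iter k d13 X) by elim: k => //= k ->.
  rewrite E' E W23 W13.
  have <- : iter N2 d13 (iter N1 d23 (zpow12 r (triple e2 e1 b a c w))) =
    iter N1 d23 (iter N2 d13 (zpow12 r (triple e2 e1 b a c w))).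
    elim: N1 {k1 k2 h1} => //= k <-; apply: iter_comm; exact: d13_d23.
  by rewrite k2; apply: ext3 => l m n; rewrite !fctE /sw scaler0 oppr0.
(* As z2 - z3 = (z1 - z3) - (z1 - z2), [nilpotent_sub] combines the two vanishing powers into one of
   [d23]. *)
have Hz : iter (s + N1) d23 (iter N2 d23 (H r)) = 0.
  have := @nilpotent_sub _ d12 d13 d12_d13 subd12 subd13
    s N1 (iter N2 d23 (H r)).
  have -> : (fun y : int -> int -> int -> M => d13 y - d12 y) = d23.
    apply: funext => X; apply: ext3 => l m n; rewrite /d13 /d12 /d23 !fctE; by lmod K.
  apply => //.
  have -> : iter s d12 (iter N2 d23 (H r)) = iter N2 d23 (iter s d12 (H r)).
    elim: N2 {H13 h2} => //= k <-; apply: iter_comm; exact: d12_d23.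
  by rewrite Hs iter_morph0 //; exact: subd23.
rewrite -iterD in Hz.
apply: funext => m; apply: funext => n.
have E k p q : iter k (@cdiff K M) (fun p q => ocomm (e1 * e2) (nprod e a b r) c 0 p q w) p q =
  iter k d23 (H r) 0 p q.
  elim: k p q => [|k IH] p q /=; last by rewrite /cdiff !IH.
  by rewrite ocomm0.
by rewrite E Hz.
Qed.

End Dong.

(** * Translation covariance, and uniqueness of the field with a given state *)

Section Translation.
Variables (K : numFieldType) (M : lmodType K).
Implicit Types a b : int -> M -> M.

(** The operator d/dz1 + d/dz2 annihilates powers of z1 - z2, hence commutes with multiplication by
    them. In coefficients the cancellation is [bz_mulS] after a shift of the summation index. *)
Lemma zpow_deriv (X : int -> int -> M) r p q : rtrunc X ->
  zpow (fun l m => - l%:~R *: X (l - 1) m - m%:~R *: X l (m - 1)) r p q =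
  - p%:~R *: zpow X r (p - 1) q - q%:~R *: zpow X r p (q - 1).
Proof.
move=> [Q tX].
pose x i := X (p + r - 1 - i%:Z) (q + i%:Z).
pose y i := X (p + r - i%:Z) (q - 1 + i%:Z).
have ezx c : ez (fun i => c i *: x i).
  by exists `|Q - q|%N => i le; rewrite /x tX ?scaler0 //; lia.
have ezy c : ez (fun i => c i *: y i).
  by exists `|Q - q|%N.+1 => i le; rewrite /y tX ?scaler0 //; lia.
have yS i : y i.+1 = x i.
  rewrite /y /x; congr (X _ _); lia.
rewrite /zpow.
rewrite (@eq_tsum _ _ (fun i => ((-1) ^+ i * bz K r i) *: _) (fun i =>
   ((-1) ^+ i * bz K r i * - (p + r - i%:Z)%:~R) *: x i +
   ((-1) ^+ i * bz K r i * - (q + i%:Z)%:~R) *: y i)); last first.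
  move=> i; rewrite /x /y (_ : p + r - i%:Z - 1 = p + r - 1 - i%:Z); last by lia.
  by rewrite (_ : q + i%:Z - 1 = q - 1 + i%:Z); [lmod K|lia].
rewrite tsumD //.
rewrite (@eq_tsum _ _ (fun i => _ *: X (p - 1 + r - i%:Z) _)
   (fun i => ((-1) ^+ i * bz K r i) *: x i)); last first.
  by move=> i; rewrite /x (_ : p - 1 + r - i%:Z = p + r - 1 - i%:Z) //; lia.
rewrite -(tsumZ (- p%:~R)) // -(tsumZ q%:~R) // -tsumN; last exact: ezZ.
pose t i := (-1) ^+ i * bz K r i.
rewrite (@eq_tsum _ _ _ (fun i => - p%:~R *: (t i *: x i) + (t i * - (r - i%:Z)%:~R) *: x i)).
  rewrite (@eq_tsum _ _ (fun i => (_ * - (q + i%:Z)%:~R) *: y i)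
     (fun i => - (q%:~R *: (t i *: y i)) + (t i * - i%:R) *: y i)).
    have ezp : ez (fun i => - p%:~R *: (t i *: x i)) by apply: ezZ; apply: ezx.
    have ezn : ez (fun i => - (q%:~R *: (t i *: y i))).
      apply: ez_sub (ezy (fun _ => 1)) => i.
      by rewrite scale1r => ->; rewrite !scaler0 oppr0.
    rewrite (tsumD ezp (ezx (fun i => t i * - (r - i%:Z)%:~R))).
    rewrite (tsumD ezn (ezy (fun i => t i * - i%:R))).
    rewrite addrACA -[RHS]addr0; congr (_ + _).
    rewrite (tsumS (ezy (fun i => t i * - i%:R))) mulr0n.
    rewrite oppr0 mulr0 scale0r add0r -tsumD //.
      rewrite -[RHS](@tsum0 K M); apply: eq_tsum => i; rewrite yS -scalerDl /t exprS.
      rewrite -[RHS](scale0r (x i)); congr (_ *: _).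
      have := bz_mulS K r i => e.
      have -> : -1 * (-1) ^+ i * bz K r i.+1 * - i.+1%:R = (-1) ^+ i * (bz K r i.+1 * i.+1%:R).
        by ring.
      by rewrite e; ring.
    by exists `|Q - q|%N => i le; rewrite yS /x tX ?scaler0 //; lia.
  by move=> i; rewrite /t intrD; lmod K.
by move=> i; rewrite /t !intrD; lmod K.
Qed.

Section Derivation.
Variables (D : M -> M) (vac : M).
Hypothesis DL : is_linear D.

Definition cov a := forall n w, D (a n w) - a n (D w) = - n%:~R *: a (n - 1) w.

Lemma cov_nprod e a b r : is_field a -> is_field b -> cov a -> cov b -> cov (nprod e a b r).
Proof.
move=> fa fb ca cb n w.
have [aL _] := fa; have [bL _] := fb.
have tab v := field_rtrunc v fa fb; have tba v := field_rtrunc v fb fa.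
have gen (a' b' : int -> M -> M) r' p q : is_field a' -> is_field b' -> cov a' -> cov b' ->
   D (zpow (fun l m => a' l (b' m w)) r' p q) - zpow (fun l m => a' l (b' m (D w))) r' p q =
   - p%:~R *: zpow (fun l m => a' l (b' m w)) r' (p - 1) q -
   q%:~R *: zpow (fun l m => a' l (b' m w)) r' p (q - 1).
  move=> fa' fb' ca' cb'; have [aL' _] := fa'.
  have t1 := field_rtrunc w fa' fb'; have t2 := field_rtrunc (D w) fa' fb'.
  rewrite -zpow_deriv // (lin_zpow _ _ _ DL t1) -(zpow_sub (K := K)) //.
    apply: eq_zpow => l m.
    have := ca' l (b' m w); move/eqP; rewrite subr_eq => /eqP ->.
    have := cb' m w; move/eqP; rewrite subr_eq => /eqP ->.
    rewrite (linD (aL' _)) (linZ (aL' _)); lmod K.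
  by have [Q h] := t1; exists Q => q' le p'; rewrite h // (lin0 DL).
rewrite /nprod /ocomm (linB DL) (linZ DL).
have := gen _ _ r 0 n fa fb ca cb; move/eqP; rewrite subr_eq => /eqP ->.
have := gen _ _ r n 0 fb fa cb ca; move/eqP; rewrite subr_eq => /eqP ->.
by lmod K.
Qed.

Definition creates a := forall n, 0 <= n -> a n vac = 0.

Lemma nprod_vac e a b r q : is_field a -> is_field b -> creates a -> creates b -> 0 <= q ->
  nprod e a b r q vac = 0.
Proof.
move=> [aL _] [bL _] va vb q0; rewrite /nprod /ocomm /zpow.
rewrite (@eq_tsum _ _ _ (fun _ => 0)) ?tsum0; last first.
  by move=> i; rewrite vb ?(lin0 (aL _)) ?scaler0 //; lia.
rewrite (@eq_tsum _ _ _ (fun _ => 0)) ?tsum0 ?scaler0 ?subr0 // => i.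
by rewrite va ?(lin0 (bL _)) ?scaler0 //; lia.
Qed.

Lemma nprod_vacN1 e a b r : is_field a -> is_field b -> creates a -> creates b ->
  nprod e a b r (-1) vac = a r (b (-1) vac).
Proof.
move=> [aL _] [bL _] va vb; rewrite /nprod /ocomm /zpow (@tsum1 _ _ _ 0); last first.
  by case=> // i _; rewrite vb ?(lin0 (aL _)) ?scaler0 //; lia.
rewrite (@eq_tsum _ _ (fun i => _ *: b _ _) (fun _ => 0)) ?tsum0 ?scaler0 ?subr0; last first.
  by move=> i; rewrite va ?(lin0 (bL _)) ?scaler0 //; lia.
by rewrite bz0 expr0 mulr1 scale1r ?add0r ?addr0 ?subr0 ?add0r.
Qed.

Hypothesis Dvac : D vac = 0.
Variables (I : Type) (g : I -> int -> M -> M) (s : I -> K).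
Hypothesis gF : forall i, is_field (g i).
Hypothesis g_ind : forall P : M -> Prop, P 0 -> (forall x y, P x -> P y -> P (x + y)) ->
  (forall k x, P x -> P (k *: x)) -> P vac -> (forall i n x, P x -> P (g i n x)) ->
  forall x, P x.

(* A translation covariant field that is local with the generating fields is
   determined by the vector it creates from the vacuum. *)
Lemma field_uniqueness c : is_field c -> cov c -> creates c -> c (-1) vac = 0 ->
  (forall i, local (s i) c (g i)) -> forall n w, c n w = 0.
Proof.
move=> fc cc vc c1 loc n w; have [cL _] := fc.
(* Covariance turns D c_n 1 into - n c_(n-1) 1, and n is nonzero for negative n; characteristic zero
   lets one divide. *)
have cv k : c (- k.+1%:Z) vac = 0.
  elim: k => // k IH; have := cc (- k.+1%:Z) vac.
  rewrite Dvac IH (lin0 DL) (lin0 (cL _)) subrr => /esym/eqP.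
  rewrite scaler_eq0 oppr_eq0 intr_eq0 /= => /eqP.
  by rewrite (_ : - k.+1%:Z - 1 = - k.+2%:Z) //; lia.
move: n; elim/g_ind: w => [|x y hx hy|k x hx||i m x hx] n.
- exact: (lin0 (cL n)).
- by rewrite (linD (cL n)) hx hy addr0.
- by rewrite (linZ (cL n)) hx scaler0.
- have [le|lt] := leP 0 n; first exact: vc.
  by rewrite (_ : n = - (`|n|.-1).+1%:Z) ?cv //; lia.
have [N h] := (localP (s i) fc (gF i)).1 (loc i).
pose X p q := c p (g i q x).
have e0 : (fun p q => ocomm (s i) c (g i) 0 p q x) = X.
  apply: funext => p; apply: funext => q.
  by rewrite ocomm0 hx (lin0 ((gF i).1 _)) scaler0 subr0.
have := h x; rewrite e0 => {}h {e0}.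
have [Q tX] : rtrunc X by exact: (field_rtrunc x fc (gF i)).
suff : X = fun _ _ => 0 by move/(congr1 (fun f => f n m)).
have : exists Q, forall q, Q <= q -> forall p, X p q = 0 by exists Q.
move: X h {tX Q}; elim: N => [|N IH] X //; rewrite iterSr => h [Q tX].
have {}h : cdiff X = fun _ _ => 0.
  apply: IH => //; exists Q => q le p; rewrite /cdiff !tX ?subrr //; lia.
(* An array killed by z1 - z2 is constant along the antidiagonals, and on each of them it reaches
   the range of q where truncation makes it zero. *)
have sh p q k : X p q = X (p - k%:Z) (q + k%:Z).
  elim: k => [|k ->]; first by rewrite subr0 addr0.
  have := congr1 (fun f => f (p - k.+1%:Z) (q + k%:Z)) h; rewrite /cdiff.
  rewrite (_ : p - k.+1%:Z + 1 = p - k%:Z); last by lia.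
  rewrite (_ : q + k%:Z + 1 = q + k.+1%:Z); last by lia.
  by move/eqP; rewrite subr_eq0 => /eqP.
apply: funext => p; apply: funext => q.
by rewrite (sh p q `|Q - q|%N) tX //; lia.
Qed.

End Derivation.
End Translation.

Lemma dcoefS (j : int) k : dcoef j k.+1 = dcoef j k * (j - k%:Z).
Proof. by rewrite /dcoef big_ord_recr. Qed.

Lemma dcoefSl (j : int) k : dcoef j k.+1 = j * dcoef (j - 1) k.
Proof.
rewrite /dcoef big_ord_recl /= subr0; congr (_ * _); apply: eq_bigr => i _.
rewrite /bump /=; lia.
Qed.

Section TermMap.
Variable K : fieldType.

Fixpoint tmap (X Y : Type) (f : X -> Y) (t : term K X) : term K Y :=
  match t with
  | TZ => TZ
  | TA x y => TA (tmap f x) (tmap f y)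
  | TS c x => TS c (tmap f x)
  | TG x => TG (f x)
  end.

Lemma ext_tmap (X Y : Type) (W : lmodType K) (phi : Y -> W) (f : X -> Y) t :
  ext phi (tmap f t) = ext (phi \o f) t.
Proof. by elim: t => //= [x -> y ->|c x ->]. Qed.

Definition term_sum (X : Type) (s : seq (term K X)) : term K X := foldr (@TA K X) TZ s.

Lemma ext_sum (X : Type) (W : lmodType K) (phi : X -> W) N (f : nat -> term K X) :
  ext phi (term_sum [seq f i | i <- iota 0 N]) = \sum_(i < N) ext phi (f i).
Proof.
rewrite -(big_mkord xpredT (fun i => ext phi (f i))) /index_iota subn0.
by elim: (iota 0 N) => [|i s IH] /=; rewrite ?big_nil ?big_cons //= IH.
Qed.
End TermMap.

(** * The vacuum module and its vertex superalgebra *)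

Section VacuumModule.
Variables (K : numFieldType) (S : lmodType K) (pr : bool -> S -> S).
Variable F : nat -> nat -> S -> S -> S.
Hypothesis Ftrunc : forall u v, exists N, forall n k, (N <= n)%N \/ (N <= k)%N -> F n k u v = 0.

Local Notation word := (seq (bool * int * S)).

(* Coefficient of [F_i^k(u, v)_(m + q - i - k)] in [[u_m, v_q]]. *)
Definition mode_coef (m q : int) (i k : nat) : K :=
  bz K m i * ((-1) ^+ k * (dcoef (m + q - i%:Z) k)%:~R).

(** A letter [(b, n, u)] stands for the n-th mode of the component of parity [b] of [u], which is
    what [BrPar] says. [BrComm] takes the bound [N] as an argument to make its double sum a finite
    term. Prefixes are added in [vm_rel], so [BrVac] bears on the last letter of a word. *)
Inductive base_rel : term K word -> Prop :=
 | BrLin b n c u v r : base_rel (TA (TG ((b, n, c *: u + v) :: r))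
     (TS (-1) (TA (TS c (TG ((b, n, u) :: r))) (TG ((b, n, v) :: r)))))
 | BrComm a m u b q v r N :
     (forall n k, (N <= n)%N \/ (N <= k)%N -> F n k (pr a u) (pr b v) = 0) ->
     base_rel (TA (TG ((a, m, u) :: (b, q, v) :: r))
      (TS (-1) (TA (TS (eps a b) (TG ((b, q, v) :: (a, m, u) :: r)))
       (term_sum [seq term_sum [seq TS (mode_coef m q i k)
          (TG ((a (+) b, m + q - i%:Z - k%:Z, F i k (pr a u) (pr b v)) :: r))
           | k <- iota 0 N] | i <- iota 0 N]))))
 | BrPar b n u r :
     base_rel (TA (TG ((b, n, u) :: r)) (TS (-1) (TG ((b, n, pr b u) :: r))))
 | BrVac b n u : 0 <= n -> base_rel (TG [:: (b, n, u)]).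

Definition vm_rel (t : term K word) : Prop :=
  exists p t0, base_rel t0 /\ t = tmap (cat p) t0.

Lemma vm_killsP (W : lmodType K) (phi : word -> W) :
  (forall p, kills base_rel (phi \o cat p)) -> kills vm_rel phi.
Proof. by move=> h t [p [t0 [b ->]]]; rewrite ext_tmap; apply: h. Qed.

(* Words in the modes [u_n], acting on a vector annihilated by the modes [u_n] with [n >= 0].
   Its universal property needs no hypothesis on [F]; only [agen_injective] does. *)
Definition vmod : lmodType K := pres vm_rel.

Definition vgen (w : word) : vmod := pgen vm_rel w.
Definition vac : vmod := vgen [::].
Definition opr (b : bool) (u : S) (n : int) : vmod -> vmod :=
  plift (fun w => vgen ((b, n, u) :: w)).

Lemma vgen_kills p : kills base_rel (vgen \o cat p).
Proof.
by move=> t bt; rewrite -ext_tmap; apply: pres_ext0; exists p, t.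
Qed.

Lemma opr_kills l : kills vm_rel (fun w => vgen (l :: w)).
Proof. by apply: vm_killsP => p; apply: (vgen_kills (l :: p)). Qed.

Lemma opr_gen b u n w : opr b u n (vgen w) = vgen ((b, n, u) :: w).
Proof. exact: plift_gen (opr_kills _). Qed.

Lemma opr_linear b u n : is_linear (opr b u n).
Proof. exact: plift_linear (opr_kills _). Qed.

Lemma vmod_ind (P : vmod -> Prop) : P 0 -> (forall x y, P x -> P y -> P (x + y)) ->
  (forall c x, P x -> P (c *: x)) -> P vac -> (forall b u n x, P x -> P (opr b u n x)) ->
  forall x, P x.
Proof.
move=> P0 PD PS Pv Po; apply: pres_ind => // w; elim: w => [|[[b n] u] w IH] //.
by rewrite -[pgen _ _]/(vgen _) -opr_gen; apply: Po.
Qed.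

Lemma opr_lin b n x : is_linear (fun u => opr b u n x).
Proof.
move=> c u v; move: x; apply: pres_linext => [||w]; first exact: opr_linear.
  by apply: lin_add; [apply: lin_scale|]; apply: opr_linear.
rewrite -[pgen _ _]/(vgen w) !opr_gen.
have := @vgen_kills [::] _ (BrLin b n c u v w); rewrite /= scaleN1r.
by move/eqP; rewrite subr_eq0 => /eqP.
Qed.

Lemma opr_pr b u n x : opr b (pr b u) n x = opr b u n x.
Proof.
apply/esym; move: x; apply: pres_linext => [||w]; try exact: opr_linear.
rewrite -[pgen _ _]/(vgen w) !opr_gen.
have := @vgen_kills [::] _ (BrPar b n u w); rewrite /= scaleN1r.
by move/eqP; rewrite subr_eq0 => /eqP.
Qed.

Lemma opr_comm a m u b q v N x :
  (forall n k, (N <= n)%N \/ (N <= k)%N -> F n k (pr a u) (pr b v) = 0) ->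
  opr a u m (opr b v q x) = eps a b *: opr b v q (opr a u m x) +
   \sum_(i < N) \sum_(k < N) mode_coef m q i k *:
     opr (a (+) b) (F i k (pr a u) (pr b v)) (m + q - i%:Z - k%:Z) x.
Proof.
move=> hN; move: x; apply: pres_linext => [||w].
- exact: (lin_comp (opr_linear b v q) (opr_linear a u m)).
- apply: lin_add.
    by apply: lin_scale; apply: (lin_comp (opr_linear a u m) (opr_linear b v q)).
  apply: lin_bigsum => i; apply: lin_bigsum => k; apply: lin_scale; exact: opr_linear.
rewrite -[pgen _ _]/(vgen w) !opr_gen.
have := @vgen_kills [::] _ (BrComm m q w hN); rewrite /= scaleN1r.
move/eqP; rewrite subr_eq0 => /eqP ->; congr (_ + _).
rewrite ext_sum; apply: eq_bigr => i _; rewrite ext_sum; apply: eq_bigr => k _.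
by rewrite opr_gen.
Qed.

Lemma opr_vac b u n : 0 <= n -> opr b u n vac = 0.
Proof. by move=> n0; rewrite opr_gen; apply: (@vgen_kills [::] _ (BrVac b u n0)). Qed.

Lemma int_bound (Q : nat -> int -> Prop) :
  (forall i, exists N : int, forall n, N <= n -> Q i n) ->
  forall k, exists N : int, forall i n, (i < k)%N -> N <= n -> Q i n.
Proof.
move=> h; elim=> [|k [N hN]]; first by exists 0.
have [N' hN'] := h k; exists (Num.max N N') => i n; rewrite ltnS leq_eqVlt ge_max.
by case/orP => [/eqP -> /andP[_ /hN']|lt /andP[le _]] //; apply: hN.
Qed.

(** When u_n crosses the first letter of a word, the corrections have modes n + q - i - k with i, k
    < [N] and act on a shorter word, so its truncation bounds work after a shift by q and twice
    [N]. *)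
Lemma opr_field b u : is_field (opr b u).
Proof.
split=> [n|w]; first exact: opr_linear.
elim/vmod_ind: w b u => [|x y hx hy|c x hx||a v q x hx] b u.
- by exists 0 => n _; rewrite (lin0 (opr_linear _ _ _)).
- have [N h] := hx b u; have [N' h'] := hy b u; exists (Num.max N N') => n.
  by rewrite ge_max => /andP[le le']; rewrite (linD (opr_linear _ _ _)) h // h' // addr0.
- by have [N h] := hx b u; exists N => n le; rewrite (linZ (opr_linear _ _ _)) h // scaler0.
- by exists 0 => n le; rewrite opr_vac.
have [N hN] := Ftrunc (pr b u) (pr a v); have [B hB] := hx b u.
have [C hC] : exists C : int, forall i n, (i < N)%N -> C <= n -> forall k, (k < N)%N ->
    opr (b (+) a) (F i k (pr b u) (pr a v)) n x = 0.
  apply: (@int_bound (fun i n => forall k, (k < N)%N ->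
    opr (b (+) a) (F i k (pr b u) (pr a v)) n x = 0)) => i.
  have [C hC] := @int_bound (fun k n => opr (b (+) a) (F i k (pr b u) (pr a v)) n x = 0)
    (fun k => hx _ _) N.
  by exists C => n le k lt; apply: hC.
exists (Num.max B (C - q + N%:Z + N%:Z)) => n; rewrite ge_max => /andP[le le'].
rewrite (opr_comm n q x hN) hB // (lin0 (opr_linear _ _ _)) scaler0 add0r big1 // => i _.
rewrite big1 // => k _; rewrite hC ?scaler0 //.
by have := ltn_ord i; have := ltn_ord k; lia.
Qed.

(** The commutator is a combination of the [bz p i] with i < [N] whose coefficients depend on p + q
    alone. Each difference lowers the index of the binomial by one, so [N] of them kill it. *)
Lemma opr_local a u b v : local (eps a b) (opr a u) (opr b v).
Proof.
have [N hN] := Ftrunc (pr a u) (pr b v).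
apply/localP; [exact: opr_field|exact: opr_field|exists N => w].
pose Z i (j : int) : vmod := \sum_(k < N) ((-1) ^+ k * (dcoef j k)%:~R) *:
  opr (a (+) b) (F i k (pr a u) (pr b v)) (j - k%:Z) w.
have Z0 i j : (N <= i)%N -> Z i j = 0.
  move=> le; rewrite /Z big1 // => k _; rewrite hN; last by left.
  by rewrite (lin0 (opr_lin _ _ _)) scaler0.
pose Y j (p q : int) := tsum (fun i => bz K p i *: Z (i + j)%N (p + q - i%:Z)).
have -> : (fun p q => ocomm (eps a b) (opr a u) (opr b v) 0 p q w) = Y 0%N.
  apply: funext => p; apply: funext => q; rewrite ocomm0 (opr_comm p q w hN) addrC addKr.
  rewrite /Y (@tsumE _ _ N) => [|i le]; last by rewrite Z0 ?scaler0 ?addn0.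
  apply: eq_bigr => i _; rewrite /Z scaler_sumr addn0; apply: eq_bigr => k _.
  by rewrite scalerA.
rewrite (_ : Y 0%N = fun p q => tsum (fun i => bz K p i *: Z i (p + q - i%:Z))); last first.
  by apply: funext => p; apply: funext => q; apply: eq_tsum => i; rewrite addn0.
rewrite (iter_cdiff_expansion N Z0); apply: funext => p; apply: funext => q.
by rewrite -[RHS](@tsum0 K vmod); apply: eq_tsum => i; rewrite Z0 ?scaler0 // leq_addl.
Qed.

Fixpoint dword (w : word) : vmod :=
  if w is (b, n, u) :: w' then opr b u n (dword w') - n%:~R *: vgen ((b, n - 1, u) :: w')
  else 0.

(** What [BrComm] requires of the translation operator: lowering either mode of [u_m, v_q] by the
    Leibniz rule must agree with lowering the modes m + q - i - k of the right-hand side. *)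
Lemma mode_coef_deriv m q i k :
  q%:~R * mode_coef m (q - 1) i k + m%:~R * mode_coef (m - 1) q i k =
  (m + q - i%:Z - k%:Z)%:~R * mode_coef m q i k.
Proof.
rewrite /mode_coef.
have -> : m + (q - 1) - i%:Z = m + q - i%:Z - 1 by lia.
have -> : m - 1 + q - i%:Z = m + q - i%:Z - 1 by lia.
have e1 : m%:~R * bz K (m - 1) i = bz K m i * (m - i%:Z)%:~R.
  rewrite -(bz_mulS K m i).
  have := bzS K (m - 1) i; rewrite subrK => ->.
  have := bz_mulS K (m - 1) i => e; rewrite mulrDl e !intrD; ring.
set j := m + q - i%:Z; set d := dcoef (j - 1) k.
have e2 : (j%:~R * d%:~R : K) = (dcoef j k)%:~R * (j - k%:Z)%:~R.
  by rewrite -!intrM -dcoefS dcoefSl.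
have -> : q%:~R * (bz K m i * ((-1) ^+ k * d%:~R)) + m%:~R * (bz K (m - 1) i * ((-1) ^+ k * d%:~R))
   = (q%:~R * bz K m i + m%:~R * bz K (m - 1) i) * ((-1) ^+ k * d%:~R) by ring.
rewrite e1.
have -> : q%:~R * bz K m i + bz K m i * (m - i%:Z)%:~R = bz K m i * j%:~R.
  by rewrite /j !intrD; ring.
have -> : bz K m i * j%:~R * ((-1) ^+ k * d%:~R) = bz K m i * (-1) ^+ k * (j%:~R * d%:~R) by ring.
by rewrite e2; ring.
Qed.

Lemma dword_kills : kills vm_rel dword.
Proof.
apply: vm_killsP => p; elim: p => [|[[b n] u] p IH] t bt; last first.
  have -> : ext (dword \o cat ((b, n, u) :: p)) t =
     opr b u n (ext (dword \o cat p) t) - n%:~R *: ext (vgen \o cat ((b, n - 1, u) :: p)) t.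
    elim: t {bt} => /= [|x -> y ->|c x ->|w] //.
    - by rewrite (lin0 (opr_linear _ _ _)) scaler0 subrr.
    - by rewrite (linD (opr_linear _ _ _)); lmod K.
    - by rewrite (linZ (opr_linear _ _ _)); lmod K.
  by rewrite IH // vgen_kills // (lin0 (opr_linear _ _ _)) scaler0 subrr.
case: bt => [b n c u v r|a m u b q v r N hN|b n u r|b n u n0] /=.
- by rewrite -!opr_gen !(opr_lin _ _ _ c u v); lmod K.
- rewrite -!opr_gen !(linB (opr_linear _ _ _)) !(linZ (opr_linear _ _ _)) ext_sum.
  rewrite (eq_bigr (fun i : 'I_N => \sum_(k < N) (mode_coef m q i k *:
     opr (a (+) b) (F i k (pr a u) (pr b v)) (m + q - i%:Z - k%:Z) (dword r) -
    (q%:~R *: (mode_coef m (q - 1) i k *: opr (a (+) b) (F i k (pr a u) (pr b v))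
         (m + (q - 1) - i%:Z - k%:Z) (vgen r)) +
     m%:~R *: (mode_coef (m - 1) q i k *: opr (a (+) b) (F i k (pr a u) (pr b v))
         (m - 1 + q - i%:Z - k%:Z) (vgen r)))))); last first.
    move=> i _; rewrite ext_sum; apply: eq_bigr => k _ /=.
    rewrite -opr_gen.
    rewrite (_ : m + (q - 1) - i%:Z - k%:Z = m + q - i%:Z - k%:Z - 1); last by lia.
    rewrite (_ : m - 1 + q - i%:Z - k%:Z = m + q - i%:Z - k%:Z - 1); last by lia.
    rewrite scalerBr ![_ *: (_ *: opr _ _ (_ - 1) _)]scalerA -scalerDl mode_coef_deriv.
    by rewrite [mode_coef _ _ _ _ * _]mulrC.
  rewrite !(opr_comm _ _ _ hN).
  under eq_bigr do rewrite sumrB big_split /= -!scaler_sumr.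
  rewrite sumrB big_split /= -!scaler_sumr.
  by lmod K.
- by rewrite -!opr_gen !opr_pr scaleN1r subrr.
- rewrite (lin0 (opr_linear _ _ _)) sub0r.
  have [->|nz] := eqVneq n 0; first by rewrite scale0r oppr0.
  rewrite -opr_gen opr_vac ?scaler0 ?oppr0 //; lia.
Qed.

Definition vD : vmod -> vmod := plift dword.

Lemma vD_linear : is_linear vD. Proof. exact: plift_linear dword_kills. Qed.

Lemma vD_vac : vD vac = 0. Proof. by rewrite /vD plift_gen //; exact: dword_kills. Qed.

Lemma vD_opr b u : cov vD (opr b u).
Proof.
move=> n; apply: pres_linext => [||w].
- apply: lin_add; first exact: (lin_comp (opr_linear _ _ _) vD_linear).
  apply: lin_opp; exact: (lin_comp vD_linear (opr_linear _ _ _)).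
- by apply: lin_scale; apply: opr_linear.
rewrite -[pgen _ _]/(vgen w) !opr_gen /vD !plift_gen; try exact: dword_kills.
by rewrite /=; lmod K.
Qed.

End VacuumModule.

Section Submodule.
Variables (K : fieldType) (U : lmodType K) (P : U -> Prop).
Hypothesis hP : is_subspace P.

(** The proof is an argument of the predicate so that the closure instance can be attached to it. *)
Definition subm_pred of is_subspace P : {pred U} := fun x => `[< P x >].

Fact subm_closed : GRing.submod_closed (subm_pred hP).
Proof.
case: hP => P0 PD PS; split; first by apply/asboolP.
by move=> c x y /asboolP Px /asboolP Py; apply/asboolP; apply: PD => //; apply: PS.
Qed.

HB.instance Definition _ := GRing.isSubmodClosed.Build K U (subm_pred hP) subm_closed.

Definition subm := {x : U | x \in subm_pred hP}.
HB.instance Definition _ := Choice.on subm.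
HB.instance Definition _ := SubChoice.on subm.
HB.instance Definition _ := [SubChoice_isSubLmodule of subm by <:].

Lemma submP (x : subm) : P (val x). Proof. exact/asboolP/(valP x). Qed.

Definition mksub (x : U) (Px : P x) : subm := Sub x (asboolT Px).

Lemma val_linear : is_linear (val : subm -> U).
Proof. by []. Qed.
End Submodule.

Section FieldAlgebra.
Variables (K : numFieldType) (M : lmodType K).
Implicit Types a b : int -> M -> M.

Lemma field_lin a b s t : is_field a -> is_field b ->
  is_field (fun n w => s *: a n w + t *: b n w).
Proof.
move=> [aL ha] [bL hb]; split=> [n|w].
  by apply: lin_add; apply: lin_scale.
have [N h] := ha w; have [N' h'] := hb w; exists (Num.max N N') => n.
by rewrite ge_max => /andP[le le']; rewrite h // h' // !scaler0 addr0.
Qed.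

Lemma field0 : is_field (fun _ _ => 0 : M).
Proof. by split=> [n|w]; [exact: lin_zero|exists 0]. Qed.

Lemma cov_lin (D : M -> M) a b s t : is_linear D -> cov D a -> cov D b ->
  cov D (fun n w => s *: a n w + t *: b n w).
Proof.
move=> DL ca cb n w; rewrite (linD DL) !(linZ DL).
have := ca n w; have := cb n w; move/eqP; rewrite subr_eq => /eqP ->.
by move/eqP; rewrite subr_eq => /eqP ->; lmod K.
Qed.

Lemma creates_lin (v : M) a b s t : creates v a -> creates v b ->
  creates v (fun n w => s *: a n w + t *: b n w).
Proof. by move=> ca cb n n0; rewrite ca // cb // !scaler0 addr0. Qed.

Lemma ocomm_0l e b r p q w : is_field b -> ocomm e (fun _ _ => 0) b r p q w = 0.
Proof.
move=> [bL _]; rewrite /ocomm zpow_zero (@eq_zpow _ _ _ (fun _ _ => 0)).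
  by rewrite zpow_zero scaler0 subrr.
by move=> l m; rewrite (lin0 (bL _)).
Qed.

Lemma ocomm_0r e a r p q w : is_field a -> ocomm e a (fun _ _ => 0) r p q w = 0.
Proof.
move=> [aL _]; rewrite /ocomm zpow_zero (@eq_zpow _ _ _ (fun _ _ => 0)).
  by rewrite zpow_zero scaler0 subrr.
by move=> l m; rewrite (lin0 (aL _)).
Qed.

Definition id_field : int -> M -> M := fun n w => if n == -1 then w else 0.

Lemma id_is_field : is_field id_field.
Proof.
split=> [n|w]; first by apply: lin_if.
by exists 0 => n le; rewrite /id_field; case: eqP => // e; move: le; rewrite e.
Qed.

Lemma id_local a : is_field a -> local 1 id_field a.
Proof.
move=> fa; apply/localP => //; first exact: id_is_field.
exists 0%N => w; apply: funext => p; apply: funext => q /=.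
rewrite ocomm0 /id_field scale1r; case: eqP => _; first exact: subrr.
by rewrite (lin0 (fa.1 _)) subrr.
Qed.

Lemma local0l e b : is_field b -> local e (fun _ _ => 0) b.
Proof. by move=> fb; exists 0 => r p q w _; apply: ocomm_0l. Qed.

Lemma local0r e a : is_field a -> local e a (fun _ _ => 0).
Proof. by move=> fa; exists 0 => r p q w _; apply: ocomm_0r. Qed.

Lemma bzN2 i : (-1) ^+ i * bz K (-2) i = i.+1%:R.
Proof.
rewrite /bz -[(-2)]/(Negz 1) /= add1n binSn intrM [((-1) ^+ i)%:~R]rmorphXn /= mulrA.
by rewrite -exprMn rmorphN1 mulrNN mulr1 expr1n mul1r.
Qed.

(** The (-2)-nd product with the identity field is d/dz. Only one mode of the identity is nonzero:
    for q < 0 it is met by the first expansion, at i = - q - 1, for q > 0 by the second, at i = q -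
    1, and for q = 0 by neither. *)
Lemma nprod_id a q w : is_field a -> nprod 1 a id_field (-2) q w = - q%:~R *: a (q - 1) w.
Proof.
move=> [aL _]; rewrite /nprod /ocomm /zpow /id_field.
rewrite (_ : 1 * (-1) ^ (-2) = 1 :> K); last by rewrite mul1r -[_ ^ _]/(((-1) ^+ 2)^-1) sqrrN expr1n invr1.
rewrite scale1r.
have [q0|q0] := ltP q 0.
  rewrite (@tsum1 _ _ _ (absz (1 + q))) => [|i ne]; last first.
    by case: eqP => [e|_]; [case/eqP: ne; lia|rewrite (lin0 (aL _)) scaler0].
  rewrite (@eq_tsum _ _ _ (fun _ => 0)) ?tsum0 ?subr0 => [|i]; last first.
    by case: eqP => [e|_]; [lia|rewrite scaler0].
  rewrite ifT; last by apply/eqP; lia.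
  rewrite bzN2 (_ : 0 + (-2) - (absz (1 + q))%:Z = q - 1); last by lia.
  rewrite -[_.+1%:R]/(_.+1%:~R) (_ : (absz (1 + q)).+1%:Z = - q); last by lia.
  by rewrite rmorphN.
rewrite (@eq_tsum _ _ _ (fun _ => 0)) ?tsum0 ?sub0r => [|i]; last first.
  by case: eqP => [e|_]; [lia|rewrite (lin0 (aL _)) scaler0].
have [->|nz] := eqVneq q 0.
  rewrite (@eq_tsum _ _ _ (fun _ => 0)) ?tsum0 ?oppr0 ?scale0r // => i.
  by case: eqP => [e|_]; [lia|rewrite scaler0].
rewrite (@tsum1 _ _ _ `|q - 1|%N) => [|i ne]; last first.
  by case: eqP => [e|_]; [case/eqP: ne; lia|rewrite scaler0].
rewrite ifT; last by apply/eqP; lia.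
rewrite bzN2 (_ : 0 + `|q - 1|%N%:Z = q - 1); last by lia.
rewrite -[_.+1%:R]/(_.+1%:~R) (_ : `|q - 1|%N.+1%:Z = q); last by lia.
by rewrite scaleNr.
Qed.

(* A field [x] is stored as the pair of its homogeneous parts [x false] and [x true]. *)
Definition sfield := bool -> int -> M -> M.

Definition sprod (r : int) (x y : sfield) : sfield := fun c n w =>
  nprod (eps false c) (x false) (y c) r n w + nprod (eps true (~~ c)) (x true) (y (~~ c)) r n w.

End FieldAlgebra.

(** * The axioms for a family of local fields closed under products *)

Section FieldVsa.
Variables (K : numFieldType) (M : lmodType K) (D : M -> M) (vac : M) (A : lmodType K).
Variables (fld : A -> sfield M) (aprod : int -> A -> A -> A) (avac : A).
Implicit Types x y z : A.
Hypothesis DL : is_linear D.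
Hypothesis Dvac : D vac = 0.
Hypothesis fldL : forall c n w, is_linear (fun x => fld x c n w).
Hypothesis fld_field : forall x c, is_field (fld x c).
Hypothesis fld_cov : forall x c, cov D (fld x c).
Hypothesis fld_creates : forall x c, creates vac (fld x c).
Hypothesis fld_local : forall x y a b, local (eps a b) (fld x a) (fld y b).
Hypothesis fld_inj0 : forall x, (forall c, fld x c (-1) vac = 0) -> x = 0.
Hypothesis fld_prod : forall r x y, fld (aprod r x y) = sprod r (fld x) (fld y).
Hypothesis fld_vac : forall c, fld avac c = if c then fun _ _ => 0 else @id_field _ M.
Hypothesis fld_part : forall x b, exists y, forall c,
  fld y c = if c == b then fld x b else fun _ _ => 0.

Definition state x c : M := fld x c (-1) vac.

Lemma state_linear c : is_linear (fun x => state x c).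
Proof. exact: fldL. Qed.

(** Most axioms below reduce through this to identities between vectors of [M], where a product
    becomes the action of a mode on a state ([state_prod]). *)
Lemma state_inj x y : (forall c, state x c = state y c) -> x = y.
Proof.
move=> h; apply/eqP; rewrite -subr_eq0; apply/eqP; apply: fld_inj0 => c.
by rewrite -/(state (x - y) c) (linB (state_linear c)) h subrr.
Qed.

(** In any vertex superalgebra D u = u_(-2) 1. Taken as a definition, it keeps derivatives inside
    the family, which is closed under products. *)
Definition aD x := aprod (-2) x avac.
Definition aeven x := fld x true = fun _ _ => 0.
Definition aodd x := fld x false = fun _ _ => 0.

Lemma ahomogE b x : homog aeven aodd b x <-> fld x (~~ b) = fun _ _ => 0.
Proof. by case: b. Qed.

Lemma state_prod r x y c :
  state (aprod r x y) c = fld x false r (state y c) + fld x true r (state y (~~ c)).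
Proof.
by rewrite /state fld_prod /sprod !nprod_vacN1 //.
Qed.

Lemma state_vac c : state avac c = if c then 0 else vac.
Proof. by rewrite /state fld_vac; case: c => //; rewrite /id_field eqxx. Qed.

Lemma fld_lin0 x c n : fld x c n 0 = 0.
Proof. exact: (lin0 ((fld_field x c).1 n)). Qed.

Lemma aprod_linl r y : is_linear (fun x => aprod r x y).
Proof.
move=> s x x'; apply: state_inj => c.
by rewrite (state_linear c) !state_prod !(fldL _ _ _ s x x'); lmod K.
Qed.

Lemma aprod_linr r x : is_linear (fun y => aprod r x y).
Proof.
move=> s y y'; apply: state_inj => c.
rewrite (state_linear c) !state_prod !(state_linear _ s).
by rewrite !((fld_field x _).1 r); lmod K.
Qed.

Lemma aprod_trunc x y : exists N : int, forall r, N <= r -> aprod r x y = 0.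
Proof.
have [N0 h0] := fld_local x y false false; have [N1 h1] := fld_local x y false true.
have [N2 h2] := fld_local x y true false; have [N3 h3] := fld_local x y true true.
exists (Num.max (Num.max N0 N1) (Num.max N2 N3)) => r.
rewrite !ge_max => /andP[/andP[l0 l1] /andP[l2 l3]].
apply: fld_inj0 => c; rewrite fld_prod /sprod /nprod; case: c => /=.
  by rewrite h1 // h2 // addr0.
by rewrite h0 // h3 // addr0.
Qed.

Lemma ahomog_prod a b x y r :
  homog aeven aodd a x -> homog aeven aodd b y -> homog aeven aodd (a (+) b) (aprod r x y).
Proof.
rewrite !ahomogE => hx hy; apply: funext => n; apply: funext => w.
rewrite fld_prod /sprod /nprod.
have z e u p q v (fu : is_field u) := ocomm_0l e r p q v fu.
have z' e u p q v (fu : is_field u) := ocomm_0r e r p q v fu.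
have f0 := field0 M.
by case: a b hx hy => [] [] /= -> ->; rewrite (z, z') // (z, z') // addr0.
Qed.

Lemma fld_D x c n w : fld (aD x) c n w = - n%:~R *: fld x c (n - 1) w.
Proof.
rewrite /aD fld_prod /sprod !fld_vac; case: c => /=.
  by rewrite {1}/nprod ocomm_0r // add0r; apply: nprod_id.
by rewrite [X in _ + X]/nprod ocomm_0r // addr0; apply: nprod_id.
Qed.

Lemma state_D x c : state (aD x) c = D (state x c).
Proof.
rewrite /state fld_D; have := fld_cov x c (-1) vac.
by rewrite Dvac fld_lin0 subr0 opprK scale1r.
Qed.

Lemma aD_prod x y r : aD (aprod r x y) - aprod r x (aD y) = aprod r (aD x) y.
Proof.
apply: state_inj => c; rewrite (linB (state_linear c)) state_D.
rewrite (state_prod r (aD x)) (state_prod r x (aD y)) (state_prod r x y) !state_D.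
rewrite (linD DL) !fld_D -!(fld_cov x _ r).
by lmod K.
Qed.

Lemma aprod_D x y r : aprod r (aD x) y = - r%:~R *: aprod (r - 1) x y.
Proof.
apply: state_inj => c; rewrite (linZ (state_linear c)) !state_prod !fld_D.
by lmod K.
Qed.

Lemma avac_prod r y : aprod r avac y = if r == -1 then y else 0.
Proof.
apply: state_inj => c; rewrite state_prod !fld_vac /id_field addr0.
by case: eqP => // _; rewrite (lin0 (state_linear c)).
Qed.

Lemma aprod_vac x r : 0 <= r -> aprod r x avac = 0.
Proof.
move=> r0; apply: state_inj => c; rewrite state_prod !state_vac.
rewrite (lin0 (state_linear c)).
by case: c => /=; rewrite fld_lin0 fld_creates // addr0.
Qed.

Lemma aprod_vacN1 x : aprod (-1) x avac = x.
Proof.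
apply: state_inj => c; rewrite state_prod !state_vac /state.
by case: c => /=; rewrite fld_lin0 ?addr0 ?add0r.
Qed.

Lemma alg_parts x : exists x0 x1, [/\ aeven x0, aodd x1 & x = x0 + x1].
Proof.
have [x0 h0] := fld_part x false; have [x1 h1] := fld_part x true.
exists x0, x1; split; [exact: (h0 true)|exact: (h1 false)|apply: state_inj => c].
by rewrite (linD (state_linear c)) /state h0 h1; case: c; rewrite ?addr0 ?add0r.
Qed.

Lemma fld_prod_homog a b x y r n w : homog aeven aodd a x -> homog aeven aodd b y ->
  fld (aprod r x y) (a (+) b) n w = nprod (eps a b) (fld x a) (fld y b) r n w.
Proof.
rewrite !ahomogE => hx hy; rewrite fld_prod /sprod /nprod.
have z e p q v := ocomm_0l e r p q v (field0 M).
by case: a b hx hy => [] [] /= hx hy; rewrite hx hy z ?addr0 ?add0r.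
Qed.

Lemma state_prod_homog a x y r c : homog aeven aodd a x ->
  state (aprod r x y) c = fld x a r (state y (a (+) c)).
Proof.
by rewrite ahomogE state_prod; case: a => /= ->; rewrite ?addr0 ?add0r.
Qed.

(** On states, the left side is the expansion of [ocomm] given by [ocomm_expand] and the right side
    is its definition, both applied to the state of [z]. The bound [N] truncates all three sums. *)
Lemma alg_jacobi a b x y z (p q r : int) (N : nat) :
  homog aeven aodd a x -> homog aeven aodd b y ->
  (forall i : nat, (N <= i)%N ->
     [/\ aprod (r + i%:Z) x y = 0, aprod (q + i%:Z) y z = 0 & aprod (p + i%:Z) x z = 0]) ->
  \sum_(i < N) ((binz p i)%:~R : K) *: aprod (p + q - i%:Z) (aprod (r + i%:Z) x y) z
  = \sum_(i < N) (((-1) ^+ i * binz r i)%:~R : K) *: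
       (aprod (p + r - i%:Z) x (aprod (q + i%:Z) y z)
        - (eps a b * (-1) ^ r) *: aprod (q + r - i%:Z) y (aprod (p + i%:Z) x z)).
Proof.
move=> hx hy hN; apply: state_inj => c.
rewrite !(lin_sum (state_linear c)).
set m := state z (a (+) b (+) c).
have fx := fld_field x a; have fy := fld_field y b.
rewrite (eq_bigr (fun i : 'I_N => bz K p i *:
    nprod (eps a b) (fld x a) (fld y b) (r + i%:Z) (p + q - i%:Z) m)); last first.
  move=> i _; rewrite (linZ (state_linear c)); congr (_ *: _).
  by rewrite (state_prod_homog _ _ _ (ahomog_prod _ hx hy)) fld_prod_homog.
rewrite -(tsumE (f := fun i => bz K p i *:
    nprod (eps a b) (fld x a) (fld y b) (r + i%:Z) (p + q - i%:Z) m)); last first.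
  move=> i /hN[e _ _]; rewrite -fld_prod_homog // e.
  by rewrite (lin0 (fldL _ _ _)) scaler0.
rewrite -ocomm_expand //.
rewrite /ocomm /zpow (@tsumE _ _ N) => [|i /hN[_ e _]]; last first.
  have := congr1 (fun u => state u (a (+) c)) e.
  rewrite (state_prod_homog _ _ _ hy) addbA (addbC b a) -/m => ->.
  by rewrite (lin0 (state_linear _)) fld_lin0 scaler0.
rewrite (@tsumE _ _ N) => [|i /hN[_ _ e]]; last first.
  have := congr1 (fun u => state u (b (+) c)) e.
  rewrite (state_prod_homog _ _ _ hx) addbA -/m => ->.
  by rewrite (lin0 (state_linear _)) fld_lin0 scaler0.
rewrite scaler_sumr -sumrB; apply: eq_bigr => i _.
rewrite (linZ (state_linear c)) (linB (state_linear c)) (linZ (state_linear c)).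
rewrite !(state_prod_homog _ _ _ hx) !(state_prod_homog _ _ _ hy) !(state_prod_homog _ _ _ hx).
rewrite !addbA (addbC b a) -/m rmorphM /= rmorphXn /= rmorphN1 -/(bz K r i).
by lmod K.
Qed.

Lemma field_vsa : is_vsa aeven aodd avac aD aprod.
Proof.
have sub b : is_subspace (fun x => fld x b = fun _ _ => 0).
  split=> [|x y ex ey|c x ex]; apply: funext => n; apply: funext => w.
  - exact: (lin0 (fldL b n w)).
  - by rewrite (linD (fldL b n w)) ex ey addr0.
  - by rewrite (linZ (fldL b n w)) ex scaler0.
split.
- split; last by split=> n x; [exact: aprod_linl|exact: aprod_linr].
  split; [exact: (sub true)|exact: (sub false)|exact: alg_parts|].
  by move=> x h0 h1; apply: fld_inj0 => -[]; rewrite ?h0 ?h1.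
- split; first exact: aprod_trunc.
  split; first by move=> *; apply: ahomog_prod.
  + exact: (fld_vac true).
  + exact: aprod_linl.
  + by move=> b x; rewrite !ahomogE => h; apply: funext => n; apply: funext => w;
      rewrite fld_D h scaler0.
- by split=> x y r; [exact: aD_prod|exact: aprod_D].
- by split; [exact: avac_prod|exact: aprod_vac|exact: aprod_vacN1].
- exact: alg_jacobi.
Qed.

End FieldVsa.

(** * Closing the generating fields under products *)

Section VertexAlgebra.
Variables (K : numFieldType) (S : lmodType K) (pr : bool -> S -> S).
Variable F : nat -> nat -> S -> S -> S.
Hypothesis Ftrunc : forall u v, exists N, forall n k, (N <= n)%N \/ (N <= k)%N -> F n k u v = 0.
Hypothesis prL : forall b, is_linear (pr b).
Hypothesis pr_pr : forall a b u, pr a (pr b u) = if a == b then pr b u else 0.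

Local Notation M := (vmod pr F).
Local Notation vac := (vac pr F).
Local Notation opr := (@opr K S pr F).
Local Notation D := (@vD K S pr F).

(** Formal expressions for the fields obtained from the generators. The algebra is the range of
    [ev], and properties of its members are proved by induction on an expression. *)
Inductive vterm :=
  VVac | VGen of S | VProd of int & vterm & vterm | VZero | VAdd of vterm & vterm
| VScale of K & vterm.

Fixpoint ev (t : vterm) : sfield M :=
  match t with
  | VVac => fun c => if c then fun _ _ => 0 else @id_field _ M
  | VGen s => fun c => opr c s
  | VProd r t t' => sprod r (ev t) (ev t')
  | VZero => 0
  | VAdd t t' => ev t + ev t'
  | VScale c t => c *: ev t
  end.

Lemma ev_addE t t' c : ev (VAdd t t') c = fun n w => 1 *: ev t c n w + 1 *: ev t' c n w.
Proof. by apply: funext => n; apply: funext => w; rewrite /= !scale1r. Qed.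

Lemma ev_scaleE k t c : ev (VScale k t) c = fun n w => k *: ev t c n w + 0 *: (fun _ _ => 0) n w.
Proof. by apply: funext => n; apply: funext => w; rewrite /= scaler0 addr0. Qed.

Lemma ev_prodE r t t' c : ev (VProd r t t') c = fun n w =>
  1 *: nprod (eps false c) (ev t false) (ev t' c) r n w +
  1 *: nprod (eps true (~~ c)) (ev t true) (ev t' (~~ c)) r n w.
Proof. by apply: funext => n; apply: funext => w; rewrite /= /sprod !scale1r. Qed.

Lemma ev_field t c : is_field (ev t c).
Proof.
elim: t c => [|s|r t IH t' IH'||t IH t' IH'|k t IH] c.
- by case: c; [exact: field0|exact: id_is_field].
- exact: (opr_field pr Ftrunc).
- by rewrite ev_prodE; apply: field_lin; apply: field_nprod.
- exact: field0.
- by rewrite ev_addE; apply: field_lin.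
- by rewrite ev_scaleE; apply: field_lin => //; apply: field0.
Qed.

Lemma cov0 : cov D (fun _ _ => 0).
Proof. by move=> n w; rewrite (lin0 (@vD_linear K S pr F)) subrr scaler0. Qed.

Lemma ev_cov t c : cov D (ev t c).
Proof.
have DL := @vD_linear K S pr F.
elim: t c => [|s|r t IH t' IH'||t IH t' IH'|k t IH] c.
- case: c; first exact: cov0.
  move=> n w; rewrite /= /id_field; have [->|nz] := eqVneq n (-1).
    by rewrite subrr scaler0.
  rewrite (lin0 DL) subrr; case: eqP => [e|]; last by rewrite scaler0.
  by rewrite (_ : n = 0) ?oppr0 ?scale0r //; lia.
- exact: vD_opr.
- by rewrite ev_prodE; apply: cov_lin => //; apply: cov_nprod => //; apply: ev_field.
- exact: cov0.
- by rewrite ev_addE; apply: cov_lin.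
- by rewrite ev_scaleE; apply: cov_lin => //; apply: cov0.
Qed.

Lemma ev_creates t c : creates vac (ev t c).
Proof.
elim: t c => [|s|r t IH t' IH'||t IH t' IH'|k t IH] c.
- case: c => // n n0; rewrite /= /id_field; case: eqP => // e; move: n0; by rewrite e.
- by move=> n n0; apply: opr_vac.
- rewrite ev_prodE; apply: creates_lin => n n0; apply: nprod_vac => //; exact: ev_field.
- by [].
- by rewrite ev_addE; apply: creates_lin.
- by rewrite ev_scaleE; apply: creates_lin.
Qed.

Fixpoint vsize t :=
  match t with
  | VProd _ t t' | VAdd t t' => (vsize t + vsize t').+1
  | VScale _ t => (vsize t).+1
  | _ => 1%N
  end.

Lemma epsC a b : eps a b = eps b a :> K. Proof. by rewrite /eps andbC. Qed.
Lemma eps_addl a b c : eps (a (+) b) c = eps a c * eps b c :> K.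
Proof. by case: a b c => [] [] []; rewrite /eps /=; ring. Qed.

(** For a product of s1 and s2 against s, Dong's lemma also asks that s1 and s2 be local to each
    other, a pair lying on one side. The induction is therefore on the total size of the pair. *)
Lemma ev_local t t' a b : local (eps a b) (ev t a) (ev t' b).
Proof.
move: {2}(vsize t + vsize t')%N (leqnn (vsize t + vsize t')) => n.
elim: n t t' a b => [|n IH] t t' a b.
  by rewrite leqn0 addn_eq0; case: t => //.
have sym s s' c d : local (eps d c) (ev s' d) (ev s c) -> local (eps c d) (ev s c) (ev s' d).
  by rewrite epsC => h; apply: local_sym => //; apply: eps_sq.
have sz s : (0 < vsize s)%N by case: s.
have vcase s c d : local (eps c d) (ev VVac c) (ev s d).
  case: c => /=; first by apply: local0l; apply: ev_field.
  by apply: id_local; apply: ev_field.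
have zcase s c d : local (eps c d) (ev VZero c) (ev s d).
  by apply: local0l; apply: ev_field.
have acase s1 s2 s c d : local (eps c d) (ev s c) (ev s1 d) -> local (eps c d) (ev s c) (ev s2 d) ->
    local (eps c d) (ev s c) (ev (VAdd s1 s2) d).
  by move=> h1 h2; rewrite ev_addE; apply: local_lin => //; apply: ev_field.
have ccase s1 k s c d : local (eps c d) (ev s c) (ev s1 d) ->
    local (eps c d) (ev s c) (ev (VScale k s1) d).
  move=> h1; rewrite ev_scaleE; apply: local_lin => //; try exact: ev_field.
    exact: field0.
  by apply: local0r; apply: ev_field.
have pcase r s1 s2 s c d :
    (forall c d, local (eps c d) (ev s1 c) (ev s2 d)) ->
    (forall c d, local (eps c d) (ev s1 c) (ev s d)) ->
    (forall c d, local (eps c d) (ev s2 c) (ev s d)) ->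
    local (eps c d) (ev s c) (ev (VProd r s1 s2) d).
  move=> h12 h1 h2; rewrite ev_prodE; apply: local_lin; try exact: ev_field;
    try by apply: field_nprod; apply: ev_field.
    apply: local_sym; first exact: eps_sq.
    have -> : eps c d = eps false c * eps d c :> K by rewrite -eps_addl epsC.
    by apply: dong; try exact: ev_field.
  apply: local_sym; first exact: eps_sq.
  have -> : eps c d = eps true c * eps (~~ d) c :> K.
    by rewrite -eps_addl epsC; case: (d).
  by apply: dong; try exact: ev_field.
case: t' => [|s'|r t1 t2||t1 t2|k t1] le; try by apply: sym.
- case: t le => [|s|r t1 t2||t1 t2|k t1] le; try by [apply: vcase|apply: zcase].
  + exact: (opr_local pr Ftrunc).
  + by apply: (sym (VProd r t1 t2) (VGen s')); apply: pcase => c d;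
      [apply: IH|apply: IH|apply: IH]; move: le (sz t1) (sz t2) => /=; lia.
  + by apply: (sym (VAdd t1 t2) (VGen s')); apply: acase; apply: IH; move: le (sz t1) (sz t2) => /=; lia.
  + by apply: (sym (VScale k t1) (VGen s')); apply: ccase; apply: IH; move: le => /=; lia.
- apply: pcase => c d; [|apply: sym|apply: sym]; apply: IH; move: le (sz t1) (sz t2) (sz t) => /=; lia.
- apply: acase; apply: IH; move: le (sz t1) (sz t2) (sz t) => /=; lia.
- apply: ccase; apply: IH; move: le (sz t) => /=; lia.
Qed.

Lemma ev_inj0 t : (forall c, ev t c (-1) vac = 0) -> ev t = 0.
Proof.
move=> h; apply: funext => c; apply: funext => n; apply: funext => w.
apply: (@field_uniqueness K M D vac (@vD_linear K S pr F) (vD_vac _ _) (bool * S)%type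
  (fun i => opr i.1 i.2) (fun i => eps c i.1)) => //.
- by move=> i; apply: (opr_field pr Ftrunc).
- move=> P P0 PD PS Pv Po; apply: vmod_ind => // b u m x Px; exact: (Po (b, u)).
- exact: ev_field.
- exact: ev_cov.
- exact: ev_creates.
by case=> b u /=; have := ev_local t (VGen u) c b.
Qed.

Definition in_alg (x : sfield M) := exists t, x = ev t.

Lemma in_alg_subspace : is_subspace in_alg.
Proof.
split; first by exists VZero.
- by move=> x y [t ->] [t' ->]; exists (VAdd t t').
- by move=> c x [t ->]; exists (VScale c t).
Qed.

Definition alg : lmodType K := subm in_alg_subspace.
Implicit Types x y : alg.

Lemma algP x : in_alg (val x). Proof. exact: submP. Qed.

Lemma alg_field x c : is_field (val x c).
Proof. by have [t ->] := algP x; apply: ev_field. Qed.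
Lemma alg_cov x c : cov D (val x c).
Proof. by have [t ->] := algP x; apply: ev_cov. Qed.
Lemma alg_creates x c : creates vac (val x c).
Proof. by have [t ->] := algP x; apply: ev_creates. Qed.
Lemma alg_local x y a b : local (eps a b) (val x a) (val y b).
Proof. by have [t ->] := algP x; have [t' ->] := algP y; apply: ev_local. Qed.

Fact aprod_in r x y : in_alg (sprod r (val x) (val y)).
Proof. by have [t ->] := algP x; have [t' ->] := algP y; exists (VProd r t t'). Qed.
Definition aprod r x y : alg := mksub _ (aprod_in r x y).

Fact avac_in : in_alg (ev VVac). Proof. by exists VVac. Qed.
Definition avac : alg := mksub _ avac_in.

Fact agen_in s : in_alg (ev (VGen s)). Proof. by exists (VGen s). Qed.
Definition agen s : alg := mksub _ (agen_in s).

(** This gives the parity decomposition of the algebra. The component [b] of a product is the even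
    part of the first factor times the component [b] of the second, plus its odd part times the
    opposite component. *)
Lemma ev_part t b : in_alg (fun c => if c == b then ev t b else 0).
Proof.
elim: t b => [|s|r t IH t' IH'||t IH t' IH'|k t IH] b.
- case: b; last by exists VVac; apply: funext => -[].
  by exists VZero; apply: funext => -[].
- exists (VGen (pr b s)); apply: funext => c /=; apply: funext => n; apply: funext => w.
  rewrite -(opr_pr (F := F) c (pr b s)) pr_pr; case: eqP => [->|_].
    by rewrite opr_pr.
  by rewrite (lin0 (opr_lin _ _ _)).
- have [u0 e0] := IH false; have [u1 e1] := IH true.
  have [v0 f0] := IH' b; have [v1 f1] := IH' (~~ b).
  exists (VAdd (VProd r u0 v0) (VProd r u1 v1)); apply: funext => c.
  apply: funext => n; apply: funext => w; rewrite ev_addE !scale1r.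
  have fe := ev_field.
  have z e a p q v := @ocomm_0l K M e a r p q v; have z' e a p q v := @ocomm_0r K M e a r p q v.
  case: b c e0 e1 f0 f1 {IH IH'} => [] [] /= <- <- <- <-; rewrite /sprod /nprod /= ?fctE;
    rewrite !(z, z') //; try exact: field0; by rewrite ?addr0 ?add0r.
- by exists VZero; apply: funext => -[]; case: b.
- have [u e] := IH b; have [v f] := IH' b; exists (VAdd u v); rewrite /= -e -f.
  apply: funext => c; rewrite -[RHS]/((if c == b then _ else 0) + (if c == b then _ else 0)).
  by case: eqP => // _; rewrite addr0.
- have [u e] := IH b; exists (VScale k u); rewrite /= -e.
  apply: funext => c; rewrite -[RHS]/(k *: (if c == b then _ else 0)).
  by case: eqP => // _; rewrite scaler0.
Qed.

Definition fld x : sfield M := val x.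

Lemma fld_prod r x y : fld (aprod r x y) = sprod r (fld x) (fld y). Proof. by []. Qed.
Lemma fld_gen s : fld (agen s) = fun c => opr c s. Proof. by []. Qed.
Lemma fld_vac c : fld avac c = if c then fun _ _ => 0 else @id_field _ M. Proof. by []. Qed.
Lemma fld_linear c n w : is_linear (fun x => fld x c n w).
Proof. by move=> s x y; rewrite /fld (@val_linear _ _ _ _ s x y). Qed.
Lemma fld_inj0 x : (forall c, fld x c (-1) vac = 0) -> x = 0.
Proof.
rewrite /fld => h; apply: val_inj; have [t e] := algP x.
by rewrite [LHS]e ev_inj0 // => c; rewrite -e.
Qed.
Lemma fld_part x b : exists y, forall c, fld y c = if c == b then fld x b else fun _ _ => 0.
Proof.
have [t e] := algP x; exists (mksub in_alg_subspace (ev_part t b)) => c.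
by rewrite /fld /= e.
Qed.

Lemma alg_vsa : is_vsa (aeven fld) (aodd fld) avac (aD aprod avac) aprod.
Proof.
apply: (field_vsa (D := D) (vac := vac)).
- exact: vD_linear.
- exact: vD_vac.
- exact: fld_linear.
- exact: alg_field.
- exact: alg_cov.
- exact: alg_creates.
- exact: alg_local.
- exact: fld_inj0.
- exact: fld_prod.
- exact: fld_vac.
- exact: fld_part.
Qed.

Definition alg_as_vsa : vsa K := VSA alg_vsa.

Lemma alg_generated : vsa_generated_by (V := alg_as_vsa) (fun x => exists s, x = agen s).
Proof.
move=> W [W0 WD WS] Wv Wp Wg.
suff h t : forall Pt, W (mksub in_alg_subspace (x := ev t) Pt).
  by move=> x; have [t e] := algP x; have := h t (ex_intro _ t erefl);
    congr W; apply: val_inj; rewrite /= e.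
have eqW (x y : alg) : val x = val y -> W x -> W y by move=> /val_inj ->.
elim: t => [|s|r t IH t' IH'||t IH t' IH'|k t IH] Pt.
- exact: eqW Wv.
- by apply: eqW (Wg (agen s) _) => //; exists s.
- exact: eqW (Wp r _ _ (IH (ex_intro _ t erefl)) (IH' (ex_intro _ t' erefl))).
- exact: eqW W0.
- exact: eqW (WD _ _ (IH (ex_intro _ t erefl)) (IH' (ex_intro _ t' erefl))).
- exact: eqW (WS k _ (IH (ex_intro _ t erefl))).
Qed.

End VertexAlgebra.

Lemma grading_proj (K : fieldType) (U : lmodType K) (U0 U1 : U -> Prop) :
  is_Z2grading U0 U1 ->
  exists pr : bool -> U -> U,
    [/\ forall b, is_linear (pr b), forall u, u = pr false u + pr true u,
        forall b u, homog U0 U1 b (pr b u),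
        forall b u, homog U0 U1 b u -> pr b u = u &
        forall a b u, pr a (pr b u) = if a == b then pr b u else 0].
Proof.
case=> -[Z0 D0 S0'] [Z1 D1 S1'] dec disj.
have /choice [f hf] : forall x, exists y : U * U, [/\ U0 y.1, U1 y.2 & x = y.1 + y.2].
  by move=> x; have [x0 [x1 [h0 h1 e]]] := dec x; exists (x0, x1).
have uniq x0 x1 y0 y1 : U0 x0 -> U1 x1 -> U0 y0 -> U1 y1 -> x0 + x1 = y0 + y1 ->
    x0 = y0 /\ x1 = y1.
  move=> hx0 hx1 hy0 hy1 e.
  have e' : x0 - y0 = y1 - x1.
    by apply/eqP; rewrite subr_eq [X in _ == X]addrC addrA -e addrK.
  have : x0 - y0 = 0.
    apply: disj; first by apply: D0 => //; rewrite -scaleN1r; apply: S0'.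
    by rewrite e'; apply: D1 => //; rewrite -scaleN1r; apply: S1'.
  move=> z; split; first by apply/eqP; rewrite -subr_eq0 z.
  by apply/esym/eqP; rewrite -subr_eq0 -e' z.
pose pr (b : bool) u := if b then (f u).2 else (f u).1.
have prE b u : homog U0 U1 b u -> pr b u = u /\ pr (~~ b) u = 0.
  have [h0 h1 e] := hf u; case: b => hu.
    have [] := uniq 0 u (f u).1 (f u).2 Z0 hu h0 h1; first by rewrite add0r.
    by rewrite /pr /= => <- <-.
  have [] := uniq u 0 (f u).1 (f u).2 hu Z1 h0 h1; first by rewrite addr0.
  by rewrite /pr /= => <- <-.
have prh b u : homog U0 U1 b (pr b u) by have [] := hf u; case: b.
exists pr; split=> //.
- move=> b c x y.
  have [hx0 hx1 ex] := hf x; have [hy0 hy1 ey] := hf y; have [h0 h1 e] := hf (c *: x + y).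
  have [e0 e1] : (f (c *: x + y)).1 = c *: (f x).1 + (f y).1 /\
                 (f (c *: x + y)).2 = c *: (f x).2 + (f y).2.
    apply: uniq => //; [by apply: D0 => //; apply: S0'|by apply: D1 => //; apply: S1'|].
    by rewrite -e {1}ex {1}ey; lmod K.
  by case: b.
- by move=> u; have [] := hf u.
- by move=> b u /prE[].
- move=> a b u; have [e e'] := prE b _ (prh b u).
  by case: eqP => [->//|ne]; rewrite (_ : a = ~~ b) //; case: a b ne {e e'} => [] [].
Qed.

Lemma dcoef_rev (m : int) n : dcoef (n%:Z - m - 1) n = (-1) ^+ n * dcoef m n.
Proof.
rewrite /dcoef (reindex_inj rev_ord_inj) /=.
have -> : (-1) ^+ n = \prod_(i < n) (-1) :> int by rewrite prodr_const card_ord.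
rewrite -big_split; apply: eq_bigr => i _ /=.
by rewrite mulN1r; have := ltn_ord i; lia.
Qed.

Lemma dcoef_binz m n : dcoef m n = n`!%:Z * binz m n.
Proof.
elim: n => [|n IH]; first by rewrite /dcoef big_ord0 binz0.
rewrite dcoefS IH -mulrA -binz_mulS factS PoszM; ring.
Qed.

(** Reversing a falling factorial costs (-1)^n, which cancels the given sign, and division by n!
    turns it into the binomial coefficient of m over n. *)
Lemma mode_coefE (K : numFieldType) (m p : int) (n k : nat) :
  ((-1) ^+ n / (n`!)%:R) * (dcoef (n%:Z - m - 1) n)%:~R
           * (dcoef (- (m + p - n%:Z - k%:Z) - 1) k)%:~R = mode_coef K m p n k.
Proof.
rewrite dcoef_rev (_ : - (m + p - n%:Z - k%:Z) - 1 = k%:Z - (m + p - n%:Z) - 1); last by lia.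
rewrite dcoef_rev dcoef_binz /mode_coef /bz !intrM !rmorphXn /= !rmorphN1.
have nz : n`!%:R != 0 :> K by rewrite pnatr_eq0 -lt0n fact_gt0.
have sq : (-1) ^+ n * (-1) ^+ n = 1 :> K by rewrite -exprMn mulrNN mulr1 expr1n.
rewrite -[(Posz n`!)%:~R]/(n`!%:R).
set a := (-1) ^+ n; set f := n`!%:R; set x := (binz m n)%:~R; set y := (-1) ^+ k * _.
have -> : a / f * (a * (f * x)) * y = (a * a) * (f^-1 * f) * (x * y) by ring.
by rewrite sq mulVf // !mul1r.
Qed.

(** * Vertex superalgebras containing the formula, and the map onto them *)

Section VsaModes.
Variables (K : numFieldType) (V : vsa K).

Local Notation prodV := (vs_prod V).
Local Notation DV := (vs_D V).

Lemma vs_linl n v : is_linear (fun u => prodV n u v).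
Proof. by have [[_ [h _]]] := vs_ax V. Qed.
Lemma vs_linr n u : is_linear (prodV n u).
Proof. by have [[_ [_ h]]] := vs_ax V. Qed.
Lemma vs_trunc u v : exists N : int, forall n, N <= n -> prodV n u v = 0.
Proof. by have [_ [h _] _ _ _] := vs_ax V. Qed.
Lemma vs_modeD u v n : prodV n (DV u) v = - (n%:~R : K) *: prodV (n - 1) u v.
Proof. by have [_ _ [_ h] _ _] := vs_ax V. Qed.
Lemma vs_vac_ge0 u n : 0 <= n -> prodV n u (vs_vac V) = 0.
Proof. by have [_ _ _ [_ h _] _] := vs_ax V; apply: h. Qed.
Lemma vs_vacN1 u : prodV (-1) u (vs_vac V) = u.
Proof. by have [_ _ _ [_ _ h] _] := vs_ax V. Qed.

Lemma vs_mode_iterD k u v n :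
  prodV n (iter k DV u) v = ((-1) ^+ k * (dcoef n k)%:~R) *: prodV (n - k%:Z) u v.
Proof.
elim: k n => [|k IH] n.
  by rewrite /dcoef big_ord0 expr0 mulr1 scale1r subr0.
rewrite iterS vs_modeD IH dcoefSl exprS scalerA intrM.
rewrite (_ : n - 1 - k%:Z = n - k.+1%:Z); last by lia.
by congr (_ *: _); ring.
Qed.

Lemma vs_bound u v (r : int) : exists M : nat, forall i : nat, (M <= i)%N ->
  prodV (r + i%:Z) u v = 0.
Proof.
have [N h] := vs_trunc u v; exists `|N - r|%N => i le; apply: h; lia.
Qed.

Lemma vs_jacobi_bound a b u v w (p q r : int) : vhomog a u -> vhomog b v ->
  exists M0 : nat, forall M : nat, (M0 <= M)%N ->
  \sum_(i < M) ((binz p i)%:~R : K) *: prodV (p + q - i%:Z) (prodV (r + i%:Z) u v) w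
  = \sum_(i < M) (((-1) ^+ i * binz r i)%:~R : K) *:
       (prodV (p + r - i%:Z) u (prodV (q + i%:Z) v w)
        - (eps a b * (-1) ^ r) *: prodV (q + r - i%:Z) v (prodV (p + i%:Z) u w)).
Proof.
move=> hu hv; have [_ _ _ _ J] := vs_ax V.
have [M1 h1] := vs_bound u v r; have [M2 h2] := vs_bound v w q; have [M3 h3] := vs_bound u w p.
exists (maxn M1 (maxn M2 M3)) => M; rewrite !geq_max => /and3P[l1 l2 l3].
apply: J => // i le; split; [apply: h1|apply: h2|apply: h3]; exact: leq_trans le.
Qed.

Section Hom.
Variables (S : lmodType K) (S0 S1 : S -> Prop) (F : nat -> nat -> S -> S -> S) (phi : S -> vs_car V).
Hypothesis hphi : formula_hom S0 S1 F phi.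

(** At r = 0 the right side of the Jacobi identity is left with i = 0, the commutator. The products
    on the left are expanded by the homomorphism property, and the modes of the derivatives by
    [vs_mode_iterD]. *)
Lemma formula_hom_commutator : commutator_formula S0 S1 F phi.
Proof.
case: hphi => phiL phiP phiF a b u v m p N hu hv hN w.
have [M0 J] := vs_jacobi_bound w m p 0 (phiP _ _ hu) (phiP _ _ hv).
have {J} := J (maxn M0 N).+1 (leqW (leq_maxl _ _)).
rewrite [RHS]big_ord_recl [X in _ = _ + X]big1 => [|i _]; last first.
  by rewrite (_ : binz 0 _ = 0) // mulr0 scale0r.
rewrite /= expr0 mul1r scale1r !addr0 ?subr0 expr0z mulr1 => <-.
rewrite (@sum_trunc K _ (fun i => (binz m i)%:~R *:
  prodV (m + p - i%:Z) (prodV (0 + i%:Z) (phi u) (phi v)) w) N); last first.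
- by rewrite leqW // leq_maxr.
- move=> i le; rewrite add0r (phiF _ _ _ 0%N) => [|k _]; last by apply: hN; left.
  by rewrite big_ord0 (lin0 (vs_linl _ _)) scaler0.
apply: eq_bigr => i _; rewrite add0r (phiF _ _ _ N) => [|k le]; last by apply: hN; right.
rewrite (lin_sum (vs_linl _ _)) scaler_sumr; apply: eq_bigr => k _.
by rewrite vs_mode_iterD scalerA mode_coefE.
Qed.

End Hom.
End VsaModes.

Section Universal.
Variables (K : numFieldType) (S : lmodType K) (S0 S1 : S -> Prop) (pr : bool -> S -> S).
Variable F : nat -> nat -> S -> S -> S.
Hypothesis Ftrunc : forall u v, exists N, forall n k, (N <= n)%N \/ (N <= k)%N -> F n k u v = 0.
Hypothesis Fl : forall n k v, is_linear (fun u => F n k u v).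
Hypothesis Fr : forall n k u, is_linear (fun v => F n k u v).
Hypothesis prL : forall b, is_linear (pr b).
Hypothesis prD : forall u, u = pr false u + pr true u.
Hypothesis prH : forall b u, homog S0 S1 b (pr b u).
Hypothesis pr_id : forall b u, homog S0 S1 b u -> pr b u = u.
Hypothesis pr_pr : forall a b u, pr a (pr b u) = if a == b then pr b u else 0.
Hypothesis Fpar : forall n k a b u v, homog S0 S1 a u -> homog S0 S1 b v ->
  homog S0 S1 (a (+) b) (F n k u v).

Local Notation M := (vmod pr F).
Local Notation vac := (vac pr F).
Local Notation opr := (@opr K S pr F).
Local Notation D := (@vD K S pr F).
Local Notation A := (alg_as_vsa Ftrunc pr_pr).
Local Notation ast := (state vac (@fld K S pr F)).

Lemma pr_F a b n k u v : pr (a (+) b) (F n k (pr a u) (pr b v)) = F n k (pr a u) (pr b v).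
Proof. by apply: pr_id; apply: Fpar. Qed.

Lemma ast_linear c : is_linear (fun x => ast x c).
Proof. exact: state_linear (@fld_linear K S pr F) c. Qed.

Lemma ast_inj (x y : alg pr F) : (forall c, ast x c = ast y c) -> x = y.
Proof. exact: (state_inj (@fld_linear K S pr F) (fld_inj0 Ftrunc)). Qed.

Lemma ast_prod r (x y : alg pr F) c :
  ast (aprod r x y) c = fld x false r (ast y c) + fld x true r (ast y (~~ c)).
Proof.
exact: (state_prod (@alg_field K S pr F Ftrunc) (@alg_creates K S pr F Ftrunc) (@fld_prod K S pr F)).
Qed.

Lemma ast_D (x : alg pr F) c : ast (vs_D A x) c = D (ast x c).
Proof.
exact: (state_D (@vD_vac K S pr F) (@alg_field K S pr F Ftrunc) (@alg_cov K S pr F Ftrunc)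
  (@fld_prod K S pr F) (@fld_vac K S pr F)).
Qed.

Lemma ast_gen s c : ast (agen pr F s) c = opr c s (-1) vac.
Proof. by rewrite /state fld_gen. Qed.

Lemma vD_iter k c s : iter k D (opr c s (-1) vac) = (k`!)%:R *: opr c s (- k.+1%:Z) vac.
Proof.
elim: k => [|k IH]; first by rewrite scale1r.
rewrite iterS IH (linZ (@vD_linear K S pr F)).
have := vD_opr (pr := pr) (F := F) c s (- k.+1%:Z) vac.
rewrite vD_vac (lin0 (opr_linear _ _ _)) subr0 => ->.
rewrite (_ : - k.+1%:Z - 1 = - k.+2%:Z); last by lia.
rewrite scalerA factS mulnC natrM rmorphN opprK; congr (_ *: _).
Qed.

Lemma dcoefN1 k : (-1) ^+ k * dcoef (-1) k = k`!%:Z.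
Proof.
elim: k => [|k IH]; first by rewrite /dcoef big_ord0.
rewrite dcoefS exprS factS PoszM -IH.
by rewrite (_ : -1 - k%:Z = - k.+1%:Z); [ring|lia].
Qed.

(** Only i = n survives. For i > n the binomial is zero; for i < n either the mode n - 1 - i - k is
    nonnegative and kills the vacuum, or k exceeds n - 1 - i and the falling factorial is zero. At i
    = n the coefficient is k!, as in [vD_iter], so the sum is that of the D^k F_n^k. *)
Lemma opr_opr_vac a b u v n N :
  (forall n k, (N <= n)%N \/ (N <= k)%N -> F n k (pr a u) (pr b v) = 0) ->
  opr a u n%:Z (opr b v (-1) vac) =
  \sum_(k < N) (k`!)%:R *: opr (a (+) b) (F n k (pr a u) (pr b v)) (- k.+1%:Z) vac.
Proof.
move=> hN; rewrite (opr_comm n%:Z (-1) vac hN) opr_vac // (lin0 (opr_linear _ _ _)).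
rewrite scaler0 add0r.
have [le|lt] := leqP N n.
  rewrite [RHS]big1 => [|k _]; last first.
    by rewrite hN ?(lin0 (opr_lin _ _ _)) ?scaler0 //; left.
  apply: big1 => i _; apply: big1 => k _; have := ltn_ord i => li.
  have [lk|lk] := leqP k (n - 1 - i).
    rewrite opr_vac ?scaler0 //; have := leq_trans li le; lia.
  rewrite /mode_coef (_ : dcoef _ k = 0) ?mulr0 ?scale0r //.
  have -> : n%:Z + -1 - i%:Z = (n - 1 - i)%N%:Z by have := leq_trans li le; lia.
  by rewrite dcoef_binz binz_nat_eq0 // mulr0.
rewrite (bigD1 (Ordinal lt)) //= [X in _ + X]big1 ?addr0 => [|i ne].
  apply: eq_bigr => k _; rewrite /mode_coef.
  rewrite (_ : n%:Z + -1 - n%:Z = -1); last by lia.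
  rewrite (_ : -1 - k%:Z = - k.+1%:Z); last by lia.
  rewrite (_ : (-1) ^+ k = ((-1) ^+ k : int)%:~R); last by rewrite rmorphXn /= rmorphN1.
  by rewrite -intrM dcoefN1 /bz /= binn mul1r.
apply: big1 => k _.
have [li|li|e] := ltngtP i n; last by case/eqP: ne; apply: val_inj.
  have [lk|lk] := leqP k (n - 1 - i).
    rewrite opr_vac ?scaler0 //; lia.
  rewrite /mode_coef (_ : dcoef _ k = 0) ?mulr0 ?scale0r //.
  have -> : n%:Z + -1 - i%:Z = (n - 1 - i)%N%:Z by lia.
  by rewrite dcoef_binz binz_nat_eq0 // mulr0.
by rewrite /mode_coef /bz binz_nat_eq0 // mul0r scale0r.
Qed.

Lemma pr_F_split c n k u v : pr c (F n k u v) =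
  F n k (pr false u) (pr c v) + F n k (pr true u) (pr (~~ c) v).
Proof.
have e a b u' v' : pr c (F n k (pr a u') (pr b v')) =
    if c == a (+) b then F n k (pr a u') (pr b v') else 0.
  by rewrite -pr_F pr_pr; case: eqP => // _.
rewrite {1}(prD u) {1}(prD v) (linD (Fl _ _ _)) !(linD (Fr _ _ _)) !(linD (prL _)) !e.
by case: c {e} => /=; rewrite !addr0 ?add0r.
Qed.

Lemma agen_formula_hom : formula_hom S0 S1 F (V := A) (agen pr F).
Proof.
split.
- move=> c u v; apply: ast_inj => d; rewrite (ast_linear d) !ast_gen.
  exact: opr_lin.
- move=> b u /pr_id hu; apply/(ahomogE (@fld K S pr F)).
  apply: funext => n; apply: funext => w; rewrite fld_gen -opr_pr -hu pr_pr.
  by case: b {hu}; rewrite (lin0 (opr_lin _ _ _)).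
move=> u v n N hN; apply: ast_inj => c.
have [N1 h1] := Ftrunc (pr false u) (pr c v).
have [N2 h2] := Ftrunc (pr true u) (pr (~~ c) v).
pose N' := maxn N (maxn N1 N2).
have [l0 [l1 l2]] : (N <= N')%N /\ (N1 <= N')%N /\ (N2 <= N')%N.
  by rewrite /N' !leq_max !leqnn !orbT.
rewrite -[RHS](congr1 (fun x => ast x c) (@sum_trunc K (alg pr F) (fun k =>
   iter k (vs_D A) (agen pr F (F n k u v))) N N' _ l0)); last first.
  move=> i le; rewrite hN //; apply: ast_inj => d.
  have e0 : agen pr F 0 = 0.
    by apply: ast_inj => d'; rewrite ast_gen (lin0 (opr_lin _ _ _)) (lin0 (ast_linear _)).
  rewrite e0 (lin0 (ast_linear _)).
  elim: i {le} => [|i IH]; first exact: (lin0 (ast_linear _)).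
  by rewrite iterS ast_D IH (lin0 (@vD_linear K S pr F)).
rewrite (lin_sum (ast_linear c)) /= ast_prod !fld_gen !ast_gen.
rewrite (@opr_opr_vac _ _ _ _ _ N') => [|i k h]; last first.
  by apply: h1; case: h => h; [left|right]; apply: leq_trans h.
rewrite (@opr_opr_vac _ _ _ _ _ N') => [|i k h]; last first.
  by apply: h2; case: h => h; [left|right]; apply: leq_trans h.
rewrite -big_split; apply: eq_bigr => k _ /=.
have -> : ast (iter k (vs_D A) (agen pr F (F n k u v))) c = iter k D (opr c (F n k u v) (-1) vac).
  by elim: {1 3}(val k) => [|j IH]; rewrite ?ast_gen // !iterS ast_D IH.
rewrite vD_iter -(opr_pr c (F n k u v)) pr_F_split (linD (opr_lin _ _ _)) scalerDr.
by case: (c).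
Qed.

Section Target.
Variables (V : vsa K) (psi : S -> vs_car V).
Hypothesis hpsi : good_pair S0 S1 F psi.

Local Notation prodV := (vs_prod V).

Lemma psi_linear : is_linear psi. Proof. by case: hpsi => -[]. Qed.
Lemma psi_homog b u : homog S0 S1 b u -> vhomog b (psi u).
Proof. by case: hpsi => -[_ h _] _ _ _; apply: h. Qed.

Definition word_to (w : seq (bool * int * S)) : vs_car V :=
  foldr (fun l x => prodV l.1.2 (psi (pr l.1.1 l.2)) x) (vs_vac V) w.

Lemma word_to_kills : kills (vm_rel pr F) word_to.
Proof.
have psiL := psi_linear.
apply: vm_killsP => p; elim: p => [|[[b n] u] p IH] t bt; last first.
  have -> : ext (word_to \o cat ((b, n, u) :: p)) t =
     prodV n (psi (pr b u)) (ext (word_to \o cat p) t).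
    rewrite (ext_comp _ _ (vs_linr n (psi (pr b u)))); exact: eq_ext.
  by rewrite IH // (lin0 (vs_linr _ _)).
case: bt => [b n c u v r|a m u b q v r N hN|b n u r|b n u n0] /=.
- by rewrite prL psiL vs_linl scaleN1r subrr.
- have [_ _ _ hc] := hpsi.
  have := hc a b (pr a u) (pr b v) m q N (prH _ _) (prH _ _) hN (word_to r).
  move/eqP; rewrite subr_eq => /eqP ->.
  rewrite ext_sum [_ + eps a b *: _]addrC scaleN1r.
  apply/eqP; rewrite subr_eq0; apply/eqP; congr (_ + _).
  apply: eq_bigr => i _; rewrite ext_sum; apply: eq_bigr => k _ /=.
  by rewrite mode_coefE pr_F.
- by rewrite pr_pr eqxx scaleN1r subrr.
- exact: vs_vac_ge0.
Qed.

Definition to_V : M -> vs_car V := plift word_to.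

Lemma to_V_linear : is_linear to_V. Proof. exact: plift_linear word_to_kills. Qed.

Lemma to_V_vac : to_V vac = vs_vac V. Proof. by rewrite /to_V plift_gen //; exact: word_to_kills. Qed.

Lemma to_V_opr b u n x : to_V (opr b u n x) = prodV n (psi (pr b u)) (to_V x).
Proof.
move: x; apply: pres_linext => [||w].
- exact: (lin_comp (opr_linear _ _ _) to_V_linear).
- exact: (lin_comp to_V_linear (vs_linr _ _)).
rewrite -[pgen _ _]/(vgen pr F w) opr_gen /to_V !plift_gen //; exact: word_to_kills.
Qed.

(** The Jacobi identity of [V] at p = 0, whose left side is left with i = 0. *)
Lemma vs_nprod a b u v r n w : vhomog a u -> vhomog b v ->
  nprod (eps a b) (fun n => prodV n u) (fun n => prodV n v) r n w = prodV n (prodV r u v) w.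
Proof.
move=> hu hv.
have [M0 J] := vs_jacobi_bound w 0 n r hu hv.
have [M1 h1] := vs_bound v w n; have [M2 h2] := vs_bound u w 0.
pose N := (maxn M0 (maxn M1 M2)).+1.
have {J} := J N (leqW (leq_maxl _ _)).
rewrite [X in X = _]big_ord_recl [X in _ + X]big1 => [|i _]; last first.
  by rewrite (_ : binz 0 _ = 0) // scale0r.
rewrite binz0 scale1r !addr0 ?subr0 add0r => ->.
rewrite /nprod /ocomm /zpow.
have le1 i : (N <= i)%N -> (M1 <= i)%N.
  by move=> le; apply: leq_trans le; rewrite leqW // !leq_max leqnn orbT.
have le2 i : (N <= i)%N -> (M2 <= i)%N.
  by move=> le; apply: leq_trans le; rewrite leqW // !leq_max leqnn !orbT.
rewrite !(@tsumE _ _ N); last 2 first.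
- by move=> i /le2 le; rewrite h2 // (lin0 (vs_linr _ _)) scaler0.
- by move=> i /le1 le; rewrite h1 // (lin0 (vs_linr _ _)) scaler0.
rewrite scaler_sumr -sumrB; apply: eq_bigr => i _.
by rewrite rmorphM /= rmorphXn /= rmorphN1 -/(bz K r i); lmod K.
Qed.

Lemma vhomog_lin b c x y : vhomog (V := V) b x -> vhomog b y -> vhomog b (c *: x + y).
Proof.
have [[[[_ D0 Z0] [_ D1 Z1] _ _] _] _ _ _ _] := vs_ax V.
by case: b => hx hy; [apply: D1 => //; apply: Z1|apply: D0 => //; apply: Z0].
Qed.

Lemma vhomog0 b : vhomog (V := V) b 0.
Proof. by have [[[[h0 _ _] [h1 _ _] _ _] _] _ _ _ _] := vs_ax V; case: b. Qed.

Lemma vhomog_prod a b x y n : vhomog (V := V) a x -> vhomog b y -> vhomog (a (+) b) (prodV n x y).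
Proof. by have [_ [_ [h _ _ _]] _ _ _] := vs_ax V; apply: h. Qed.

Definition evst (t : vterm S) b : vs_car V := to_V (ev t b (-1) vac).

(** [to_V] intertwines each field of the algebra with the modes in [V] of the image of its state.
    The parity statement belongs to the same induction, because [vs_nprod] needs homogeneous
    vectors. *)
Lemma to_V_ev t b : vhomog b (evst t b) /\
  forall n m, to_V (ev t b n m) = prodV n (evst t b) (to_V m).
Proof.
have tL := to_V_linear.
elim: t b => [|s|r t IH t' IH'||t IH t' IH'|k t IH] b.
- case: b; rewrite /evst /=.
    by rewrite (lin0 tL); split=> [|n m]; [exact: (vhomog0 true)|rewrite (lin0 (vs_linl _ _))].
  rewrite /id_field eqxx to_V_vac; have [_ [_ [_ h _ _]] _ [hv _ _] _] := vs_ax V.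
  split=> // n m; rewrite hv; case: eqP => // _; exact: lin0.
- rewrite /evst /= to_V_opr to_V_vac vs_vacN1; split.
    by apply: psi_homog; apply: prH.
  by move=> n m; rewrite to_V_opr.
- have np a b' n m : to_V (nprod (eps a b') (ev t a) (ev t' b') r n m) =
      prodV n (prodV r (evst t a) (evst t' b')) (to_V m).
    have [ha ea] := IH a; have [hb eb] := IH' b'.
    rewrite -(vs_nprod r n (to_V m) ha hb) /nprod /ocomm (linB tL) (linZ tL).
    have fa := ev_field pr Ftrunc t a; have fb := ev_field pr Ftrunc t' b'.
    rewrite (lin_zpow _ _ _ tL (field_rtrunc m fa fb)) (lin_zpow _ _ _ tL (field_rtrunc m fb fa)).
    congr (_ - _ *: _); apply: eq_zpow => l q; first by rewrite ea eb.
    by rewrite eb ea.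
  have e : evst (VProd r t t') b =
      prodV r (evst t false) (evst t' b) + prodV r (evst t true) (evst t' (~~ b)).
    by rewrite /evst /= /sprod (linD tL) !np to_V_vac !vs_vacN1.
  rewrite e; split.
    rewrite -[X in X + _]scale1r; apply: vhomog_lin.
      exact: (vhomog_prod _ (IH false).1 (IH' b).1).
    by have := vhomog_prod r (IH true).1 (IH' (~~ b)).1; case: (b).
  by move=> n m; rewrite /= /sprod (linD tL) !np (linD (vs_linl _ _)).
- rewrite /evst /= (lin0 tL); split=> [|n m]; first exact: (vhomog0 b).
  by rewrite (lin0 (vs_linl _ _)).
- have [h1 e1] := IH b; have [h2 e2] := IH' b.
  have e : evst (VAdd t t') b = evst t b + evst t' b by rewrite /evst /= (linD tL).
  rewrite e; split; first by rewrite -[X in X + _]scale1r; apply: vhomog_lin.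
  by move=> n m; rewrite /= (linD tL) e1 e2 (linD (vs_linl _ _)).
- have [h1 e1] := IH b.
  have e : evst (VScale k t) b = k *: evst t b by rewrite /evst /= (linZ tL).
  rewrite e; split; first by rewrite -[X in vhomog b X]addr0; apply: vhomog_lin => //; apply: (vhomog0 b).
  by move=> n m; rewrite /= (linZ tL) e1 (linZ (vs_linl _ _)).
Qed.

Lemma to_V_fld (x : alg pr F) b : vhomog b (to_V (ast x b)) /\
  forall n m, to_V (fld x b n m) = prodV n (to_V (ast x b)) (to_V m).
Proof.
have [t e] := algP x; have := to_V_ev t b.
by rewrite /evst -e.
Qed.

Definition alg_map (x : alg pr F) : vs_car V := to_V (ast x false) + to_V (ast x true).

Lemma alg_map_gen s : alg_map (agen pr F s) = psi s.
Proof.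
rewrite /alg_map !ast_gen !to_V_opr to_V_vac !vs_vacN1 -(linD psi_linear).
by rewrite -prD.
Qed.

Lemma alg_map_linear : is_linear alg_map.
Proof.
apply: lin_add; [exact: (lin_comp (ast_linear false) to_V_linear)|
  exact: (lin_comp (ast_linear true) to_V_linear)].
Qed.

Lemma alg_map_prod n x y : alg_map (aprod n x y) = prodV n (alg_map x) (alg_map y).
Proof.
have e0 := (to_V_fld x false).2; have e1 := (to_V_fld x true).2.
have st c : to_V (ast (aprod n x y) c) =
    prodV n (to_V (ast x false)) (to_V (ast y c)) + prodV n (to_V (ast x true)) (to_V (ast y (~~ c))).
  by rewrite ast_prod (linD to_V_linear (fld x false n (ast y c)) (fld x true n (ast y (~~ c))))
    e0 e1.
rewrite /alg_map !st /=; move: (to_V _) (to_V _) (to_V _) (to_V _) => u v u' v'.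
rewrite (linD (vs_linl _ _)) !(linD (vs_linr _ _)).
by lmod K.
Qed.

Lemma alg_map_hom : vsa_hom (V := A) (W := V) alg_map.
Proof.
split; [exact: alg_map_linear| |exact: alg_map_prod].
move=> b x /(ahomogE (@fld K S pr F)) h.
have h0 : ast x (~~ b) = 0 by rewrite /state h.
have hb := (to_V_fld x b).1.
by rewrite /alg_map; case: b h h0 hb => /= _ -> hb;
  rewrite (lin0 to_V_linear) ?add0r ?addr0.
Qed.

Lemma alg_map_onto y : exists x, alg_map x = y.
Proof.
have [_ _ gen _] := hpsi; move: y; apply: gen.
- split.
  + by exists 0; rewrite (lin0 alg_map_linear).
  + by move=> x y [u <-] [v <-]; exists (u + v); rewrite (linD alg_map_linear).
  + by move=> c x [u <-]; exists (c *: u); rewrite (linZ alg_map_linear).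
- exists (avac pr F); rewrite /alg_map.
  rewrite !(state_vac vac (@fld_vac K S pr F)) to_V_vac (lin0 to_V_linear) addr0 //.
- by move=> n x y [u <-] [v <-]; exists (aprod n u v); rewrite alg_map_prod.
- by move=> _ [s ->]; exists (agen pr F s); rewrite alg_map_gen.
Qed.

End Target.
End Universal.

(** * The Lie superalgebra of modes *)

Section FiniteFamilies.
Variables (K : numFieldType) (S : lmodType K) (F : nat -> nat -> S -> S -> S).
Implicit Types A B : nat -> S.
Hypothesis Ftrunc : forall u v, exists N, forall n k, (N <= n)%N \/ (N <= k)%N -> F n k u v = 0.
Hypothesis Fl : forall n k v, is_linear (fun u => F n k u v).
Hypothesis Fr : forall n k u, is_linear (fun v => F n k u v).

Definition cpol (u : S) : nat -> S := fun k => if k is 0 then u else 0.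

(* Multiplication by [D] on [C[D] (x) S]. *)
Definition sD A : nat -> S := fun k => if k is k'.+1 then A k' else 0.

Lemma fin_supp_cpol u : fin_supp (cpol u). Proof. by exists 1%N => -[]. Qed.
Lemma fin_supp_sD A : fin_supp A -> fin_supp (sD A).
Proof. by case=> N h; exists N.+1 => -[|k] //; apply: h. Qed.

Lemma fin_supp_ind (P : (nat -> S) -> Prop) :
  (forall u, P (cpol u)) -> (forall A, fin_supp A -> P A -> P (sD A)) ->
  (forall A B, fin_supp A -> fin_supp B -> P A -> P B -> P (fun k => A k + B k)) ->
  forall A, fin_supp A -> P A.
Proof.
move=> Pc PsD PA A [N]; elim: N A => [|N IH] A h.
  rewrite (_ : A = cpol 0); first exact: Pc.
  by apply: funext => k; rewrite h //; case: k.
pose B k := A k.+1.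
have hB k : (N <= k)%N -> B k = 0 by move=> le; apply: h.
rewrite (_ : A = fun k => cpol (A 0%N) k + sD B k); last first.
  by apply: funext => -[|k] /=; rewrite ?addr0 ?add0r.
apply: PA; [exact: fin_supp_cpol|apply: fin_supp_sD; by exists N|exact: Pc|].
by apply: PsD; [exists N|exact: IH].
Qed.

Lemma F0l n k v : F n k 0 v = 0. Proof. exact: (lin0 (Fl n k v)). Qed.
Lemma F0r n k u : F n k u 0 = 0. Proof. exact: (lin0 (Fr n k u)). Qed.

Lemma cprod_cpolr n A v k : cprod F n A (cpol v) k =
  \sum_(a < n.+1) ((-1) ^+ a * (n ^_ a)%:R) *: F (n - a)%N k (A a) v.
Proof.
rewrite /cprod; apply: eq_bigr => a _; rewrite big_ord_recl /= [X in _ + X]big1 ?addr0.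
  rewrite big_ord_recr /= big1 ?add0r => [|l _].
    by rewrite subnn bin0 mulr1 add0n subn0.
  rewrite addn0; have -> : (k - l = (k - l).-1.+1)%N by have := ltn_ord l; lia.
  by rewrite /= F0r scaler0.
move=> j _; apply: big1 => l _; rewrite /bump /= addnA.
by rewrite addnS /= F0r scaler0.
Qed.

Lemma cprod_cpoll n u B k : cprod F n (cpol u) B k =
  \sum_(j < n.+1) \sum_(l < k.+1)
    (('C(k - l + j, j))%:R * (n ^_ j)%:R) *: F (n - j)%N l u (B (k - l + j)%N).
Proof.
rewrite /cprod big_ord_recl /= [X in _ + X]big1 ?addr0 => [|a _]; last first.
  by rewrite /bump /=; apply: big1 => j _; apply: big1 => l _; rewrite F0l scaler0.
rewrite subn0; apply: eq_bigr => j _; apply: eq_bigr => l _.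
by rewrite expr0 mul1r addn0 subn0.
Qed.

(** At n = 0 the truncated predecessor is harmless, since its coefficient is zero. A constant second
    argument suffices for the mode brackets. *)
Lemma cprod_sDl n A v k :
  cprod F n (sD A) (cpol v) k = - n%:R *: cprod F n.-1 A (cpol v) k.
Proof.
rewrite !cprod_cpolr; case: n => [|n].
  by rewrite big_ord1 /= F0l scaler0 oppr0 scale0r.
rewrite big_ord_recl /= F0l scaler0 add0r scaler_sumr; apply: eq_bigr => a _.
rewrite /bump /= add1n subSS scalerA; congr (_ *: _).
by rewrite exprS ffactnS natrM /=; ring.
Qed.

(** The Leibniz rule combined with (D u)_n B = - n u_(n-1) B. In the explicit formula it is Pascal's
    rule for the binomial. *)
Lemma cprod_sDr n u B k : cprod F n (cpol u) (sD B) k =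
  sD (cprod F n (cpol u) B) k + n%:R *: cprod F n.-1 (cpol u) B k.
Proof.
pose e n' j k' l d := (('C(k' - l + d, d))%:R * (n' ^_ d)%:R : K) *: F (n' - d)%N l u (B (k' - l + j)%N).
rewrite cprod_cpoll big_ord_recl.
have -> : \sum_(l < k.+1) (('C(k - l + @ord0 n, @ord0 n))%:R * (n ^_ (@ord0 n))%:R : K) *:
    F (n - @ord0 n)%N l u (sD B (k - l + @ord0 n)%N) =
  if k is k'.+1 then \sum_(l < k) F n l u (B (k' - l)%N) else 0.
  rewrite big_ord_recr /= subnn F0r scaler0 addr0.
  case: k => [|k']; first by rewrite big_ord0.
  apply: eq_bigr => l _; rewrite bin0 mulr1 scale1r subn0 addn0.
  by rewrite subSn //; have := ltn_ord l; lia.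
have E j : \sum_(l < k.+1) (('C(k - l + j.+1, j.+1))%:R * (n ^_ j.+1)%:R : K) *:
    F (n - j.+1)%N l u (sD B (k - l + j.+1)%N) =
  (if k is k'.+1 then \sum_(l < k) (('C(k' - l + j.+1, j.+1))%:R * (n ^_ j.+1)%:R : K) *:
       F (n - j.+1)%N l u (B (k' - l + j.+1)%N) else 0) +
  n%:R *: \sum_(l < k.+1) (('C(k - l + j, j))%:R * (n.-1 ^_ j)%:R : K) *:
       F (n.-1 - j)%N l u (B (k - l + j)%N).
  have pre : \sum_(l < k.+1) (('C(k - l + j, j.+1))%:R * (n ^_ j.+1)%:R : K) *:
       F (n - j.+1)%N l u (B (k - l + j)%N) =
     if k is k'.+1 then \sum_(l < k) (('C(k' - l + j.+1, j.+1))%:R * (n ^_ j.+1)%:R : K) *: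
       F (n - j.+1)%N l u (B (k' - l + j.+1)%N) else 0.
    rewrite big_ord_recr /= subnn add0n bin_small // mul0r scale0r addr0.
    case: k => [|k']; first by rewrite big_ord0.
    apply: eq_bigr => l _.
    by rewrite (_ : (k'.+1 - l + j = k' - l + j.+1)%N) //; have := ltn_ord l; lia.
  rewrite -pre scaler_sumr -big_split; apply: eq_bigr => l _ /=.
  rewrite addnS /= binS natrD ffactnS scalerA.
  have -> : (n - j.+1 = n.-1 - j)%N by lia.
  by rewrite natrM; lmod K.
under eq_bigr do rewrite !lift0 E.
rewrite big_split addrA /=; congr (_ + _).
  case: k {E} => [|k] /=; first by rewrite big1 ?addr0.
  rewrite cprod_cpoll [RHS]big_ord_recl /=; congr (_ + _).
  by apply: eq_bigr => l _; rewrite bin0 mulr1 scale1r subn0 addn0.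
rewrite -scaler_sumr; case: n {e E} => [|n]; first by rewrite !scale0r.
by rewrite cprod_cpoll.
Qed.

Lemma cprod_cpol n u v : cprod F n (cpol u) (cpol v) = fun k => F n k u v.
Proof.
apply: funext => k; rewrite cprod_cpolr big_ord_recl big1 ?addr0 /=.
  by rewrite mul1r scale1r subn0.
by move=> i _; rewrite F0l scaler0.
Qed.

Definition nice (X : nat -> nat -> S) :=
  exists N, forall n k, (N <= n)%N \/ (N <= k)%N -> X n k = 0.

Lemma nice_add X Y (s : nat -> K) : nice X -> nice Y -> nice (fun n k => X n k + s n *: Y n k).
Proof.
case=> N h [N' h']; exists (maxn N N') => n k; rewrite !geq_max.
by move=> hk; rewrite h ?h' ?scaler0 ?addr0 //; case: hk => /andP[]; [left|right|left|right].
Qed.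

Lemma nice_scale X (s : nat -> K) : nice X -> nice (fun n k => s n *: X n k).
Proof. by case=> N h; exists N => n k hk; rewrite h ?scaler0. Qed.

Lemma nice_sD X : nice X -> nice (fun n => sD (X n)).
Proof.
case=> N h; exists N.+1 => n [|k] //= [h1|h1]; apply: h; first by left; apply: ltnW.
by right.
Qed.

Lemma nice_pred X : nice X -> nice (fun n => X n.-1).
Proof.
case=> N h; exists N.+1 => n k [h1|h1]; apply: h; last by right; apply: ltnW.
by left; case: n h1.
Qed.

Lemma nice_cprodr u B : fin_supp B -> nice (fun n => cprod F n (cpol u) B).
Proof.
move: B; apply: fin_supp_ind => [v|B hB IH|B C hB hC IHB IHC].
- have [N h] := Ftrunc u v; exists N => n k hk; rewrite cprod_cpol; exact: h.
- have h := nice_add (fun n => n%:R) (nice_sD IH) (nice_pred IH).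
  have [N {}h] := h; exists N => n k hk; by rewrite cprod_sDr h.
have [N {}h] := nice_add (fun _ => 1) IHB IHC; exists N => n k hk.
rewrite -[RHS](h n k hk) !cprod_cpoll scale1r -big_split; apply: eq_bigr => j _ /=.
rewrite -big_split; apply: eq_bigr => l _ /=.
by rewrite (linD (Fr _ _ _)) scalerDr.
Qed.

Lemma nice_cprodl A v : fin_supp A -> nice (fun n => cprod F n A (cpol v)).
Proof.
move: A; apply: fin_supp_ind => [u|A hA IH|A B hA hB IHA IHB].
- have [N h] := Ftrunc u v; exists N => n k hk; rewrite cprod_cpol; exact: h.
- have [N h] := nice_scale (fun n => - n%:R) (nice_pred IH).
  by exists N => n k hk; rewrite cprod_sDl h.
have [N {}h] := nice_add (fun _ => 1) IHA IHB; exists N => n k hk.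
rewrite -[RHS](h n k hk) !cprod_cpolr scale1r -big_split; apply: eq_bigr => a _ /=.
by rewrite (linD (Fl _ _ _)) scalerDr.
Qed.

Lemma nice_fin X n : nice X -> fin_supp (X n).
Proof. by case=> N h; exists N => k le; apply: h; right. Qed.

End FiniteFamilies.

(** * Binomial convolutions *)

Section Vandermonde.
Variables (K : numFieldType) (W : lmodType K).
Implicit Types h : nat -> W.

Lemma bz_ez a h : ez h -> ez (fun i => bz K a i *: h i).
Proof. by case=> N e; exists N => i le; rewrite e ?scaler0. Qed.

Lemma tsum_bz_succ a h : ez h ->
  tsum (fun i => bz K (a + 1) i *: h i) =
  tsum (fun i => bz K a i *: h i) + tsum (fun i => bz K a i *: h i.+1).
Proof.
move=> hz; have hz' := ez_shift hz.
rewrite (tsumS (bz_ez (a + 1) hz)) (tsumS (bz_ez a hz)) !bz0 -addrA; congr (_ + _).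
rewrite -tsumD.
- by apply: eq_tsum => i; rewrite bzS; lmod K.
- exact: (ez_shift (bz_ez a hz)).
- exact: bz_ez.
Qed.

Lemma tsum_bz_ez b h : ez h -> ez (fun t => tsum (fun j => bz K b j *: h (t + j)%N)).
Proof.
case=> N e; exists N => t le; rewrite -[RHS](@tsum0 K W); apply: eq_tsum => j.
by rewrite e ?scaler0 // (leq_trans le) ?leq_addr.
Qed.

(** The defect [V] satisfies V(a + 1, h) = V(a, h) + V(a, shifted h), which gives a >= 0 at once.
    Going down in a, the shifted family has shorter support, so a second induction on the length of
    the support closes the step. *)
Lemma tsum_vandermonde a b h : ez h ->
  tsum (fun t => bz K a t *: tsum (fun j => bz K b j *: h (t + j)%N)) =
  tsum (fun s => bz K (a + b) s *: h s).
Proof.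
move=> hz; apply/eqP; rewrite -subr_eq0; apply/eqP.
pose V a h := tsum (fun t => bz K a t *: tsum (fun j => bz K b j *: h (t + j)%N)) -
  tsum (fun s => bz K (a + b) s *: h s).
rewrite -/(V a h).
have VS a' h' : ez h' -> V (a' + 1) h' = V a' h' + V a' (fun i => h' i.+1).
  move=> ez'; rewrite /V tsum_bz_succ; last exact: tsum_bz_ez.
  rewrite (_ : a' + 1 + b = a' + b + 1); last by lia.
  rewrite tsum_bz_succ //.
  rewrite (@eq_tsum _ _ (fun i => bz K a' i *: tsum (fun j => bz K b j *: h' (i.+1 + j)%N))
    (fun i => bz K a' i *: tsum (fun j => bz K b j *: h' (i + j)%N.+1))); first by lmod K.
  by move=> i; congr (_ *: _); apply: eq_tsum => j; rewrite addSn.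
have V0 h' : ez h' -> V 0 h' = 0.
  move=> ez'; rewrite /V (@tsum1 _ _ _ 0) => [|[|i] //]; last by rewrite bz0S scale0r.
  by rewrite bz0 scale1r add0r subrr.
elim/int_rect: a h hz => [|n IH|n IH] h hz; first exact: V0.
  rewrite (_ : n.+1%:Z = n%:Z + 1); last by lia.
  by rewrite VS // !IH ?addr0 //; apply: ez_shift.
case: (hz) => N; elim: N h hz => [|N IHN] h hz e.
  have -> : h = fun _ => 0 by apply: funext => i; apply: e.
  rewrite /V -[RHS](subrr 0); congr (_ - _); rewrite -[RHS](@tsum0 K W); apply: eq_tsum => t.
    by rewrite (@eq_tsum _ _ _ (fun _ => 0)) ?tsum0 ?scaler0 // => j; rewrite scaler0.
  by rewrite scaler0.
have := VS (- n.+1%:Z) h hz.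
rewrite (_ : - n.+1%:Z + 1 = - n%:Z); last by lia.
rewrite IH // (IHN (fun i => h i.+1)) ?addr0 //; first exact: ez_shift.
by move=> i le; apply: e.
Qed.

Lemma bz_trinomial (m : int) l t :
  bz K m (l + t) * ('C(l + t, l))%:R = bz K m l * bz K (m - l%:Z) t.
Proof.
elim: t => [|t IH]; first by rewrite addn0 binn bz0.
have nz : t.+1%:R != 0 :> K by rewrite pnatr_eq0.
apply: (mulIf nz).
have e : ('C((l + t).+1, l))%:R * t.+1%:R = ('C(l + t, l))%:R * (l + t).+1%:R :> K.
  rewrite -!natrM; congr (_%:R); rewrite [RHS]mulnC mul_bin_down.
  by rewrite mulnC; congr (_ * _)%N; lia.
have e1 := bz_mulS K (m - l%:Z) t; have e2 := bz_mulS K m (l + t).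
rewrite addnS -mulrA e mulrCA e2 -[RHS]mulrA e1 (mulrA (bz K m l)) -IH PoszD opprD addrA.
by ring.
Qed.

End Vandermonde.

Section ModeAlgebra.
Variables (K : numFieldType) (S : lmodType K) (F : nat -> nat -> S -> S -> S).
Implicit Types A B : nat -> S.
Hypothesis Ftrunc : forall u v, exists N, forall n k, (N <= n)%N \/ (N <= k)%N -> F n k u v = 0.
Hypothesis Fl : forall n k v, is_linear (fun u => F n k u v).
Hypothesis Fr : forall n k u, is_linear (fun v => F n k u v).

Inductive loop_rel : term K (int * S) -> Prop :=
  LoopRel n c u v : loop_rel (TA (TG (n, c *: u + v))
    (TS (-1) (TA (TS c (TG (n, u))) (TG (n, v))))).

Definition loop : lmodType K := pres loop_rel.
Definition lgen (n : int) (u : S) : loop := pgen loop_rel (n, u).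

Lemma lgen_lin n : is_linear (lgen n).
Proof.
move=> c u v; have := pres_ext0 (LoopRel n c u v); rewrite /= scaleN1r.
by move/eqP; rewrite subr_eq0 => /eqP.
Qed.

Section Lift.
Variables (W : lmodType K) (phi : int -> S -> W).
Hypothesis phiL : forall n, is_linear (phi n).

Lemma loop_kills : kills loop_rel (fun x => phi x.1 x.2).
Proof. by move=> t [n c u v] /=; rewrite phiL scaleN1r subrr. Qed.

Definition llift : loop -> W := plift (fun x => phi x.1 x.2).
Lemma llift_linear : is_linear llift. Proof. exact: plift_linear loop_kills. Qed.
Lemma llift_gen n u : llift (lgen n u) = phi n u. Proof. exact: plift_gen loop_kills. Qed.
End Lift.

Lemma loop_ext (W : lmodType K) (f h : loop -> W) : is_linear f -> is_linear h ->
  (forall n u, f (lgen n u) = h (lgen n u)) -> f =1 h.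
Proof. by move=> fL hL e; apply: pres_linext => // -[n u]; apply: e. Qed.

(* [mode m A] is the element [A_m] of the loop space, where [(D A)_m = - m A_(m - 1)]. *)
Definition mode (m : int) A : loop :=
  tsum (fun k => ((-1) ^+ k * (dcoef m k)%:~R) *: lgen (m - k%:Z) (A k)).

Lemma mode_ez m A : fin_supp A ->
  ez (fun k => ((-1) ^+ k * (dcoef m k)%:~R : K) *: lgen (m - k%:Z) (A k)).
Proof.
by case=> N h; exists N => k le; rewrite h // (lin0 (lgen_lin _)) scaler0.
Qed.

Lemma mode_lin m A B c : fin_supp A -> fin_supp B ->
  mode m (fun k => A k + c *: B k) = mode m A + c *: mode m B.
Proof.
move=> hA hB; rewrite /mode -tsumZ; last exact: mode_ez.
rewrite -tsumD; [|exact: mode_ez|by apply: ezZ; apply: mode_ez].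
by apply: eq_tsum => k; rewrite (linD (lgen_lin _)) (linZ (lgen_lin _)); lmod K.
Qed.

Lemma mode_scale m A c : fin_supp A -> mode m (fun k => c *: A k) = c *: mode m A.
Proof.
move=> hA; rewrite /mode -tsumZ; last exact: mode_ez.
by apply: eq_tsum => k; rewrite (linZ (lgen_lin _)); lmod K.
Qed.

Lemma mode0 m : mode m (fun _ => 0) = 0.
Proof.
by rewrite /mode -[RHS](@tsum0 K loop); apply: eq_tsum => k; rewrite (lin0 (lgen_lin _)) scaler0.
Qed.

Lemma mode_cpol m u : mode m (cpol u) = lgen m u.
Proof.
rewrite /mode (@tsum1 _ _ _ 0) => [|[|k] //]; last by rewrite /= (lin0 (lgen_lin _)) scaler0.
by rewrite /dcoef big_ord0 expr0 mulr1 scale1r subr0.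
Qed.

Lemma mode_sD m A : fin_supp A -> mode m (sD A) = - m%:~R *: mode (m - 1) A.
Proof.
move=> hA; rewrite /mode (tsumS (mode_ez _ (fin_supp_sD hA))) /= (lin0 (lgen_lin _)).
rewrite scaler0 add0r -tsumZ; last exact: mode_ez.
apply: eq_tsum => k; rewrite exprS dcoefSl scalerA intrM.
rewrite (_ : m - k.+1%:Z = m - 1 - k%:Z); last by lia.
by congr (_ *: _); ring.
Qed.

(* For [X n = u_n v] this is the bracket [[u_m, v_p]]. *)
Definition msum (m p : int) (X : nat -> nat -> S) : loop :=
  tsum (fun i => bz K m i *: mode (m + p - i%:Z) (X i)).

Lemma nice_ez (X : nat -> nat -> S) (c : nat -> K) (s : nat -> int) : nice X ->
  ez (fun i => c i *: mode (s i) (X i)).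
Proof.
case=> N h; exists N => i le; rewrite (_ : X i = fun _ => 0) ?mode0 ?scaler0 //.
by apply: funext => k; apply: h; left.
Qed.

Lemma msum_lin m p X Y c : nice X -> nice Y ->
  msum m p (fun i k => X i k + c *: Y i k) = msum m p X + c *: msum m p Y.
Proof.
move=> nX nY; rewrite /msum -tsumZ; last exact: nice_ez.
rewrite -tsumD; [|exact: nice_ez|by apply: ezZ; apply: nice_ez].
apply: eq_tsum => i; rewrite mode_lin; [by lmod K|exact: nice_fin nX|exact: nice_fin nY].
Qed.

(** The left side is the shape of [cprod_sDr], the right side that of [mode_sD]: with this the
    bracket with the modes of B determines the bracket with the modes of D B. *)
Lemma msum_sDr m p X : nice X ->
  msum m p (fun i k => sD (X i) k + i%:R *: X i.-1 k) = - p%:~R *: msum m (p - 1) X.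
Proof.
move=> nX; have fX i := nice_fin i nX.
rewrite /msum (@eq_tsum _ _ _ (fun i =>
   (bz K m i * - (m + p - i%:Z)%:~R) *: mode (m + (p - 1) - i%:Z) (X i) +
   (bz K m i * i%:R) *: mode (m + p - i%:Z) (X i.-1))); last first.
  move=> i; rewrite mode_lin // ?mode_sD //; last exact: fin_supp_sD.
  by rewrite (_ : m + (p - 1) - i%:Z = m + p - i%:Z - 1); [lmod K|lia].
rewrite tsumD; [|exact: nice_ez|exact: (nice_ez _ _ (nice_pred nX))].
rewrite [X in _ + X]tsumS; last exact: (nice_ez _ _ (nice_pred nX)).
rewrite /= mulr0 scale0r add0r -tsumZ; last exact: nice_ez.
rewrite -tsumD; [|exact: nice_ez|].
  apply: eq_tsum => i; rewrite bz_mulS.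
  rewrite (_ : m + p - i.+1%:Z = m + (p - 1) - i%:Z); last by lia.
  by rewrite -scalerDl scalerA !intrD; congr (_ *: _); ring.
exact: (@nice_ez X (fun i => bz K m i.+1 * i.+1%:R) (fun i => m + p - i.+1%:Z)).
Qed.

Lemma msum_sDl m p X : nice X ->
  msum m p (fun i k => - i%:R *: X i.-1 k) = - m%:~R *: msum (m - 1) p X.
Proof.
move=> nX; have fX i := nice_fin i nX.
rewrite /msum (@eq_tsum _ _ _ (fun i => (bz K m i * - i%:R) *: mode (m + p - i%:Z) (X i.-1))).
  rewrite tsumS; last exact: (nice_ez _ _ (nice_pred nX)).
  rewrite oppr0 mulr0 scale0r add0r -tsumZ; last exact: nice_ez.
  apply: eq_tsum => i; rewrite scalerA /= mulrN bz_mulS.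
  rewrite (_ : m + p - i.+1%:Z = m - 1 + p - i%:Z); last by lia.
  congr (_ *: _); rewrite -(bz_mulS K m i) -mulrN mulNr mulrN; congr (- _).
  rewrite bz_mulS; have := bzS K (m - 1) i; rewrite subrK.
  case: i => [|i] e; first by rewrite !bz0 subr0; ring.
  have e1 := bz_mulS K (m - 1) i; have := bzS K (m - 1) i; rewrite subrK => ->.
  have -> : (m - i.+1%:Z)%:~R = m%:~R - i.+1%:R :> K by rewrite intrD rmorphN.
  rewrite mulrBr mulrDl mulrDl; move: e1; rewrite (_ : m - 1 - i%:Z = m - i.+1%:Z); last by lia.
  rewrite intrD rmorphN /= => e1.
  by rewrite e1; ring.
by move=> i; rewrite mode_scale // scalerA.
Qed.

Definition lbr : loop -> loop -> loop := fun x y =>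
  llift (fun m u => llift (fun p v => msum m p (fun i k => F i k u v)) y) x.

Lemma F_nice u v : nice (fun i k => F i k u v). Proof. exact: Ftrunc. Qed.

Lemma msum_F_linr m p u : is_linear (fun v => msum m p (fun i k => F i k u v)).
Proof.
move=> c v v'; rewrite [RHS]addrC -msum_lin; try exact: F_nice.
by congr (msum _ _ _); apply: funext => i; apply: funext => k; rewrite Fr addrC.
Qed.

Lemma msum_F_linl m p v : is_linear (fun u => msum m p (fun i k => F i k u v)).
Proof.
move=> c u u'; rewrite [RHS]addrC -msum_lin; try exact: F_nice.
by congr (msum _ _ _); apply: funext => i; apply: funext => k; rewrite Fl addrC.
Qed.

Lemma lbr_inner m y : is_linear (fun u => llift (fun p v => msum m p (fun i k => F i k u v)) y).
Proof.
move=> c u u'; move: y; apply: loop_ext.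
- by apply: llift_linear => n; apply: msum_F_linr.
- by apply: lin_add; [apply: lin_scale|]; apply: llift_linear => n; apply: msum_F_linr.
by move=> n v; rewrite !llift_gen; try (by move=> n'; apply: msum_F_linr); exact: msum_F_linl.
Qed.

Lemma lbr_linl y : is_linear (fun x => lbr x y).
Proof. by apply: llift_linear => m; apply: lbr_inner. Qed.

Lemma lbr_linr x : is_linear (lbr x).
Proof.
move=> c y y'; move: x; apply: loop_ext; first exact: lbr_linl.
  by apply: lin_add; [apply: lin_scale|]; apply: lbr_linl.
move=> m u; rewrite /lbr !llift_gen; try by move=> n; apply: lbr_inner.
by apply: llift_linear => n; apply: msum_F_linr.
Qed.

Lemma lbr_gen m u p v : lbr (lgen m u) (lgen p v) = msum m p (fun i k => F i k u v).
Proof.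
rewrite /lbr llift_gen; last by move=> n; apply: lbr_inner.
by rewrite llift_gen // => n; apply: msum_F_linr.
Qed.

Lemma lbr_gen_mode m u p A : fin_supp A ->
  lbr (lgen m u) (mode p A) = msum m p (fun i => cprod F i (cpol u) A).
Proof.
move=> hA; move: A hA p; apply: fin_supp_ind => [v|A hA IH|A B hA hB IHA IHB] p.
- rewrite mode_cpol lbr_gen; congr msum; apply: funext => i.
  by rewrite (cprod_cpol Fl Fr).
- rewrite mode_sD // (linZ (lbr_linr _)) IH -msum_sDr; last exact: nice_cprodr.
  by congr msum; apply: funext => i; apply: funext => k; rewrite (cprod_sDr Fl Fr).
have := mode_lin p 1 hA hB; rewrite scale1r => e.
rewrite (_ : mode p (fun k => A k + B k) = mode p A + mode p B); last first.
  by rewrite -e; congr mode; apply: funext => k; rewrite scale1r.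
rewrite (linD (lbr_linr _)) IHA IHB.
have := @msum_lin m p (fun i => cprod F i (cpol u) A) (fun i => cprod F i (cpol u) B) 1.
rewrite scale1r => <-; try exact: nice_cprodr.
congr msum; apply: funext => i; apply: funext => k; rewrite !(cprod_cpoll Fl) scale1r -big_split.
apply: eq_bigr => j _ /=; rewrite -big_split; apply: eq_bigr => l _ /=.
by rewrite (linD (Fr _ _ _)) scalerDr.
Qed.

Lemma lbr_mode_gen m A p v : fin_supp A ->
  lbr (mode m A) (lgen p v) = msum m p (fun i => cprod F i A (cpol v)).
Proof.
move=> hA; move: A hA m; apply: fin_supp_ind => [u|A hA IH|A B hA hB IHA IHB] m.
- rewrite mode_cpol lbr_gen; congr msum; apply: funext => i.
  by rewrite (cprod_cpol Fl Fr).
- rewrite mode_sD // (linZ (lbr_linl _)) IH -msum_sDl; last exact: nice_cprodl.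
  by congr msum; apply: funext => i; apply: funext => k; rewrite (cprod_sDl Fl Fr).
have := mode_lin m 1 hA hB; rewrite scale1r => e.
rewrite (_ : mode m (fun k => A k + B k) = mode m A + mode m B); last first.
  by rewrite -e; congr mode; apply: funext => k; rewrite scale1r.
rewrite (linD (lbr_linl _)) IHA IHB.
have := @msum_lin m p (fun i => cprod F i A (cpol v)) (fun i => cprod F i B (cpol v)) 1.
rewrite scale1r => <-; try exact: nice_cprodl.
congr msum; apply: funext => i; apply: funext => k; rewrite !(cprod_cpolr Fr) scale1r -big_split.
apply: eq_bigr => j _ /=.
by rewrite (linD (Fl _ _ _)) scalerDr.
Qed.

End ModeAlgebra.

Section DoubleSums.
Variables (K : numFieldType) (W : lmodType K).
Implicit Types Y Z : nat -> nat -> W.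

Definition nice2 Y := exists N, forall i j, (N <= i)%N \/ (N <= j)%N -> Y i j = 0.

Lemma nice2_intro Y : (exists N, forall j, (N <= j)%N -> forall i, Y i j = 0) ->
  (forall j, exists N, forall i, (N <= i)%N -> Y i j = 0) -> nice2 Y.
Proof.
move=> [N h] hY.
have [N' h'] : exists N', forall i j, (j < N)%N -> (N' <= i)%N -> Y i j = 0.
  elim: N {h} => [|N [N1 h1]]; first by exists 0%N.
  have [N2 h2] := hY N; exists (maxn N1 N2) => i j; rewrite ltnS leq_eqVlt geq_max.
  by case/orP => [/eqP -> /andP[_ /h2]|lt /andP[le _]] //; apply: h1.
exists (maxn N N') => i j; rewrite !geq_max => -[/andP[l1 l2]|/andP[l1 l2]]; last exact: h.
by have [lt|le] := ltnP j N; [apply: h'|apply: h].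
Qed.

Lemma nice2_swap Y : nice2 Y -> nice2 (fun i j => Y j i).
Proof. by case=> N h; exists N => i j hij; apply: h; case: hij; [right|left]. Qed.

Lemma tsum2E (a b : nat -> K) Y N : (forall i j, (N <= i)%N \/ (N <= j)%N -> Y i j = 0) ->
  tsum (fun i => a i *: tsum (fun j => b j *: Y i j)) =
  \sum_(i < N) \sum_(j < N) a i *: (b j *: Y i j).
Proof.
move=> h; rewrite (@tsumE _ _ N) => [|i le]; last first.
  rewrite (@eq_tsum _ _ _ (fun _ => 0)) ?tsum0 ?scaler0 // => j.
  by rewrite h ?scaler0 //; left.
apply: eq_bigr => i _; rewrite (@tsumE _ _ N) ?scaler_sumr // => j le.
by rewrite h ?scaler0 //; right.
Qed.

Lemma tsum_exchange (a b : nat -> K) Y : nice2 Y ->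
  tsum (fun j => b j *: tsum (fun i => a i *: Y i j)) =
  tsum (fun i => a i *: tsum (fun j => b j *: Y i j)).
Proof.
case=> N h; rewrite (tsum2E a b h).
rewrite (@tsum2E b a (fun j i => Y i j) N); last by move=> i j hij; apply: h; case: hij; [right|left].
rewrite exchange_big; apply: eq_bigr => i _; apply: eq_bigr => j _.
by rewrite !scalerA mulrC.
Qed.

Lemma tsum2_lin (a b : nat -> K) Y Z c : nice2 Y -> nice2 Z ->
  tsum (fun i => a i *: tsum (fun j => b j *: (Y i j + c *: Z i j))) =
  tsum (fun i => a i *: tsum (fun j => b j *: Y i j)) +
  c *: tsum (fun i => a i *: tsum (fun j => b j *: Z i j)).
Proof.
move=> [N h] [N' h']; pose B := maxn N N'.
have hB i j : (B <= i)%N \/ (B <= j)%N -> Y i j = 0.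
  by rewrite !geq_max => hij; apply: h; case: hij => /andP[]; [left|right].
have hB' i j : (B <= i)%N \/ (B <= j)%N -> Z i j = 0.
  by rewrite !geq_max => hij; apply: h'; case: hij => /andP[]; [left|right].
rewrite (tsum2E a b hB) (tsum2E a b hB').
rewrite (@tsum2E a b (fun i j => Y i j + c *: Z i j) B); last first.
  by move=> i j hij; rewrite hB // hB' // scaler0 addr0.
rewrite scaler_sumr -big_split; apply: eq_bigr => i _ /=.
rewrite scaler_sumr -big_split; apply: eq_bigr => j _ /=.
by lmod K.
Qed.

Lemma tsum_drop (f : nat -> W) l : (forall i, (i < l)%N -> f i = 0) -> ez f ->
  tsum f = tsum (fun t => f (l + t)%N).
Proof.
elim: l f => [|l IH] f h hz; first by apply: eq_tsum.
rewrite tsumS // h // add0r IH; last exact: ez_shift.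
  by apply: eq_tsum => t; rewrite addSn.
by move=> i lt; apply: h.
Qed.

(* The Vandermonde convolution behind the Jacobi identity for the modes. *)
Lemma tsum_jacobi (m p : int) Y : nice2 Y ->
  tsum (fun i => bz K m i *: tsum (fun j => bz K p j *:
    \sum_(l < i.+1) ('C(i, l))%:R *: Y l (j + i - l)%N)) =
  tsum (fun l => bz K m l *: tsum (fun s => bz K (m + p - l%:Z) s *: Y l s)).
Proof.
move=> [N h].
have hz l : ez (Y l) by exists N => i le; apply: h; right.
pose k l t := tsum (fun j => bz K p j *: Y l (t + j)%N).
have k0 l t : (N <= l)%N \/ (N <= t)%N -> k l t = 0.
  move=> hlt; rewrite /k -[RHS](@tsum0 K W); apply: eq_tsum => j; rewrite h ?scaler0 //.
  by case: hlt => hl; [left|right; rewrite (leq_trans hl) ?leq_addr].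
have -> : (fun i => bz K m i *: tsum (fun j => bz K p j *:
    \sum_(l < i.+1) ('C(i, l))%:R *: Y l (j + i - l)%N)) =
  fun i => \sum_(l < N) (bz K m i * ('C(i, l))%:R) *: k l (i - l)%N.
  apply: funext => i.
  have -> : tsum (fun j => bz K p j *: \sum_(l < i.+1) ('C(i, l))%:R *: Y l (j + i - l)%N) =
      \sum_(l < i.+1) ('C(i, l))%:R *: k l (i - l)%N.
    rewrite (@tsumE _ _ (N + i)) => [|j le]; last first.
      rewrite big1 ?scaler0 // => l _; rewrite h ?scaler0 //; right.
      by have := ltn_ord l; lia.
    rewrite (eq_bigr (fun j : 'I_(N + i) => \sum_(l < i.+1) ('C(i, l))%:R *:
        (bz K p j *: Y l (i - l + j)%N))); last first.
      move=> j _; rewrite scaler_sumr; apply: eq_bigr => l _.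
      rewrite !scalerA mulrC; congr (_ *: Y _ _); have := ltn_ord l; lia.
    rewrite exchange_big; apply: eq_bigr => l _ /=; rewrite -scaler_sumr /k.
    rewrite (@tsumE _ _ (N + i)) // => j le; rewrite h ?scaler0 //; right; lia.
  rewrite -(@tsumE _ _ i.+1 (fun l => ('C(i, l))%:R *: k l (i - l)%N)) => [|l lt]; last first.
    by rewrite bin_small // scale0r.
  rewrite (@tsumE _ _ N) => [|l le]; last by rewrite k0 ?scaler0 //; left.
  by rewrite scaler_sumr; apply: eq_bigr => l _; rewrite scalerA.
rewrite (@tsumE _ _ (N + N)) => [|i le]; last first.
  by apply: big1 => l _; rewrite k0 ?scaler0 //; right; have := ltn_ord l; lia.
rewrite exchange_big (@tsumE _ _ N) => [|l le]; last first.
  rewrite (@eq_tsum _ _ _ (fun _ => 0)) ?tsum0 ?scaler0 // => s.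
  by rewrite h ?scaler0 //; left.
apply: eq_bigr => l _ /=.
have e0 i : (N + N <= i)%N -> (bz K m i * ('C(i, l))%:R) *: k l (i - l)%N = 0.
  by move=> le; rewrite k0 ?scaler0 //; right; have := ltn_ord l; lia.
rewrite -(tsumE e0) (@tsum_drop _ l) => [|i lt|]; last first.
- by exists (N + N)%N.
- by rewrite bin_small // mulr0 scale0r.
rewrite (@eq_tsum _ _ _ (fun t => bz K m l *: (bz K (m - l%:Z) t *: k l t))); last first.
  by move=> t; rewrite bz_trinomial addKn scalerA.
rewrite tsumZ; last by apply: bz_ez; apply: tsum_bz_ez.
rewrite tsum_vandermonde //; congr (_ *: _); apply: eq_tsum => s.
by rewrite addrAC.
Qed.

End DoubleSums.

Section BilinearQuotient.
Variables (K : fieldType) (U W : lmodType K) (Q : U -> Prop) (B : U -> U -> W).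
Hypotheses (Bl : forall y, is_linear (fun x => B x y)) (Br : forall x, is_linear (B x)).
Hypotheses (Ql : forall x y, Q x -> B x y = 0) (Qr : forall x y, Q y -> B x y = 0).

Definition qlift2 (x y : quot Q) : W := plift (fun x0 => plift (B x0) y) x.

Let kr x : kills (quot_rel Q) (B x). Proof. by apply: quot_kills => // y; apply: Qr. Qed.
Let kl y : kills (quot_rel Q) (fun x => plift (B x) (y : quot Q)).
Proof.
apply: quot_kills => [c x x'|x Qx].
  move: y; apply: quot_ind => y; rewrite !(plift_gen _ (kr _)); exact: Bl.
by move: y; apply: quot_ind => y; rewrite (plift_gen _ (kr _)); apply: Ql.
Qed.

Lemma qlift2E x y : qlift2 (qproj Q x) (qproj Q y) = B x y.
Proof. by rewrite /qlift2 (plift_gen _ (kl _)) (plift_gen _ (kr _)). Qed.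
Lemma qlift2_linl y : is_linear (fun x => qlift2 x y). Proof. exact: plift_linear (kl y). Qed.
Lemma qlift2_linr x : is_linear (qlift2 x).
Proof.
move=> c y y'; move: x; apply: quot_ind => x; rewrite /qlift2 !(plift_gen _ (kl _)).
by rewrite (plift_linear (kr x)).
Qed.
End BilinearQuotient.

(** * Skew-symmetry defects of the bracket of modes *)

Section SkewExpansion.
Variables (K : numFieldType) (S : lmodType K) (F : nat -> nat -> S -> S -> S).
Hypothesis Ftrunc : forall u v, exists N, forall n k, (N <= n)%N \/ (N <= k)%N -> F n k u v = 0.
Hypothesis Fl : forall n k v, is_linear (fun u => F n k u v).
Hypothesis Fr : forall n k u, is_linear (fun v => F n k u v).
Variables (e : K) (u v : S).

(** For r = 0 this is the bracket [u_p, v_q]; in general it is a coefficient of the commutator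
    series multiplied by the r-th power of z1 - z2, as [smodeS] shows. *)
Definition smode r u v (p q : int) : loop S :=
  tsum (fun i => bz K p i *: mode (p + q - i%:Z) (fun k => F (i + r) k u v)).

(* For [p = 0] this is the mode [q] of the skew-symmetry defect of the [r]-th product. *)
Definition sdef r p q : loop S := smode r u v p q + (e * (-1) ^+ r) *: smode r v u q p.

Lemma smode_ez (W : lmodType K) (f : loop S -> W) r u' v' (c : nat -> K) (s : nat -> int) :
  is_linear f -> ez (fun i => c i *: f (mode (s i) (fun k => F (i + r) k u' v'))).
Proof.
have [N h] := Ftrunc u' v' => fL; exists N => i le.
rewrite (_ : (fun k => F (i + r) k u' v') = fun _ => 0); first by rewrite mode0 lin0 ?scaler0.
by apply: funext => k; apply: h; left; rewrite (leq_trans le) ?leq_addr.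
Qed.

Lemma lin_smode (W : lmodType K) (f : loop S -> W) r u' v' p q : is_linear f ->
  f (smode r u' v' p q) =
  tsum (fun i => bz K p i *: f (mode (p + q - i%:Z) (fun k => F (i + r) k u' v'))).
Proof.
move=> fL; rewrite /smode (lin_tsum fL); last exact: (smode_ez _ _ _ _ _ (@lin_id K _)).
by apply: eq_tsum => i; rewrite /= (linZ fL).
Qed.

Lemma smodeS r u' v' p q : smode r.+1 u' v' p q = smode r u' v' (p + 1) q - smode r u' v' p (q + 1).
Proof.
pose h i := mode (p + q + 1 - i%:Z) (fun k => F (i + r)%N k u' v').
have hz : ez h.
  have [N z] := smode_ez r u' v' (fun _ => 1) (fun i => p + q + 1 - i%:Z) (@lin_id K (loop S)).
  by exists N => i /z; rewrite scale1r.
have -> : smode r u' v' (p + 1) q = tsum (fun i => bz K (p + 1) i *: h i).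
  by apply: eq_tsum => i; congr (_ *: mode _ _); lia.
have -> : smode r u' v' p (q + 1) = tsum (fun i => bz K p i *: h i).
  by apply: eq_tsum => i; congr (_ *: mode _ _); lia.
rewrite tsum_bz_succ // addrAC subrr add0r; apply: eq_tsum => i; rewrite /h addSnnS.
by congr (_ *: mode _ _); lia.
Qed.

Lemma sdefS r p q : sdef r.+1 p q = sdef r (p + 1) q - sdef r p (q + 1).
Proof. by rewrite /sdef !smodeS exprS; lmod K. Qed.

Lemma sdef_trunc : exists N, forall r p q, (N <= r)%N -> sdef r p q = 0.
Proof.
have [N h] := Ftrunc u v; have [N' h'] := Ftrunc v u; exists (maxn N N') => r p q.
rewrite geq_max => /andP[l1 l2]; rewrite /sdef /smode.
rewrite (@eq_tsum _ _ _ (fun _ => 0)) => [|i].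
  rewrite tsum0 add0r (@eq_tsum _ _ _ (fun _ => 0)) ?tsum0 ?scaler0 // => i.
  rewrite (_ : (fun k => _) = fun _ => 0) ?mode0 ?scaler0 //.
  by apply: funext => k; apply: h'; left; rewrite (leq_trans l2) ?leq_addl.
rewrite (_ : (fun k => _) = fun _ => 0) ?mode0 ?scaler0 //.
by apply: funext => k; apply: h; left; rewrite (leq_trans l1) ?leq_addl.
Qed.

Lemma sdef0 p q :
  sdef 0 p q = lbr F (lgen p u) (lgen q v) + e *: lbr F (lgen q v) (lgen p u).
Proof.
rewrite !(lbr_gen Ftrunc Fl Fr) /sdef expr0 mulr1; congr (_ + _ *: _); apply: eq_tsum => i.
  by rewrite addn0.
by rewrite addn0 (addrC q).
Qed.

(** By [cascade] the defect of a bracket is a combination of the defects of single products, the row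
    p = 0, on which a form is easy to evaluate. *)
Lemma sdef0_kills (W : lmodType K) (f : loop S -> W) : is_linear f ->
  (forall r q, f (sdef r 0 q) = 0) -> forall p q, f (sdef 0 p q) = 0.
Proof.
move=> fL h p q; have [N hN] := sdef_trunc.
rewrite (cascade sdefS hN) (lin_tsum fL); last by exists N => i le; rewrite hN ?scaler0.
by rewrite -[RHS](@tsum0 K W); apply: eq_tsum => i; rewrite /= (linZ fL) h scaler0.
Qed.

Lemma sdef_kills (W : lmodType K) (f : loop S -> W) : is_linear f ->
  (forall p q, f (sdef 0 p q) = 0) -> forall r p q, f (sdef r p q) = 0.
Proof.
by move=> fL h; elim=> [|r IH] p q //; rewrite sdefS (linB fL) !IH subrr.
Qed.

(** The weights are [bz 0 i] in the product of u and v and [bz q i] in that of v and u, so the maps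
    need only agree on modes up to these weights. *)
Lemma lin_sdef (W : lmodType K) (f g : loop S -> W) r q : is_linear f -> is_linear g ->
  (forall s i A, s = 0 \/ s = q -> fin_supp A -> bz K s i *: f (mode (q - i%:Z) A) = bz K s i *: g (mode (q - i%:Z) A))
  -> f (sdef r 0 q) = g (sdef r 0 q).
Proof.
move=> fL gL h; rewrite /sdef (linD fL) (linD gL) (linZ fL) (linZ gL) !lin_smode // addr0 add0r.
have fF n x y := nice_fin n (F_nice Ftrunc x y).
by congr (_ + _ *: _); apply: eq_tsum => i; apply: h; auto.
Qed.

End SkewExpansion.

(** * The quotient Lie superalgebra, its two halves, and the retraction onto [S] *)

Section EnvelopingAlgebra.
Variables (K : numFieldType) (S : lmodType K) (S0 S1 : S -> Prop) (pr : bool -> S -> S).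
Variable F : nat -> nat -> S -> S -> S.
Hypothesis Ftrunc : forall u v, exists N, forall n k, (N <= n)%N \/ (N <= k)%N -> F n k u v = 0.
Hypothesis Fl : forall n k v, is_linear (fun u => F n k u v).
Hypothesis Fr : forall n k u, is_linear (fun v => F n k u v).
Hypothesis prL : forall b, is_linear (pr b).
Hypothesis prH : forall b u, homog S0 S1 b (pr b u).
Hypothesis pr_id : forall b u, homog S0 S1 b u -> pr b u = u.
Hypothesis pr_pr : forall a b u, pr a (pr b u) = if a == b then pr b u else 0.
Hypothesis Fpar : forall n k a b u v, homog S0 S1 a u -> homog S0 S1 b v ->
  homog S0 S1 (a (+) b) (F n k u v).

Hypothesis prD : forall u, u = pr false u + pr true u.
Local Notation homog := (homog S0 S1).
Local Notation homogD := (homogD S0 S1).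
Local Notation loop := (loop S).
Local Notation lbr := (lbr F).
Hypothesis HJ : forall x, jacobi_ideal S0 S1 F x -> x 0%N = 0.
Hypothesis Hskew : forall a b u v n, homog a u -> homog b v ->
  F n 0%N u v = - (eps a b * (-1) ^+ n) *: F n 0%N v u.

Lemma homog0 b : homog b 0.
Proof. by have := prH b 0; rewrite (lin0 (prL b)). Qed.

Lemma homog_lin b c u v : homog b u -> homog b v -> homog b (c *: u + v).
Proof. by move=> /pr_id <- /pr_id <-; rewrite -(prL b). Qed.

Lemma homogZ b c u : homog b u -> homog b (c *: u).
Proof. by move=> h; rewrite -[_ *: _]addr0; apply: homog_lin => //; apply: homog0. Qed.

Lemma homogD_add b u v : homog b u -> homog b v -> homog b (u + v).
Proof. by rewrite -{2}[u]scale1r; apply: homog_lin. Qed.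

Lemma homog_sum b I (r : seq I) (P : pred I) (f : I -> S) :
  (forall i, homog b (f i)) -> homog b (\sum_(i <- r | P i) f i).
Proof.
by move=> h; elim/big_rec: _ => [|i x _ hx]; [exact: homog0|exact: homogD_add].
Qed.

Lemma cprod_homog a b n A B : homogD a A -> homogD b B -> homogD (a (+) b) (cprod F n A B).
Proof.
move=> hA hB k; do 3![apply: homog_sum => ?]; apply: homogZ; exact: Fpar.
Qed.

Lemma jacobi_homog a b c u v w m n : homogD a u -> homogD b v -> homogD c w ->
  homogD (a (+) b (+) c) (jacobi_elem F a b u v w m n).
Proof.
move=> hu hv hw k; rewrite /jacobi_elem -scaleNr -scaleN1r [X in homog _ X]addrC.
apply: homog_lin.
  apply: homog_sum => i; apply: homogZ; apply: cprod_homog => //; exact: cprod_homog.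
rewrite [X in homog _ X]addrC; apply: homog_lin.
  rewrite (addbC a) -addbA; by apply: cprod_homog => //; apply: cprod_homog.
by rewrite -addbA; apply: cprod_homog => //; apply: cprod_homog.
Qed.

Lemma cpol_homog b u : homog b u -> homogD b (cpol u).
Proof. by move=> h [|k] //=; apply: homog0. Qed.

Definition lpr (a : bool) : loop -> loop := llift (fun n u => lgen n (pr a u)).

Lemma lpr_phi a n : is_linear (fun u => lgen n (pr a u)).
Proof. exact: (lin_comp (prL a) (@lgen_lin K S n)). Qed.
Lemma lpr_linear a : is_linear (lpr a). Proof. exact: llift_linear (lpr_phi a). Qed.
Lemma lpr_gen a n u : lpr a (lgen n u) = lgen n (pr a u).
Proof. exact: (llift_gen (lpr_phi a)). Qed.

Lemma llift_mode (W : lmodType K) (phi : int -> S -> W) m A : (forall n, is_linear (phi n)) ->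
  fin_supp A ->
  llift phi (mode m A) = tsum (fun k => ((-1) ^+ k * (dcoef m k)%:~R) *: phi (m - k%:Z) (A k)).
Proof.
move=> phiL hA; rewrite /mode (lin_tsum (llift_linear phiL)); last exact: mode_ez.
by apply: eq_tsum => k; rewrite /= (linZ (llift_linear phiL)) llift_gen.
Qed.

Lemma lpr_mode a m A : fin_supp A -> lpr a (mode m A) = mode m (fun k => pr a (A k)).
Proof. exact: llift_mode (lpr_phi a). Qed.

Lemma lpr_mode_homog a c m A : fin_supp A -> homogD c A ->
  lpr a (mode m A) = if a == c then mode m A else 0.
Proof.
move=> fA hA; rewrite lpr_mode //.
rewrite (_ : (fun k => pr a (A k)) = if a == c then A else fun _ => 0).
  by case: eqP => // _; rewrite mode0.
apply: funext => k; rewrite -(pr_id (hA k)) pr_pr.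
by case: eqP => // _; rewrite (pr_id (hA k)).
Qed.

Lemma lin_msum (W : lmodType K) (f : loop -> W) m p X : is_linear f -> nice X ->
  f (msum m p X) = tsum (fun i => bz K m i *: f (mode (m + p - i%:Z) (X i))).
Proof.
move=> fL nX; rewrite /msum (lin_tsum fL); last exact: nice_ez.
by apply: eq_tsum => i; rewrite /= (linZ fL).
Qed.

Lemma lpr_lbr a b c x y :
  lpr c (lbr (lpr a x) (lpr b y)) = if c == a (+) b then lbr (lpr a x) (lpr b y) else 0.
Proof.
have L1 z : is_linear (fun x => lbr (lpr a x) z).
  exact: (lin_comp (lpr_linear a) (lbr_linl Ftrunc Fl Fr z)).
have L2 z : is_linear (fun y => lbr z (lpr b y)).
  exact: (lin_comp (lpr_linear b) (lbr_linr Ftrunc Fl Fr z)).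
move: x; apply: loop_ext => [||m u].
- exact: (lin_comp (L1 _) (lpr_linear c)).
- exact: (lin_if _ (L1 _)).
move: y; apply: loop_ext => [||p v].
- exact: (lin_comp (L2 _) (lpr_linear c)).
- exact: (lin_if _ (L2 _)).
rewrite !lpr_gen lbr_gen // lin_msum; [|exact: lpr_linear|exact: F_nice].
case: ifP => e; last rewrite -[RHS](@tsum0 K loop); apply: eq_tsum => i.
  rewrite (@lpr_mode_homog _ (a (+) b)) ?e //.
    exact: (nice_fin i (F_nice Ftrunc _ _)).
  by move=> k; apply: Fpar.
rewrite (@lpr_mode_homog _ (a (+) b)) ?e ?scaler0 //.
  exact: (nice_fin i (F_nice Ftrunc _ _)).
by move=> k; apply: Fpar.
Qed.

(** The relators are homogeneous: a parity projection leaves each of them unchanged or kills it,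
    which [env_rel_ideal_l] uses. *)
Inductive env_rel : loop -> Prop :=
 | ErJac m c A : fin_supp A -> jacobi_ideal S0 S1 F A -> homogD c A -> env_rel (mode m A)
 | ErSkew a b m u p v : env_rel (lbr (lgen m (pr a u)) (lgen p (pr b v)) +
     eps a b *: lbr (lgen p (pr b v)) (lgen m (pr a u))).

(* The graded version of the quotient of the loop space by the modes of <Jacobi>, in which
   skew-symmetry is imposed by hand. *)
Definition env : lmodType K := quot env_rel.
Definition envp : loop -> env := qproj env_rel.

Lemma envp_linear : is_linear envp. Proof. exact: qproj_linear. Qed.

Let lprL a : is_linear (lpr a) := lpr_linear a.
Let lbrl y : is_linear (fun x => lbr x y) := lbr_linl Ftrunc Fl Fr y.
Let lbrr x : is_linear (lbr x) := lbr_linr Ftrunc Fl Fr x.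
Let lbrL b y : is_linear (fun x => lbr (lpr b x) y) := lin_comp (lprL b) (lbrl y).
Let lbrR b x : is_linear (fun y => lbr x (lpr b y)) := lin_comp (lprL b) (lbrr x).

Lemma envp_skew a b x y :
  envp (lbr (lpr a x) (lpr b y)) = - eps a b *: envp (lbr (lpr b y) (lpr a x)).
Proof.
move: x; apply: loop_ext => [||m u].
- exact: (lin_comp (lbrL a _) envp_linear).
- apply: lin_scale; exact: (lin_comp (lin_comp (lprL a) (lbrr _)) envp_linear).
move: y; apply: loop_ext => [||p v].
- exact: (lin_comp (lbrR b _) envp_linear).
- apply: lin_scale; exact: (lin_comp (lbrL b _) envp_linear).
rewrite !lpr_gen scaleNr; apply/eqP; rewrite -addr_eq0 -(linZ envp_linear).
rewrite -(linD envp_linear); apply/eqP; apply: qproj0; exact: ErSkew.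
Qed.

Lemma fin_supp_jacobi a b u v w m n :
  fin_supp (jacobi_elem F a b (cpol u) (cpol v) (cpol w) m n).
Proof.
have fF i u' v' : fin_supp (cprod F i (cpol u') (cpol v')).
  by rewrite (cprod_cpol Fl Fr); apply: (nice_fin i (F_nice Ftrunc _ _)).
have [N1 h1] := nice_fin m (nice_cprodr Ftrunc Fl Fr u (fF n v w)).
have [N2 h2] := nice_fin n (nice_cprodr Ftrunc Fl Fr v (fF m u w)).
have h3 i : exists N, forall k, (N <= k)%N -> cprod F (n + m - i)%N (cprod F i (cpol u) (cpol v)) (cpol w) k = 0.
  exact: (nice_fin _ (nice_cprodl Ftrunc Fl Fr w (fF i u v))).
have [N3 {}h3] : exists N, forall i k, (i < m.+1)%N -> (N <= k)%N ->
    cprod F (n + m - i)%N (cprod F i (cpol u) (cpol v)) (cpol w) k = 0.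
  elim: m.+1 => [|r [N h]]; first by exists 0%N.
  have [N' h'] := h3 r; exists (maxn N N') => i k; rewrite ltnS leq_eqVlt geq_max.
  by case/orP => [/eqP ->|lt] /andP[le le']; [apply: h'|apply: h].
exists (maxn N1 (maxn N2 N3)) => k; rewrite !geq_max => /and3P[l1 l2 l3].
rewrite /jacobi_elem h1 // h2 // scaler0 subrr sub0r big1 ?oppr0 // => i _.
by rewrite h3 // scaler0.
Qed.

Lemma envp_jacobi_elem t a b c u v w m n : homog a u -> homog b v -> homog c w ->
  envp (mode t (jacobi_elem F a b (cpol u) (cpol v) (cpol w) m n)) = 0.
Proof.
move=> hu hv hw; have hc d x := @cpol_homog d x.
apply: qproj0; apply: (@ErJac t (a (+) b (+) c)).
- exact: fin_supp_jacobi.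
- move=> I _; apply; exists a, b, c, (cpol u), (cpol v), (cpol w), m, n.
  by split => //; try (exact: hc); split; [|split]; apply: fin_supp_cpol.
by apply: jacobi_homog => //; exact: hc.
Qed.

Lemma mode_sum (N : nat) t (X : nat -> nat -> S) (s : nat -> K) : (forall i, fin_supp (X i)) ->
  mode t (fun k => \sum_(i < N) s i *: X i k) = \sum_(i < N) s i *: mode t (X i).
Proof.
move=> hX; elim: N => [|N IH].
  by rewrite big_ord0 -[RHS](mode0 S t); congr mode; apply: funext => k; rewrite big_ord0.
rewrite big_ord_recr /= -IH -mode_lin //.
  by congr mode; apply: funext => k; rewrite big_ord_recr.
elim: N {IH} => [|N [N1 h1]]; first by exists 0%N => k _; rewrite big_ord0.
have [N2 h2] := hX N; exists (maxn N1 N2) => k; rewrite geq_max => /andP[l1 l2].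
by rewrite big_ord_recr /= h1 // h2 // scaler0 addr0.
Qed.

Lemma envp_jacobi_modes t a b c u v w i j : homog a u -> homog b v -> homog c w ->
  envp (mode t (cprod F i (cpol u) (fun k => F j k v w))) -
  eps a b *: envp (mode t (cprod F j (cpol v) (fun k => F i k u w))) =
  \sum_(l < i.+1) ('C(i, l))%:R *:
     envp (mode t (cprod F (j + i - l) (fun k => F l k u v) (cpol w))).
Proof.
move=> hu hv hw; have fF n x y := nice_fin n (F_nice Ftrunc x y).
have := envp_jacobi_elem t i j hu hv hw; rewrite /jacobi_elem.
set X1 := cprod F i _ _; set X2 := cprod F j _ _.
pose X3 l := cprod F (j + i - l) (fun k => F l k u v) (cpol w).
have e : (fun k => X1 k - eps a b *: X2 k - \sum_(l < i.+1) ('C(i, l))%:R *: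
    cprod F (j + i - l) (cprod F l (cpol u) (cpol v)) (cpol w) k) =
  fun k => (X1 k + (- eps a b) *: X2 k) + (-1) *: \sum_(l < i.+1) ('C(i, l))%:R *: X3 l k.
  apply: funext => k; rewrite scaleN1r scaleNr; congr (_ - _); apply: eq_bigr => l _.
  by rewrite (cprod_cpol Fl Fr).
rewrite e {e} /X1 /X2 !(cprod_cpol Fl Fr) {X1 X2}.
have f1 := nice_fin i (nice_cprodr Ftrunc Fl Fr u (fF j v w)).
have f2 := nice_fin j (nice_cprodr Ftrunc Fl Fr v (fF i u w)).
have f3 l : fin_supp (X3 l) by exact: (nice_fin _ (nice_cprodl Ftrunc Fl Fr w (fF l u v))).
have f12 : fin_supp (fun k => cprod F i (cpol u) (fun k => F j k v w) k +
    - eps a b *: cprod F j (cpol v) (fun k => F i k u w) k).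
  have [N h] := f1; have [N' h'] := f2; exists (maxn N N') => k.
  by rewrite geq_max => /andP[l1 l2]; rewrite h // h' // scaler0 addr0.
have f4 : fin_supp (fun k => \sum_(l < i.+1) ('C(i, l))%:R *: X3 l k).
  elim: i.+1 => [|N [N1 h1]]; first by exists 0%N => k _; rewrite big_ord0.
  have [N2 h2] := f3 N; exists (maxn N1 N2) => k; rewrite geq_max => /andP[l1 l2].
  by rewrite big_ord_recr /= h1 // h2 // scaler0 addr0.
rewrite (mode_lin _ _ f12 f4) (mode_lin _ _ f1 f2) (@mode_sum i.+1 t X3 (fun l => ('C(i, l))%:R) f3).
rewrite !(linD envp_linear) !(linZ envp_linear) (lin_sum envp_linear) scaleN1r scaleNr.
move/eqP; rewrite subr_eq0 => /eqP ->; apply: eq_bigr => l _.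
by rewrite (linZ envp_linear).
Qed.

(** The three double brackets become double sums of modes of iterated products. <Jacobi> relates
    these products for each pair of indices, and [tsum_jacobi] matches the binomial weights. *)
Lemma envp_jacobi_gen m p s a b c u v w : homog a u -> homog b v -> homog c w ->
  envp (lbr (lgen m u) (lbr (lgen p v) (lgen s w))) =
  envp (lbr (lbr (lgen m u) (lgen p v)) (lgen s w)) +
  eps a b *: envp (lbr (lgen p v) (lbr (lgen m u) (lgen s w))).
Proof.
move=> hu hv hw; have fF n x y := nice_fin n (F_nice Ftrunc x y).
have nF x y := F_nice Ftrunc x y.
pose T := m + p + s.
pose P1 i j := envp (mode (T - i%:Z - j%:Z) (cprod F i (cpol u) (fun k => F j k v w))).
pose P2 i j := envp (mode (T - i%:Z - j%:Z) (cprod F j (cpol v) (fun k => F i k u w))).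
pose Y l k := envp (mode (T - l%:Z - k%:Z) (cprod F k (fun r => F l r u v) (cpol w))).
have c0r i x : cprod F i (cpol x) (fun _ => 0) = fun _ => 0.
  apply: funext => k; rewrite (cprod_cpoll Fl); apply: big1 => ? _; apply: big1 => ? _.
  by rewrite (F0r Fr) scaler0.
have c0l i x : cprod F i (fun _ => 0) (cpol x) = fun _ => 0.
  by apply: funext => k; rewrite (cprod_cpolr Fr); apply: big1 => ? _; rewrite (F0l Fl) scaler0.
have em0 t : envp (mode t (fun _ => 0)) = 0 by rewrite mode0 (lin0 envp_linear).
have F0 x y : exists N, forall j, (N <= j)%N -> (fun k => F j k x y) = fun _ => 0.
  by have [N h] := nF x y; exists N => j le; apply: funext => k; apply: h; left.
have X0 (X : nat -> nat -> S) : nice X -> exists N, forall i, (N <= i)%N -> X i = fun _ => 0.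
  by case=> N h; exists N => i le; apply: funext => k; apply: h; left.
have n1 : nice2 P1.
  apply: nice2_intro.
    by have [N h] := F0 v w; exists N => j le i; rewrite /P1 h // c0r em0.
  move=> j; have [N h] := X0 _ (nice_cprodr Ftrunc Fl Fr u (fF j v w)); exists N => i le.
  by rewrite /P1 h // em0.
have n2 : nice2 P2.
  apply: (nice2_swap (Y := fun j i => P2 i j)); apply: nice2_intro.
    by have [N h] := F0 u w; exists N => j le i; rewrite /P2 h // c0r em0.
  move=> j; have [N h] := X0 _ (nice_cprodr Ftrunc Fl Fr v (fF j u w)); exists N => i le.
  by rewrite /P2 h // em0.
have nY : nice2 Y.
  apply: (nice2_swap (Y := fun k l => Y l k)); apply: nice2_intro.
    by have [N h] := F0 u v; exists N => j le i; rewrite /Y h // c0l em0.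
  move=> j; have [N h] := X0 _ (nice_cprodl Ftrunc Fl Fr w (fF j u v)); exists N => i le.
  by rewrite /Y h // em0.
have gl x z : is_linear (envp \o lbr (lgen x z)) := lin_comp (lbrr _) envp_linear.
have gr x z : is_linear (fun y => envp (lbr y (lgen x z))) := lin_comp (lbrl _) envp_linear.
have -> : envp (lbr (lgen m u) (lbr (lgen p v) (lgen s w))) =
   tsum (fun i => bz K m i *: tsum (fun j => bz K p j *: P1 i j)).
  rewrite (lbr_gen Ftrunc Fl Fr p) -tsum_exchange //; apply: (etrans (lin_msum p s (gl m u) (nF v w))).
  apply: eq_tsum => j; congr (_ *: _); rewrite /= lbr_gen_mode // (lin_msum _ _ envp_linear).
    apply: eq_tsum => i; congr (_ *: envp (mode _ _)); rewrite /T; lia.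
  exact: nice_cprodr.
have -> : envp (lbr (lgen p v) (lbr (lgen m u) (lgen s w))) =
   tsum (fun i => bz K m i *: tsum (fun j => bz K p j *: P2 i j)).
  rewrite (lbr_gen Ftrunc Fl Fr m); apply: (etrans (lin_msum m s (gl p v) (nF u w))).
  apply: eq_tsum => j; congr (_ *: _); rewrite /= lbr_gen_mode // (lin_msum _ _ envp_linear).
    apply: eq_tsum => i; congr (_ *: envp (mode _ _)); rewrite /T; lia.
  exact: nice_cprodr.
have -> : envp (lbr (lbr (lgen m u) (lgen p v)) (lgen s w)) =
   tsum (fun l => bz K m l *: tsum (fun k => bz K (m + p - l%:Z) k *: Y l k)).
  rewrite (lbr_gen Ftrunc Fl Fr m); apply: (etrans (lin_msum m p (gr s w) (nF u v))).
  apply: eq_tsum => j; congr (_ *: _); rewrite lbr_mode_gen // (lin_msum _ _ envp_linear).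
    apply: eq_tsum => i; congr (_ *: envp (mode _ _)); rewrite /T; lia.
  exact: nice_cprodl.
rewrite -(tsum_jacobi m p nY); apply/eqP; rewrite -subr_eq -scaleNr -tsum2_lin //.
apply/eqP; apply: eq_tsum => i; congr (_ *: _); apply: eq_tsum => j; congr (_ *: _).
rewrite scaleNr /P1 /P2 (envp_jacobi_modes _ _ _ hu hv hw); apply: eq_bigr => l _.
congr (_ *: envp (mode _ _)); have := ltn_ord l; lia.
Qed.

Lemma envp_jacobi a b c x y z :
  envp (lbr (lpr a x) (lbr (lpr b y) (lpr c z))) =
  envp (lbr (lbr (lpr a x) (lpr b y)) (lpr c z)) +
  eps a b *: envp (lbr (lpr b y) (lbr (lpr a x) (lpr c z))).
Proof.
move: x; apply: loop_ext => [||m u].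
- exact: (lin_comp (lbrL a _) envp_linear).
- apply: lin_add; first exact: (lin_comp (lin_comp (lbrL a _) (lbrl _)) envp_linear).
  apply: lin_scale; exact: (lin_comp (lin_comp (lbrL a _) (lbrr _)) envp_linear).
move: y; apply: loop_ext => [||p v].
- exact: (lin_comp (lin_comp (lbrL b _) (lbrr _)) envp_linear).
- apply: lin_add; first exact: (lin_comp (lin_comp (lbrR b _) (lbrl _)) envp_linear).
  apply: lin_scale; exact: (lin_comp (lbrL b _) envp_linear).
move: z; apply: loop_ext => [||s w].
- exact: (lin_comp (lin_comp (lbrR c _) (lbrr _)) envp_linear).
- apply: lin_add; first exact: (lin_comp (lbrR c _) envp_linear).
  apply: lin_scale; exact: (lin_comp (lin_comp (lbrR c _) (lbrr _)) envp_linear).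
rewrite !lpr_gen; apply: envp_jacobi_gen; exact: prH.
Qed.

Let envpL : is_linear envp := envp_linear.

Lemma envp0 x : env_rel x -> envp x = 0. Proof. exact: qproj0. Qed.

(** A mode of <Jacobi> stays among such modes because <Jacobi> is a two-sided ideal. For a
    skew-symmetry relator, the Jacobi identity expresses [[x, y], z] and [[y, x], z] through the
    same two double brackets, and they cancel. *)
Lemma env_rel_ideal_l d e r z : env_rel r -> envp (lbr (lpr d r) (lpr e z)) = 0.
Proof.
case=> [m c A fA jA hA|a b m u p v].
  rewrite (lpr_mode_homog _ _ fA hA); case: eqP => _; last first.
    by rewrite (lin0 (lbrl _)) (lin0 envpL).
  move: z; apply: loop_ext => [||p v]; first exact: (lin_comp (lin_comp (lprL e) (lbrr _)) envpL).
    exact: lin_zero.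
  have nX := nice_cprodl Ftrunc Fl Fr (pr e v) fA.
  rewrite lpr_gen (lbr_mode_gen Ftrunc Fl Fr) // (lin_msum _ _ envpL) //.
  rewrite -[RHS](@tsum0 K env); apply: eq_tsum => i; rewrite envp0 ?scaler0 //.
  apply: (@ErJac _ (c (+) e)); first exact: nice_fin nX.
    by move=> I hI hg; have [_ _ _ _ /(_ _ A i (fin_supp_cpol (pr e v)) (jA I hI hg))[]] := hI.
  apply: cprod_homog => //.
  by apply: cpol_homog; exact: prH.
rewrite -!lpr_gen; set x := lgen m u; set y := lgen p v.
rewrite (linD (lprL d)) (linZ (lprL d)) !lpr_lbr (addbC b).
case: eqP => _; last by rewrite scaler0 addr0 (lin0 (lbrl _)) (lin0 envpL).
rewrite (linD (lbrl _)) (linZ (lbrl _)) (linD envpL) (linZ envpL).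
have J := envp_jacobi.
have := J a b e x y z; have := J b a e y x z.
set A := envp (lbr _ (lbr (lpr a x) _)); set B := envp (lbr _ (lbr (lpr b y) _)).
have -> : eps b a = eps a b :> K by rewrite /eps andbC.
move=> /eqP; rewrite -subr_eq => /eqP <- /eqP; rewrite -subr_eq => /eqP <-.
by rewrite scalerBr scalerA eps_sq; lmod K.
Qed.

Lemma env_rel_ideal_r d e r z : env_rel r -> envp (lbr (lpr e z) (lpr d r)) = 0.
Proof.
move=> hr; rewrite envp_skew env_rel_ideal_l ?scaler0 //.
Qed.

(** The indices select the parity components to be bracketed, so vectors of [env] need not be
    homogeneous and [a], [b] match the parity bits of the letters. *)
Definition ebr (a b : bool) : env -> env -> env :=
  qlift2 (Q := env_rel) (fun x y => envp (lbr (lpr a x) (lpr b y))).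

Let ebrl0 a b y : is_linear (fun x => envp (lbr (lpr a x) (lpr b y))).
Proof. exact: (lin_comp (lin_comp (lprL a) (lbrl _)) envpL). Qed.
Let ebrr0 a b x : is_linear (fun y => envp (lbr (lpr a x) (lpr b y))).
Proof. exact: (lin_comp (lin_comp (lprL b) (lbrr _)) envpL). Qed.

Lemma ebrE a b x y : ebr a b (envp x) (envp y) = envp (lbr (lpr a x) (lpr b y)).
Proof.
by apply: qlift2E => // *; [apply: env_rel_ideal_l|apply: env_rel_ideal_r].
Qed.
Lemma ebr_linl a b y : is_linear (fun x => ebr a b x y).
Proof.
by apply: qlift2_linl => // *; [apply: env_rel_ideal_l|apply: env_rel_ideal_r].
Qed.
Lemma ebr_linr a b x : is_linear (ebr a b x).
Proof.
by apply: qlift2_linr => // *; [apply: env_rel_ideal_l|apply: env_rel_ideal_r].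
Qed.

Lemma ebr_skew a b x y : ebr a b x y = - eps a b *: ebr b a y x.
Proof.
move: x; apply: quot_ind => x; move: y; apply: quot_ind => y.
by rewrite !ebrE envp_skew.
Qed.

Lemma ebr_jacobi a b c x y z :
  ebr (a (+) b) c (ebr a b x y) z =
  ebr a (b (+) c) x (ebr b c y z) - eps a b *: ebr b (a (+) c) y (ebr a c x z).
Proof.
move: x; apply: quot_ind => x; move: y; apply: quot_ind => y; move: z; apply: quot_ind => z.
rewrite !ebrE !lpr_lbr !eqxx.
by rewrite (envp_jacobi a b c x y z) addrK.
Qed.

Definition lpp : loop -> loop := llift (fun n u => if 0 <= n then lgen n u else 0).

Let lpp_phi n : is_linear (fun u : S => if 0 <= n then lgen n u else 0).
Proof. exact: (lin_if _ (@lgen_lin K S n)). Qed.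
Lemma lpp_linear : is_linear lpp. Proof. exact: llift_linear lpp_phi. Qed.
Lemma lpp_gen n u : lpp (lgen n u) = if 0 <= n then lgen n u else 0.
Proof. exact: (llift_gen lpp_phi). Qed.

(** Each mode A_m lies in one half of the loop space: for m >= 0 the terms of index m - k < 0 carry
    a falling factorial that vanishes. *)
Lemma lpp_mode m (A : nat -> S) : fin_supp A -> lpp (mode m A) = if 0 <= m then mode m A else 0.
Proof.
move=> fA; apply: (etrans (llift_mode m lpp_phi fA)).
case: ifP => m0; last rewrite -[RHS](@tsum0 K loop); apply: eq_tsum => k.
  case: ifP => // mk.
  have -> : m = (absz m)%:Z by lia.
  by rewrite dcoef_binz binz_nat_eq0 ?mulr0 ?scale0r //; lia.
by rewrite (_ : (0 <= m - k%:Z) = false) ?scaler0 //; lia.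
Qed.

Lemma lpp_lpr a x : lpr a (lpp x) = lpp (lpr a x).
Proof.
move: x; apply: loop_ext => [||n u]; [exact: lin_comp lpp_linear (lprL a)|exact: lin_comp (lprL a) lpp_linear|].
by rewrite lpr_gen !lpp_gen; case: ifP; rewrite ?lpr_gen // (lin0 (lprL a)).
Qed.

Lemma env_rel_sdef a b u v r p q : envp (sdef F (eps a b) (pr a u) (pr b v) r p q) = 0.
Proof.
apply: (sdef_kills Ftrunc (e := eps a b) (u := pr a u) (v := pr b v) envpL) => {}p {}q.
rewrite (sdef0 Ftrunc Fl Fr); apply: envp0; exact: ErSkew.
Qed.

(** A skew-symmetry relator may have terms in both halves, so it is first expanded into the defects
    [sdef r 0 q]. Each of these lies in the half given by the sign of q, because the terms q - i < 0
    <= q carry a zero binomial. *)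
Lemma env_rel_lpp r : env_rel r -> envp (lpp r) = 0.
Proof.
case=> [m c A fA jA hA|a b m u p v].
  rewrite lpp_mode //; case: ifP => _; last exact: lin0.
  apply: envp0; exact: (@ErJac _ c).
rewrite -(sdef0 Ftrunc Fl Fr); move: m p.
apply: (sdef0_kills Ftrunc _ (f := envp \o lpp)); first exact: lin_comp lpp_linear envpL.
move=> r' q; rewrite (@lin_sdef _ _ _ Ftrunc _ _ _ _ _ (fun x => if 0 <= q then envp x else 0)).
- by case: ifP => // _; apply: env_rel_sdef.
- exact: lin_comp lpp_linear envpL.
- exact: lin_if.
move=> s i A hs fA /=; rewrite lpp_mode //.
have [q0|q0] := ifP (0 <= q); last first.
  by rewrite (_ : (0 <= q - i%:Z) = false) ?(lin0 envpL) //; lia.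
case: ifP => // qi; rewrite (_ : bz K s i = 0) ?scale0r //.
case: hs => ->; first by case: i qi => [|i] //; rewrite subr0 q0.
have -> : q = (absz q)%:Z by lia.
by rewrite /bz binz_nat_eq0 //; lia.
Qed.

Definition epp : env -> env := plift (envp \o lpp).
Lemma epp_kills : kills (quot_rel env_rel) (envp \o lpp).
Proof. by apply: quot_kills; [exact: lin_comp lpp_linear envpL|exact: env_rel_lpp]. Qed.
Lemma eppE x : epp (envp x) = envp (lpp x). Proof. exact: plift_gen epp_kills. Qed.
Lemma epp_linear : is_linear epp. Proof. exact: plift_linear epp_kills. Qed.

Definition epm (x : env) := x - epp x.
Lemma epm_linear : is_linear epm.
Proof. by apply: lin_add => //; apply: lin_opp; apply: epp_linear. Qed.
Lemma epmE x : epm (envp x) = envp (x - lpp x).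
Proof. by rewrite /epm eppE (linB envpL). Qed.

Lemma epm_epp x : epm (epp x) = 0.
Proof.
move: x; apply: quot_ind => x; rewrite eppE epmE.
suff -> : lpp (lpp x) = lpp x by rewrite subrr (lin0 envpL).
move: x; apply: loop_ext => [||n u]; [exact: lin_comp lpp_linear lpp_linear|exact: lpp_linear|].
by rewrite lpp_gen; case: ifP => h; rewrite ?lpp_gen ?h // (lin0 lpp_linear).
Qed.

Lemma lpp_msum m p X : nice X -> (0 <= m) = (0 <= p) ->
  lpp (msum m p X) = if 0 <= m then msum m p X else 0.
Proof.
move=> nX mp; rewrite (lin_msum _ _ lpp_linear) //.
case: ifP => m0; last rewrite -[RHS](@tsum0 K loop); apply: eq_tsum => i;
  rewrite lpp_mode; try exact: nice_fin nX.
  case: ifP => // h; rewrite (_ : bz K m i = 0) ?scale0r //.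
  have -> : m = (absz m)%:Z by lia.
  by rewrite /bz binz_nat_eq0 //; lia.
by rewrite (_ : (0 <= _ - _) = false) ?scaler0 //; lia.
Qed.

Lemma epm_ebr a b x y : epm (ebr a b (epp x) (epp y)) = 0.
Proof.
move: x; apply: quot_ind => x; move: y; apply: quot_ind => y.
rewrite !eppE ebrE epmE !lpp_lpr -[RHS](lin0 envpL); congr envp.
apply/eqP; rewrite subr_eq0 eq_sym; apply/eqP.
have L z : is_linear (fun x => lbr (lpp (lpr a x)) z).
  exact: lin_comp (lin_comp (lprL a) lpp_linear) (lbrl _).
have L' z : is_linear (fun y => lbr z (lpp (lpr b y))).
  exact: lin_comp (lin_comp (lprL b) lpp_linear) (lbrr _).
move: x; apply: loop_ext => [||m u]; [exact: lin_comp (L _) lpp_linear|exact: L|].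
move: y; apply: loop_ext => [||p v]; [exact: lin_comp (L' _) lpp_linear|exact: L'|].
rewrite !lpr_gen !lpp_gen; case: ifP => m0; last by rewrite (lin0 (lbrl _)) (lin0 lpp_linear).
case: ifP => p0; last by rewrite (lin0 (lbrr _)) (lin0 lpp_linear).
rewrite (lbr_gen Ftrunc Fl Fr) lpp_msum ?m0 ?p0 //; exact: F_nice.
Qed.

Lemma epp_ebr a b x y : epp (ebr a b (epm x) (epm y)) = 0.
Proof.
move: x; apply: quot_ind => x; move: y; apply: quot_ind => y.
rewrite !epmE ebrE eppE !(linB (lprL _)) !lpp_lpr -[RHS](lin0 envpL); congr envp.
pose m1 x := x - lpp x; rewrite -[lpr a x - _]/(m1 _) -[lpr b y - _]/(m1 _).
have mL : is_linear m1 by apply: lin_add => //; apply: lin_opp; apply: lpp_linear.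
have L z : is_linear (fun x => lbr (m1 (lpr a x)) z).
  exact: lin_comp (lin_comp (lprL a) mL) (lbrl _).
have L' z : is_linear (fun y => lbr z (m1 (lpr b y))).
  exact: lin_comp (lin_comp (lprL b) mL) (lbrr _).
move: x; apply: loop_ext => [||m u]; [exact: lin_comp (L _) lpp_linear|exact: lin_zero|].
move: y; apply: loop_ext => [||p v]; [exact: lin_comp (L' _) lpp_linear|exact: lin_zero|].
rewrite !lpr_gen /m1 !lpp_gen; case: ifP => m0; first by rewrite subrr (lin0 (lbrl _)) (lin0 lpp_linear).
case: ifP => p0; first by rewrite subrr (lin0 (lbrr _)) (lin0 lpp_linear).
rewrite !subr0 (lbr_gen Ftrunc Fl Fr) lpp_msum ?m0 ?p0 //; exact: F_nice.
Qed.

Definition lrho : loop -> S := llift (fun n u => if n == -1 then u else 0).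

Let lrho_phi (n : int) : is_linear (fun u : S => if n == -1 then u else 0).
Proof. exact: lin_if (@lin_id K S). Qed.
Lemma lrho_linear : is_linear lrho. Proof. exact: llift_linear lrho_phi. Qed.

(** A term with k > 0 has index -1 only for m = k - 1 >= 0, where the falling factorial is zero. So
    only the D^0 coefficient of A is seen, and <Jacobi> dies by [HJ]. *)
Lemma lrho_mode m (A : nat -> S) : fin_supp A -> lrho (mode m A) = if m == -1 then A 0%N else 0.
Proof.
move=> fA; apply: (etrans (llift_mode m lrho_phi fA)).
rewrite (@tsum1 _ _ _ 0) => [|k k0]; first by rewrite /dcoef big_ord0 expr0 mulr1 scale1r subr0.
case: eqP => e; last by rewrite scaler0.
have -> : m = (absz m)%:Z by move: k0; case: k e => // k; lia.
by rewrite dcoef_binz binz_nat_eq0 ?mulr0 ?scale0r //; move: k0; case: k e => // k; lia.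
Qed.

Lemma env_rel_lrho r : env_rel r -> lrho r = 0.
Proof.
case=> [m c A fA jA hA|a b m u p v].
  by rewrite lrho_mode // (HJ jA); case: ifP.
rewrite -(sdef0 Ftrunc Fl Fr); move: m p.
apply: (sdef0_kills Ftrunc _ (f := lrho)) => [|r' q]; first exact: lrho_linear.
have fF n x y := nice_fin n (F_nice Ftrunc x y).
rewrite /sdef (linD lrho_linear) (linZ lrho_linear) !(lin_smode Ftrunc _ _ _ _ _ lrho_linear).
have e s x y : s = 0 \/ s = q -> tsum (fun i => bz K s i *:
     lrho (mode (q - i%:Z) (fun k => F (i + r')%N k x y))) = if q == -1 then F r' 0%N x y else 0.
  move=> hs; rewrite (@tsum1 _ _ _ 0) => [|i i0].
    by rewrite bz0 scale1r subr0 lrho_mode.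
  rewrite lrho_mode //; case: eqP => ei; last by rewrite scaler0.
  rewrite (_ : bz K s i = 0) ?scale0r //; case: i i0 ei => // i _ ei.
  case: hs => ->; first exact: bz0S.
  have -> : q = (absz q)%:Z by lia.
  by rewrite /bz binz_nat_eq0 //; lia.
rewrite addr0 add0r !e; auto.
case: eqP => _; last by rewrite scaler0 addr0.
by rewrite (Hskew r' (prH a u) (prH b v)) scaleNr addNr.
Qed.

Definition erho : env -> S := plift lrho.
Lemma erho_kills : kills (quot_rel env_rel) lrho.
Proof. by apply: quot_kills; [exact: lrho_linear|exact: env_rel_lrho]. Qed.
Lemma erhoE x : erho (envp x) = lrho x. Proof. exact: plift_gen erho_kills. Qed.
Lemma erho_linear : is_linear erho. Proof. exact: plift_linear erho_kills. Qed.

(* Descends to a linear form on the vacuum module that sends [u_(-1) 1] to [u]. *)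
Definition eform : seq (bool * env) -> S := vacuum_form ebr
  epm epp erho.

Lemma eform_multilinear : multilinear eform.
Proof. exact: (vacuum_form_multilinear ebr_linl ebr_linr epm_linear epp_linear erho_linear). Qed.

Lemma eform_commutes : commutes ebr eform eform.
Proof.
apply: (vacuum_form_commutes ebr_linl ebr_linr _ _ epm_linear epp_linear _ _ _ _ erho_linear).
- exact: ebr_skew.
- exact: ebr_jacobi.
- by move=> x; rewrite /epm subrK.
- exact: epm_epp.
- exact: epm_ebr.
- exact: epp_ebr.
Qed.

Definition eletter (l : bool * int * S) : bool * env :=
  (l.1.1, envp (lgen l.1.2 (pr l.1.1 l.2))).

Definition wform (w : seq (bool * int * S)) : S := eform (map eletter w).

Lemma eform_linear p a r : is_linear (fun x => eform (p ++ (a, envp x) :: r)).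
Proof. by move=> c x y; rewrite envpL eform_multilinear. Qed.

(** [BrComm] is the exchange rule of [eform] with the bracket written out in modes. [BrVac] holds
    because a letter with n >= 0 has no negative part. *)
Lemma wform_kills : kills (vm_rel pr F) wform.
Proof.
apply: vm_killsP => p t; case=> [b n c u v r|a m u b q v r N hN|b n u r|b n u n0] /=;
  rewrite /wform !map_cat /=.
- rewrite /eletter /= (prL b) lgen_lin envpL eform_multilinear scaleN1r subrr //.
- rewrite eform_commutes scaleN1r; apply/eqP; rewrite subr_eq0; apply/eqP; congr (_ + _).
  rewrite ext_sum /brl /eletter /= ebrE.
  rewrite !lpr_gen !pr_pr !eqxx (lbr_gen Ftrunc Fl Fr).
  rewrite (lin_msum _ _ (eform_linear _ _ _) (F_nice Ftrunc _ _)) (@tsumE _ _ N) => [|i le].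
    apply: eq_bigr => i _; rewrite ext_sum.
    have e := lin_tsum (eform_linear (map eletter p) (a (+) b) (map eletter r)).
    rewrite /mode e; last first.
      exact: (mode_ez _ (nice_fin i (F_nice Ftrunc (pr a u) (pr b v)))).
    rewrite (@tsumE _ _ N) => [|k le] /=.
      rewrite scaler_sumr; apply: eq_bigr => k _ /=.
      rewrite (linZ (eform_linear _ _ _)) scalerA /wform map_cat /= /eletter /=.
      congr (_ *: eform (_ ++ (_, envp (lgen _ _)) :: _)).
      by apply: esym; apply: pr_id; apply: Fpar; apply: prH.
    rewrite hN; last by right.
    by rewrite (lin0 (@lgen_lin K S _)) scaler0 (lin0 (eform_linear _ _ _)).
  rewrite (_ : (fun k => F i k (pr a u) (pr b v)) = fun _ => 0); last first.
    by apply: funext => k; apply: hN; left.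
  by rewrite mode0 (lin0 (eform_linear _ _ _)) scaler0.
- by rewrite /eletter /= pr_pr eqxx scaleN1r subrr.
- apply: (vacuum_form_last ebr_linl ebr_linr epm_linear epp_linear erho_linear); rewrite /= epmE.
  by rewrite lpp_gen n0 subrr (lin0 envpL).
Qed.

(** The form recovers from the state of [agen s] in parity [c] the component [pr c s], since u_(-1)
    is a negative mode and [lrho] returns u on it. *)
Lemma agen_injective : injective (agen pr F).
Proof.
have e c s : plift wform (opr c s (-1) (vac pr F)) = pr c s.
  rewrite opr_gen /vgen (plift_gen _ wform_kills) /wform /= /eform vacuum_form1 /eletter /=.
  rewrite epmE lpp_gen subr0.
  rewrite erhoE.
  by rewrite /lrho llift_gen //= => n; apply: lin_if.
move=> s s' h; rewrite (prD s) (prD s') -!e -!ast_gen h //.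
Qed.

End EnvelopingAlgebra.

Lemma formula_truncation (K : fieldType) (S : lmodType K) (F : nat -> nat -> S -> S -> S) :
  (forall n u v, exists N, forall k, (N <= k)%N -> F n k u v = 0) ->
  (forall u v, exists N, forall n k, (N <= n)%N -> F n k u v = 0) ->
  forall u v, exists N, forall n k, (N <= n)%N \/ (N <= k)%N -> F n k u v = 0.
Proof.
move=> hk hn u v; have [N h] := hn u v.
have [N' h'] : exists N', forall n k, (n < N)%N -> (N' <= k)%N -> F n k u v = 0.
  elim: N {h} => [|N [N1 h1]]; first by exists 0%N.
  have [N2 h2] := hk N u v; exists (maxn N1 N2) => n k; rewrite ltnS leq_eqVlt geq_max.
  by case/orP => [/eqP -> /andP[_ /h2]|lt /andP[le _]] //; apply: h1.
exists (maxn N N') => n k; rewrite !geq_max => -[/andP[l1 l2]|/andP[l1 l2]]; first exact: h.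
by have [lt|le] := ltnP n N; [apply: h'|apply: h].
Qed.

Theorem theorem7p9 (R : realType) (S : lmodType R[i]) (S0 S1 : S -> Prop)
    (F : nat -> nat -> S -> S -> S) :
  is_formula S0 S1 F ->
  (* <Jacobi> is contained in D C[D] (x) S *)
  (forall x, jacobi_ideal S0 S1 F x -> x 0%N = 0) ->
  (* skew-symmetry of the D^0-components *)
  (forall (a b : bool) (u v : S) (n : nat),
     homog S0 S1 a u -> homog S0 S1 b v ->
     F n 0%N u v = - (eps a b * (-1) ^+ n) *: F n 0%N v u) ->
  (exists (V : vsa R[i]) (phi : S -> vs_car V), good_pair S0 S1 F phi)
  /\ (exists (U : vsa R[i]) (iota : S -> vs_car U),
        good_pair S0 S1 F iota /\
        forall (V : vsa R[i]) (phi : S -> vs_car V), good_pair S0 S1 F phi ->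
          exists f : vs_car U -> vs_car V,
            [/\ vsa_hom f, (forall y, exists x, f x = y) & forall s, f (iota s) = phi s])
  /\ (forall (V : vsa R[i]) (phi : S -> vs_car V), good_pair S0 S1 F phi ->
        forall (u v : S) (n N : nat), (forall k, (N <= k)%N -> F n k u v = 0) ->
          vs_prod V (n%:Z) (phi u) (phi v)
          = \sum_(k < N) iter k (vs_D V) (phi (F n k u v))).
Proof.
move=> [grS [Fl Fr] Fpar hk hn] HJ Hskew.
have Ftrunc := formula_truncation hk hn.
have [pr [prL prD prH pr_id pr_pr]] := grading_proj grS.
have hom := agen_formula_hom Ftrunc Fl Fr prL prD prH pr_id pr_pr Fpar.
have good : good_pair S0 S1 F (V := alg_as_vsa Ftrunc pr_pr) (agen pr F).
  split; [exact: hom| |exact: alg_generated|exact: formula_hom_commutator hom].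
  exact: (agen_injective Ftrunc Fl Fr prL prH pr_id pr_pr Fpar prD HJ Hskew).
split; first by exists (alg_as_vsa Ftrunc pr_pr), (agen pr F).
split; last by move=> V phi [[_ _ h] _ _ _].
exists (alg_as_vsa Ftrunc pr_pr), (agen pr F); split=> // V phi gphi.
exists (alg_map phi); split.
- exact: alg_map_hom.
- exact: (alg_map_onto Ftrunc prL prD prH pr_id pr_pr Fpar gphi).
- exact: (alg_map_gen prL prD prH pr_id pr_pr Fpar gphi).
Qed.
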